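(* For every integer $n\ge 3$ there is a circularly slit disk $\Omega\subset\mathbb{D}$ of connectivity $n$ (in particular $0\in\Omega$) such that $\Omega$ is the extremal domain, unique up to rotation about the origin, for the squeezing problem for $\Omega$ and the point $z=0$. That is, $S_\Omega(0)=\operatorname{dist}(0,\partial\Omega)$, and whenever $f\in\mathcal{U}(\Omega)$ satisfies $f(0)=0$ and $\operatorname{dist}(0,\partial f(\Omega))=S_\Omega(0)$, one has $f(\Omega)=e^{i\theta}\Omega$ for some $\theta\in\mathbb{R}$.
   Context: $\mathbb{D}=\{z\in\mathbb{C}:|z|<1\}$ is the unit disk. For a domain $\Omega\subset\mathbb{C}$, $\mathcal{U}(\Omega)$ denotes the class of all injective holomorphic functions $f:\Omega\to\mathbb{D}$. When $\mathcal{U}(\Omega)\neq\emptyset$, the squeezing function $S_\Omega:\Omega\to\mathbb{R}$ is defined by $$S_\Omega(z)=\sup\{\operatorname{dist}(0,\partial f(\Omega)):\ f\in\mathcal{U}(\Omega),\ f(z)=0\}.$$ A function $f\in\mathcal{U}(\Omega)$ with $f(z)=0$ and $\operatorname{dist}(0,\partial f(\Omega))=S_\Omega(z)$ is called extremal for the squeezing problem for the point $z\in\Omega$, and its image $f(\Omega)$ is called an extremal domain. A circularly slit disk of connectivity $n$ is a domain of the form $\mathbb{D}\setminus\bigcup_{j=1}^{n-1}C_j$, where $C_1,\dots,C_{n-1}$ are pairwise disjoint closed (non-degenerate, proper) arcs of circles centered at $0$ with radii in $(0,1)$ (different arcs may lie on the same circle or on different circles). *)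

(* Defs.v *)
From HB Require Import structures.
From mathcomp Require Import all_boot all_order all_algebra.
From mathcomp Require Import all_classical all_reals all_analysis.
From mathcomp Require Import complex.

Set Implicit Arguments.
Unset Strict Implicit.
Unset Printing Implicit Defensive.

Import Order.TTheory GRing.Theory Num.Theory.
Import numFieldNormedType.Exports.
Import ComplexField.Normc.

Local Open Scope classical_set_scope.
Local Open Scope ring_scope.

(* R[i] is only known to the algebraic libraries; it receives the topology and
   norm that every numFieldType carries as a normed module over itself.  In
   particular [derivable] below is differentiability over the field R[i]. *)
HB.instance Definition _ (R : rcfType) := NormedModule.copy R[i] R[i]^o.

Section ComplexPlane.
Context {R : realType}.
Implicit Types (A : set R[i]) (z : R[i]).

(* [normc z : R] is the modulus as a real number: `|z| = (normc z)%:C. *)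
Definition unit_disk : set R[i] := [set z | normc z < 1].

Definition expi (t : R) : R[i] := (cos t +i* sin t)%C.

Definition rotate (t : R) A : set R[i] := [set expi t * z | z in A].

Definition boundary A : set R[i] := closure A `\` A°.

Definition dist z A : R := inf [set normc (z - w) | w in A].

Definition domain A : Prop := [/\ open A, connected A & A !=set0].

End ComplexPlane.

Section Squeezing.
Context {R : realType}.
Implicit Types (Omega : set R[i]) (z : R[i]) (f : R[i] -> R[i]).

(* Maps on Omega are total functions; their values outside Omega are
   irrelevant, Omega being open. *)
Definition holomorphic_on Omega f : Prop :=
  forall z, Omega z -> derivable f z 1.

Definition injective_on Omega f : Prop :=
  forall z w, Omega z -> Omega w -> f z = f w -> z = w.

Definition univalent_to_disk Omega : set (R[i] -> R[i]) :=
  [set f | [/\ holomorphic_on Omega f, injective_on Omega f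
             & f @` Omega `<=` unit_disk]].

(* Meaningful for a domain Omega with [univalent_to_disk Omega] nonempty: then
   the set of distances is nonempty and bounded by 1, so that [sup] is the
   genuine least upper bound. *)
Definition squeezing Omega z : R :=
  sup [set dist 0 (boundary (f @` Omega))
        | f in [set f | univalent_to_disk Omega f /\ f z = 0]].

Definition extremal Omega z f : Prop :=
  [/\ univalent_to_disk Omega f, f z = 0
    & dist 0 (boundary (f @` Omega)) = squeezing Omega z].

Definition extremal_domain Omega z (D : set R[i]) : Prop :=
  exists2 f, extremal Omega z f & D = f @` Omega.

End Squeezing.

Section SlitDisks.
Context {R : realType}.

Definition circular_arc (r a b : R) : set R[i] :=
  [set r%:C%C * expi t | t in `[a, b]].

(* The bounds on b exclude single points and full circles. *)
Definition circular_slit (C : set R[i]) : Prop :=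
  exists r a b : R,
    [/\ 0 < r < 1, a < b < a + 2 * pi & C = circular_arc r a b].

Definition circularly_slit_disk (n : nat) (Omega : set R[i]) : Prop :=
  domain Omega /\
  exists C : 'I_n.-1 -> set R[i],
    [/\ forall j, circular_slit (C j),
        forall i j, i != j -> C i `&` C j = set0
      & Omega = unit_disk `\` \bigcup_j C j].

End SlitDisks.

(* Main.v *)
Require Import Defs.
From HB Require Import structures.
From mathcomp Require Import all_boot all_order all_algebra.
From mathcomp Require Import all_classical all_reals all_analysis.
From mathcomp Require Import complex ring lra zify.
Set Implicit Arguments.
Unset Strict Implicit.
Unset Printing Implicit Defensive.
Import Order.TTheory GRing.Theory Num.Theory.
Import numFieldNormedType.Exports.
Import ComplexField.Normc.
Local Open Scope classical_set_scope.
Local Open Scope ring_scope.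

Local Notation Re := complex.Re.
Local Notation Im := complex.Im.

(* Omega is the unit disk minus n - 1 very short slits on |z| = 1/2.  Let f be
   univalent on Omega with f 0 = 0 and dist (0, boundary of f(Omega)) >= 1/2, and
   write f z = z F z; the point is that F is a constant of modulus 1.
   Near the slits |z| is about 1/2 and |f z| is asymptotically at least 1/2, as
   f(Omega) contains the disk of radius 1/2; so v = max (- ln |F|) 0, extended by 0
   across the slits, is continuous and subharmonic, and its means over the circles
   |z| = r increase with r.  On 1/2 < r < 1 the mean of ln |F| is an affine function
   of ln r with an integer slope.  The slope is not negative: the circle means of
   the subharmonic function max (ln |F^K P|) (ln k) increase, where the polynomial
   P has one zero on each slit, and the slits are so short that this function is
   constant near them.  Hence the means of max (ln |F|) 0 = v + ln |F| increase
   too; as |f| < 1 they tend to 0 at the unit circle, so |F| <= 1 for |z| > 1/2, and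
   the means of v are constant there.  Averaging v over a small circle around a
   slit point, where v = 0, then forces v to vanish somewhere in |z| > 1/2.  At
   such a point |F| = 1, and the maximum principle makes F constant. *)

(** One rigidity statement carries the theorem: it assumes only distance at least 1/2, so it bounds
    the squeezing function by 1/2 as well as identifying the extremal maps, and no existence theorem
    for extremal maps is called upon. The obstacle is that f has no boundary values on the slits and
    might permute the boundary components; all that is known there is that |f| is at least 1/2 in
    the limit, whence the truncation in v. A permutation moving the unit circle would show up as
    slope -1 of the mean of ln |F|, because f would then have winding number 0 about the origin
    along circles near |z| = 1. As the slope n is an integer, a rough bound excludes this: if q is
    the winding number of P on the outer annulus and K > |q|, then K n + q >= 0 forces n >= 0. On
    the outer annulus |F| >= 1/2 and near the slits |F| <= 4, so a level k separates the two regimes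
    once |P| is small enough on the slits. This fixes the length of the slits from n alone, before f
    is chosen. *)

(** * Modulus, continuity and compactness in the complex plane *)

Section PlaneTopology.
Context {R : realType}.
Local Notation C := R[i].
Implicit Types (z w : C) (A : set C).

Lemma normrE z : `|z| = (normc z)%:C%C.
Proof. by []. Qed.

Lemma normc_ge0 z : 0 <= normc z.
Proof. by case: z => a b /=; exact: sqrtr_ge0. Qed.

Lemma normc_eq0 z : (normc z == 0) = (z == 0).
Proof.
apply/eqP/eqP => [/eq0_normc//|->]; exact: normc0.
Qed.

Lemma normc_gt0 z : (0 < normc z) = (z != 0).
Proof. by rewrite lt_neqAle normc_ge0 andbT eq_sym normc_eq0. Qed.

Lemma normcN z : normc (- z) = normc z.
Proof. by case: z => a b /=; rewrite !sqrrN. Qed.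

Lemma normcBC z w : normc (z - w) = normc (w - z).
Proof. by rewrite -normcN opprB. Qed.

Lemma normcD z w : normc (z + w) <= normc z + normc w.
Proof. by rewrite -lecR -normrE rmorphD /= -!normrE; exact: ler_normD. Qed.

Lemma normcB_ge z w : normc z - normc w <= normc (z - w).
Proof. by rewrite lerBlDr; apply: le_trans (normcD _ _); rewrite subrK. Qed.

Lemma normcB_tri w z t : normc (z - t) <= normc (z - w) + normc (w - t).
Proof. by apply: le_trans (normcD _ _); rewrite addrA subrK. Qed.

Lemma normcX z n : normc (z ^+ n) = normc z ^+ n.
Proof. by elim: n => [|n IH]; rewrite ?normc1// !exprS normcM IH. Qed.

Lemma normc_real (x : R) : normc x%:C%C = `|x|.
Proof. by rewrite /= expr0n addr0 sqrtr_sqr. Qed.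

Lemma sqr_normc z : normc z ^+ 2 = Re z ^+ 2 + Im z ^+ 2.
Proof. by case: z => a b /=; rewrite sqr_sqrtr// addr_ge0// sqr_ge0. Qed.

Lemma Re_le_normc z : `|Re z| <= normc z.
Proof.
rewrite -ler_sqr ?nnegrE ?normc_ge0// sqr_normc real_normK ?num_real//.
by rewrite lerDl sqr_ge0.
Qed.

Lemma Im_le_normc z : `|Im z| <= normc z.
Proof.
rewrite -ler_sqr ?nnegrE ?normc_ge0// sqr_normc real_normK ?num_real//.
by rewrite lerDr sqr_ge0.
Qed.

Lemma normc_le_ReIm z : normc z <= `|Re z| + `|Im z|.
Proof.
rewrite -ler_sqr ?nnegrE ?normc_ge0 ?addr_ge0// sqr_normc sqrrD.
rewrite !real_normK ?num_real// addrAC lerDl mulrn_wge0// mulr_ge0//.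
Qed.

(** The norm of [R[i]] takes its values in [R[i]], so balls have complex radii; a positive one is
    real, which gives radii in [R]. *)
Lemma nbhs_normcP z A :
  nbhs z A <-> exists2 e : R, 0 < e & forall w, normc (w - z) < e -> A w.
Proof.
split=> [/nbhs_ballP[e /= e0 eA]|[e e0 eA]].
  have Ree : e = (Re e)%:C%C by rewrite RRe_real// gtr0_real.
  exists (Re e); first by rewrite -ltcR -Ree.
  by move=> w zw; apply: eA; rewrite -ball_normE /= normrE Ree ltcR normcBC.
apply/nbhs_ballP; exists e%:C%C; first by rewrite /= ltcR.
by move=> w; rewrite -ball_normE /= normrE ltcR normcBC; exact: eA.
Qed.

Lemma continuous_ReIm (T : topologicalType) (f : T -> C) x :
  {for x, continuous f} <->
  {for x, continuous (fun y => Re (f y))} /\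
  {for x, continuous (fun y => Im (f y))}.
Proof.
split=> [cf|[cR cI]].
  split; apply/cvgrPdist_lt => e e0; near=> y.
    rewrite -raddfB; apply: le_lt_trans (Re_le_normc _) _.
    rewrite normcBC; near: y; apply: (cf [set w | normc (w - f x) < e]);
    by apply/nbhs_normcP; exists e.
  rewrite -raddfB; apply: le_lt_trans (Im_le_normc _) _.
  rewrite normcBC; near: y; apply: (cf [set w | normc (w - f x) < e]);
    by apply/nbhs_normcP; exists e.
move=> A /nbhs_normcP[e e0 eA]; rewrite nbhs_filterE /=; near=> y.
apply: eA; apply: le_lt_trans (normc_le_ReIm _) _.
rewrite (splitr e) !raddfB /= ltrD//.
  by near: y; move/cvgrPdistC_lt : cR; apply; rewrite divr_gt0.
by near: y; move/cvgrPdistC_lt : cI; apply; rewrite divr_gt0.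
Unshelve. all: by end_near. Qed.

Lemma continuous_Re : continuous (@complex.Re R : C -> R).
Proof. by move=> z; have [] := (@continuous_ReIm _ id z).1 cvg_id. Qed.

Lemma continuous_Im : continuous (@complex.Im R : C -> R).
Proof. by move=> z; have [] := (@continuous_ReIm _ id z).1 cvg_id. Qed.

Lemma continuous_CRP (f : C -> R) z :
  {for z, continuous f} <-> forall e : R, 0 < e ->
  exists2 d : R, 0 < d & forall w, normc (w - z) < d -> `|f w - f z| < e.
Proof.
have FF : Filter (nbhs z) by exact _.
split=> [cf e e0|cf].
  by move/(@cvgrPdistC_lt _ _ _ (nbhs z) FF) : cf => /(_ _ e0) /nbhs_normcP.
apply/(@cvgrPdistC_lt _ _ _ (nbhs z) FF) => e e0.
by apply/nbhs_normcP; exact: cf.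
Qed.

Lemma continuous_CCP (f : C -> C) z :
  {for z, continuous f} <-> forall e : R, 0 < e ->
  exists2 d : R, 0 < d & forall w, normc (w - z) < d -> normc (f w - f z) < e.
Proof.
split=> [cf e e0|cf A /nbhs_normcP[e e0 eA]].
  have : nbhs (f z) [set w | normc (w - f z) < e].
    by apply/nbhs_normcP; exists e.
  by move=> /cf /nbhs_normcP.
have [d d0 dP] := cf _ e0; apply/nbhs_normcP; exists d => // w wz.
by apply: eA; exact: dP.
Qed.

Lemma continuous_normc : continuous (@normc R : C -> R).
Proof.
move=> z; apply/continuous_CRP => e e0; exists e => // w.
apply: le_lt_trans; rewrite ler_norml normcB_ge andbT.
by rewrite lerNl opprB normcBC normcB_ge.
Qed.

Lemma continuous_normcB z : continuous (fun w => normc (w - z)).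
Proof.
move=> t; apply/continuous_CRP => e e0; exists e => // w.
have -> : w - t = (w - z) - (t - z) by rewrite opprB addrA subrK.
apply: le_lt_trans; rewrite ler_norml normcB_ge andbT.
by rewrite lerNl opprB [X in _ <= X]normcBC normcB_ge.
Qed.

Lemma continuous_normcE (T : topologicalType) (f : T -> C) x :
  {for x, continuous f} -> {for x, continuous (fun y => normc (f y))}.
Proof.
by move=> cf; exact: (@continuous_comp _ _ _ f (@normc R) x cf (@continuous_normc _)).
Qed.

Lemma continuous_real_complex : continuous (fun x : R => x%:C%C : C).
Proof.
move=> x; apply/continuous_ReIm; split => /=; first exact: cvg_id.
exact: cvg_cst.
Qed.

Lemma continuous_expi : continuous (expi : R -> C).
Proof.
move=> x; apply/continuous_ReIm; split => /=.
  exact: continuous_cos.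
exact: continuous_sin.
Qed.

Lemma normc_expi (t : R) : normc (expi t) = 1.
Proof. by rewrite /= cos2Dsin2 sqrtr1. Qed.

Lemma expiD (s t : R) : expi (s + t) = expi s * expi t.
Proof.
by apply/eqP; rewrite eq_complex /= cosD sinD eqxx addrC [cos s * _]mulrC eqxx.
Qed.

Lemma expi0 : expi 0 = 1 :> C.
Proof. by rewrite /expi cos0 sin0. Qed.

Lemma expi_neq0 (t : R) : expi t != 0 :> C.
Proof. by rewrite -normc_eq0 normc_expi oner_eq0. Qed.

Lemma expiN (t : R) : expi (- t) = (expi t)^-1 :> C.
Proof.
apply: (mulfI (expi_neq0 t)); rewrite -expiD subrr expi0 divff//.
exact: expi_neq0.
Qed.

Lemma expi_periodic (t : R) : expi (t + 2 * pi) = expi t :> C.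
Proof. by rewrite /expi mulrC mulr_natr cosD2pi sinD2pi. Qed.

(** Heine-Borel, carried over from [R * R]: A is a closed subset of the continuous image of a
    square. *)
Lemma closed_bounded_compact A (M : R) :
  closed A -> (forall z, A z -> normc z <= M) -> compact A.
Proof.
move=> cA AM; pose g (p : R * R) : C := (p.1 +i* p.2)%C.
have cg : continuous g.
  by move=> p; apply/continuous_ReIm; split; [exact: cvg_fst|exact: cvg_snd].
apply: (subclosed_compact cA (B := g @` (`[- M, M] `*` `[- M, M]))).
  apply: continuous_compact; first exact: continuous_subspaceT.
  by apply: compact_setX; exact: segment_compact.
move=> z Az; exists (Re z, Im z); last by case: z {Az}.
have zM := AM _ Az.
split; rewrite /= in_itv /= -ler_norml; apply: le_trans zM.
- exact: Re_le_normc.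
- exact: Im_le_normc.
Qed.

Lemma closed_disk_compact z (r : R) : compact [set w | normc (w - z) <= r].
Proof.
apply: (@closed_bounded_compact _ (r + normc z)).
  have -> : [set w | normc (w - z) <= r] =
            (fun w => normc (w - z)) @^-1` [set x | x <= r] by [].
  apply: closed_comp; last exact: closed_le.
  by move=> w _; exact: continuous_normcB.
by move=> w /= wz; rewrite -lerBlDr; apply: le_trans wz; exact: normcB_ge.
Qed.

End PlaneTopology.

(** * Integrals of continuous functions over segments *)

Section SegmentIntegral.
Context {R : realType}.
Implicit Types (a b c k e : R) (f g : R -> R).

Definition segment_integral a b f : R :=
  \int[@lebesgue_measure R]_(x in `[a, b]) f x.

(** Continuity is meant on the whole line, also at the endpoints, so that no subspace topology
    intervenes when a segment is cut. *)
Definition continuous_seg a b f :=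
  forall x, a <= x <= b -> {for x, continuous f}.

Local Notation I := segment_integral.

Lemma seg_integrable a b f :
  continuous_seg a b f -> (@lebesgue_measure R).-integrable `[a, b] (EFin \o f).
Proof.
move=> cf; apply: continuous_compact_integrable; first exact: segment_compact.
by apply: continuous_in_subspaceT => x; rewrite inE /= in_itv /=; exact: cf.
Qed.

Lemma seg_cst a b k : a <= b -> I a b (fun=> k) = k * (b - a).
Proof.
move=> ab; rewrite /I Rintegral_cst; last exact: measurable_itv.
by rewrite /= lebesgue_measure_itv /= lte_fin; case: ltgtP ab => //= -> _; rewrite subrr.
Qed.

Lemma seg_le a b f g : continuous_seg a b f -> continuous_seg a b g ->
  (forall x, a <= x <= b -> f x <= g x) -> I a b f <= I a b g.
Proof.
move=> cf cg fg; apply: le_Rintegral => //; exact: seg_integrable.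
Qed.

Lemma eq_seg a b f g : (forall x, a <= x <= b -> f x = g x) -> I a b f = I a b g.
Proof.
move=> fg; apply: eq_Rintegral => x; rewrite inE /= in_itv /=; exact: fg.
Qed.

Lemma segD a b f g : continuous_seg a b f -> continuous_seg a b g ->
  I a b (fun x => f x + g x) = I a b f + I a b g.
Proof. by move=> cf cg; apply: RintegralD => //; exact: seg_integrable. Qed.

Lemma segB a b f g : continuous_seg a b f -> continuous_seg a b g ->
  I a b (fun x => f x - g x) = I a b f - I a b g.
Proof. by move=> cf cg; apply: RintegralB => //; exact: seg_integrable. Qed.

Lemma segZ a b k f : continuous_seg a b f ->
  I a b (fun x => k * f x) = k * I a b f.
Proof. by move=> cf; apply: RintegralZl => //; exact: seg_integrable. Qed.

Lemma seg_split a c b f : a <= c <= b -> continuous_seg a b f ->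
  I a b f = I a c f + I c b f.
Proof.
move=> /andP[ac cb] cf; have fi := seg_integrable cf.
have := Rintegral_itvB fi; move/(_ c); rewrite !bnd_simp => /(_ ac cb).
move/eqP; rewrite subr_eq => /eqP; rewrite /I => ->.
rewrite addrC; congr (_ + _); apply: Rintegral_itv_obnd_cbnd.
apply: integrableS fi => //; apply: subset_itv => //.
Qed.

Lemma continuous_segS a b c d f : c <= a -> b <= d ->
  continuous_seg c d f -> continuous_seg a b f.
Proof.
move=> ca bd cf x /andP[ax xb]; apply: cf.
by rewrite (le_trans ca ax) (le_trans xb bd).
Qed.

Lemma continuous_seg_cst a b k : continuous_seg a b (fun=> k).
Proof. by move=> x _; exact: cvg_cst. Qed.

Lemma continuous_segB a b f g : continuous_seg a b f -> continuous_seg a b g ->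
  continuous_seg a b (fun x => f x - g x).
Proof. by move=> cf cg x xab; apply: (@continuousB R R); [exact: cf|exact: cg]. Qed.

Lemma seg_approx a b k e f : a <= b -> continuous_seg a b f ->
  (forall x, a <= x <= b -> `|f x - k| <= e) ->
  `|I a b f - k * (b - a)| <= e * (b - a).
Proof.
move=> ab cf fk; have ccst r := continuous_seg_cst (a:=a) (b:=b) (k:=r).
rewrite ler_distl -mulrBl -mulrDl -!seg_cst//.
by apply/andP; split; apply: seg_le => // x /fk; rewrite ler_distl => /andP[].
Qed.

(** If f x > 0, then f stays above f x / 2 on a nondegenerate segment around x, clipped to [a, b] by
    [c1] and [c2], and the integral is positive. *)
Lemma seg_ge0_eq0 a b f : a < b -> continuous_seg a b f ->
  (forall x, a <= x <= b -> 0 <= f x) -> I a b f <= 0 ->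
  forall x, a <= x <= b -> f x = 0.
Proof.
move=> ab cf f0 If x xab; apply/eqP/negPn/negP => fx0.
have fx : 0 < f x by rewrite lt_neqAle eq_sym fx0 f0.
have : {for x, continuous f} by exact: cf.
have fx2 : 0 < f x / 2 by lra.
move=> /cvgrPdist_lt /(_ _ fx2).
move=> /nbhs_ballP[d /= d0 dP].
pose c1 := Num.max a (x - d / 2); pose c2 := Num.min b (x + d / 2).
have [ax xb] := andP xab.
have c12 : c1 < c2.
  rewrite lt_min !gt_max ab/= ltrBlDr.
  move: xb ax; rewrite le_eqVlt => /orP[/eqP-> _|xb ax];
  apply/andP; split; try (apply/andP; split); lra.
have [ac1 c2b] : a <= c1 /\ c2 <= b by rewrite le_max lexx ge_min lexx.
have gt x' : c1 <= x' <= c2 -> f x / 2 <= f x'.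
  rewrite ge_max le_min => /andP[/andP[_ h1] /andP[_ h2]].
  have : ball x d x' by rewrite /ball /= ltr_distl; apply/andP; split; lra.
  by move/dP; rewrite ltr_distl => /andP[]; lra.
have s1 : I a b f = I a c1 f + (I c1 c2 f + I c2 b f).
  rewrite (@seg_split a c1 b)//; last by rewrite ac1 (le_trans (ltW c12) c2b).
  congr (_ + _); apply: seg_split; first by rewrite (ltW c12) c2b.
  exact: continuous_segS cf.
have p1 : 0 <= I a c1 f.
  by apply: Rintegral_ge0 => y; rewrite /= in_itv /= => /andP[ay yc]; apply: f0; lra.
have p2 : 0 <= I c2 b f.
  by apply: Rintegral_ge0 => y; rewrite /= in_itv /= => /andP[ay yc]; apply: f0; lra.
have : f x / 2 * (c2 - c1) <= I c1 c2 f.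
  rewrite -seg_cst; last exact: ltW.
  apply: seg_le gt => //; first exact: continuous_seg_cst.
  exact: continuous_segS cf.
have : 0 < f x / 2 * (c2 - c1) by rewrite mulr_gt0 ?divr_gt0// subr_gt0.
by lra.
Qed.

End SegmentIntegral.

(** * Goursat's theorem on rectangles *)

Section Goursat.
Context {R : realType}.
Implicit Types (U V : R -> R -> R) (a b c d e x y : R).

Local Notation I := segment_integral.

(* U + iV is complex differentiable at x + iy, with derivative alpha + i beta. *)
Definition CR U V x y := exists alpha beta, forall e, 0 < e ->
  exists2 d, 0 < d & forall x' y', `|x' - x| < d -> `|y' - y| < d ->
    `|U x' y' - U x y - (alpha * (x' - x) - beta * (y' - y))|
      <= e * (`|x' - x| + `|y' - y|) /\
    `|V x' y' - V x y - (beta * (x' - x) + alpha * (y' - y))|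
      <= e * (`|x' - x| + `|y' - y|).

Lemma linear_approx_continuous (f : R -> R) x (k : R) :
  (forall e, 0 < e -> exists2 d, 0 < d & forall x', `|x' - x| < d ->
     `|f x' - f x - k * (x' - x)| <= e * `|x' - x|) ->
  {for x, continuous f}.
Proof.
move=> H; apply/cvgrPdist_lt => e e0.
have [d d0 dP] := H _ ltr01.
have k1 : 0 < `|k| + 2 by rewrite ltr_wpDl.
apply/nbhs_ballP; exists (Num.min d (e / (`|k| + 2))).
  by rewrite /= lt_min d0 divr_gt0.
move=> x'; rewrite /ball /= distrC lt_min => /andP[x'd x'e]; rewrite distrC.
have := dP _ x'd; rewrite mul1r => h.
have : `|f x' - f x| <= `|x' - x| + `|k| * `|x' - x|.
  by rewrite -normrM -[f x' - f x](subrK (k * (x' - x))); apply: le_trans (ler_normD _ _) _; exact: lerD.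
move: x'e; rewrite ltr_pdivlMr// mulrDr mulrC => x'e.
have := normr_ge0 (x' - x); lra.
Qed.

Lemma CR_continuous U V x y : CR U V x y ->
  [/\ {for x, continuous (fun t => U t y)}, {for y, continuous (fun t => U x t)},
      {for x, continuous (fun t => V t y)} & {for y, continuous (fun t => V x t)}].
Proof.
move=> [al [be H]]; split.
- apply: (@linear_approx_continuous _ _ al) => e e0; have [d d0 dP] := H _ e0.
  exists d => // t td; have [|+ _] := dP t y td; rewrite ?subrr ?normr0//.
  by rewrite mulr0 subr0 addr0.
- apply: (@linear_approx_continuous _ _ (- be)) => e e0; have [d d0 dP] := H _ e0.
  exists d => // t td; have [||+ _] := dP x t; rewrite ?subrr ?normr0//.
  by rewrite mulr0 sub0r add0r mulNr.
- apply: (@linear_approx_continuous _ _ be) => e e0; have [d d0 dP] := H _ e0.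
  exists d => // t td; have [|_ +] := dP t y td; rewrite ?subrr ?normr0//.
  by rewrite mulr0 !addr0.
- apply: (@linear_approx_continuous _ _ al) => e e0; have [d d0 dP] := H _ e0.
  exists d => // t td; have [||_ +] := dP x t; rewrite ?subrr ?normr0//.
  by rewrite mulr0 !add0r.
Qed.

(** The imaginary part of the integral of (U + iV) dz counterclockwise around the rectangle: the
    part that compares the integrals of U over the two vertical sides. *)
Definition boundary_integral U V a b c d : R :=
  I a b (fun x => V x c - V x d) + I c d (fun y => U b y - U a y).

Local Notation J := boundary_integral.

Definition CR_on U V a b c d :=
  forall x y, a <= x <= b -> c <= y <= d -> CR U V x y.

Lemma CR_onS U V a b c d a' b' c' d' : CR_on U V a b c d ->
  a <= a' -> b' <= b -> c <= c' -> d' <= d -> CR_on U V a' b' c' d'.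
Proof.
move=> H aa bb cc dd x y /andP[ax xb] /andP[cy yd]; apply: H.
  by rewrite (le_trans aa ax) (le_trans xb bb).
by rewrite (le_trans cc cy) (le_trans yd dd).
Qed.

Lemma CR_on_hor U V a b c d : CR_on U V a b c d -> c <= d ->
  continuous_seg a b (fun x => V x c - V x d).
Proof.
move=> H cd; apply: continuous_segB => x xab.
  by have [] := CR_continuous (H x c xab _); rewrite ?lexx ?cd.
by have [] := CR_continuous (H x d xab _); rewrite ?lexx ?cd.
Qed.

Lemma CR_on_ver U V a b c d x : CR_on U V a b c d -> a <= x <= b ->
  continuous_seg c d (fun y => U x y).
Proof.
by move=> H xab y ycd; have [] := CR_continuous (H x y xab ycd).
Qed.

Lemma boundary_integral_split_x U V a b c d m : CR_on U V a b c d ->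
  a <= m <= b -> c <= d -> J U V a b c d = J U V a m c d + J U V m b c d.
Proof.
move=> H amb cd; have [am mb] := andP amb; have ab := le_trans am mb.
rewrite /J (seg_split amb (CR_on_hor H cd)).
have ca : continuous_seg c d (fun y => U a y).
  by apply: (CR_on_ver H); rewrite lexx ab.
have cm : continuous_seg c d (fun y => U m y) by exact: (CR_on_ver H).
have cb : continuous_seg c d (fun y => U b y).
  by apply: (CR_on_ver H); rewrite lexx ab.
by rewrite (segB cb ca) (segB cb cm) (segB cm ca); ring.
Qed.

Lemma boundary_integral_split_y U V a b c d m : CR_on U V a b c d ->
  a <= b -> c <= m <= d -> J U V a b c d = J U V a b c m + J U V a b m d.
Proof.
move=> H ab cmd; have [cm md] := andP cmd; have cd := le_trans cm md.
have cU : continuous_seg c d (fun y => U b y - U a y).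
  by apply: continuous_segB; apply: (CR_on_ver H); rewrite lexx ab.
have cV y : c <= y <= d -> continuous_seg a b (fun x => V x y).
  by move=> ycd x xab; have [] := CR_continuous (H x y xab ycd).
have Vc : continuous_seg a b (fun x => V x c) by apply: cV; rewrite lexx cd.
have Vd : continuous_seg a b (fun x => V x d) by apply: cV; rewrite lexx cd.
have Vm : continuous_seg a b (fun x => V x m) by exact: cV.
by rewrite /J (seg_split cmd cU) (segB Vc Vd) (segB Vc Vm) (segB Vm Vd); ring.
Qed.

(** Nested intervals: each left endpoint is below each right endpoint, so the supremum of the left
    ones lies in every interval. *)
Lemma nested_sup (x w : nat -> R) :
  (forall n, x n <= x n.+1) -> (forall n, x n.+1 + w n.+1 <= x n + w n) ->
  (forall n, 0 <= w n) -> exists z, forall n, x n <= z <= x n + w n.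
Proof.
move=> xS wS w0.
have xm : {homo x : m n / (m <= n)%N >-> m <= n}.
  by apply: homo_leq => //; exact: le_trans.
have wm : {homo (fun n => x n + w n) : m n / (m <= n)%N >-> n <= m}.
  apply: (@homo_leq _ _ (fun s t => t <= s)) => // u v t h1 h2.
  exact: le_trans h2 h1.
have xw m n : x m <= x n + w n.
  apply: le_trans (xm _ _ (leq_maxl m n)) _.
  by apply: le_trans (wm _ _ (leq_maxr m n)); rewrite lerDl.
exists (sup (range x)) => n; apply/andP; split.
  apply: sup_upper_bound; last by exists n.
  split; first by exists (x 0%N), 0%N.
  by exists (x 0%N + w 0%N) => _ [m _ <-].
apply: sup_le_ub; first by exists (x 0%N), 0%N.
by move=> _ [m _ <-].
Qed.

(** The affine part of U + iV contributes [- al * (d - c) * (b - a)] and its opposite, which cancel;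
    the remainders on two opposite sides add up to at most twice e times the half-perimeter. *)
Lemma boundary_integral_small U V a b c d x y e :
  CR U V x y -> 0 < e -> exists2 r, 0 < r & forall a b c d,
    CR_on U V a b c d -> a <= x <= b -> c <= y <= d ->
    b - a < r -> d - c < r ->
    `|J U V a b c d| <= 2 * e * ((b - a) + (d - c)) ^+ 2.
Proof.
move=> [al [be H]] e0; have [r r0 rP] := H _ e0; exists r => // {}a {}b {}c {}d.
move=> cr /andP[ax xb] /andP[cy yd] bar dcr.
have ab := le_trans ax xb; have cd := le_trans cy yd.
pose s := (b - a) + (d - c).
have near x' y' : a <= x' <= b -> c <= y' <= d ->
    `|x' - x| < r /\ `|y' - y| < r /\ `|x' - x| + `|y' - y| <= s.
  move=> /andP[ax' x'b] /andP[cy' y'd]; split.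
    clear -ax xb cy yd bar dcr ax' x'b cy' y'd.
    by rewrite ltr_distl; apply/andP; split; lra.
  split; first by rewrite ltr_distl; apply/andP; split; lra.
  by rewrite /s lerD// ler_distl; apply/andP; split; lra.
have hV : `|I a b (fun x => V x c - V x d) - (- al * (d - c)) * (b - a)|
    <= 2 * e * s * (b - a).
  apply: seg_approx => //; first exact: CR_on_hor cr cd.
  move=> x' x'ab.
  have [||n1 [n2 n3]] := near x' c; rewrite ?lexx ?cd//.
  have [||n4 [n5 n6]] := near x' d; rewrite ?lexx ?cd//.
  have [_ h1] := rP _ _ n1 n2; have [_ h2] := rP _ _ n4 n5.
  have h1' := le_trans h1 (ler_wpM2l (ltW e0) n3).
  have h2' := le_trans h2 (ler_wpM2l (ltW e0) n6).
  move: h1' h2'; rewrite !ler_norml => /andP[+ +] /andP[].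
  by clear; move=> *; apply/andP; split; lra.
have hU : `|I c d (fun y => U b y - U a y) - (al * (b - a)) * (d - c)|
    <= 2 * e * s * (d - c).
  apply: seg_approx => //.
    by apply: continuous_segB; apply: (CR_on_ver cr); rewrite lexx ab.
  move=> y' y'cd.
  have [||n1 [n2 n3]] := near a y'; rewrite ?lexx ?ab//.
  have [||n4 [n5 n6]] := near b y'; rewrite ?lexx ?ab//.
  have [h1 _] := rP _ _ n1 n2; have [h2 _] := rP _ _ n4 n5.
  have h1' := le_trans h1 (ler_wpM2l (ltW e0) n3).
  have h2' := le_trans h2 (ler_wpM2l (ltW e0) n6).
  move: h1' h2'; rewrite !ler_norml => /andP[+ +] /andP[].
  by clear; move=> *; apply/andP; split; lra.
have -> : J U V a b c d =
  (I a b (fun x => V x c - V x d) - (- al * (d - c)) * (b - a)) +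
  (I c d (fun y => U b y - U a y) - (al * (b - a)) * (d - c)).
  by rewrite /J; ring.
apply: le_trans (ler_normD _ _) _; apply: le_trans (lerD hV hU) _.
by rewrite le_eqVlt; apply/orP; left; apply/eqP; rewrite /s; ring.
Qed.

(** Some quarter of a rectangle carries at least a quarter of its boundary integral. Along the
    resulting nested rectangles, differentiability at the common point bounds the integral by e
    times the square of a size divided by 2 ^ n, and this square cancels the factor 4 ^ n. *)
Lemma goursat U V a b c d : a <= b -> c <= d -> CR_on U V a b c d ->
  J U V a b c d = 0.
Proof.
move=> ab cd cr.
pose w n := (b - a) / 2 ^+ n; pose h n := (d - c) / 2 ^+ n.
have p2 n : 0 < 2 ^+ n :> R by rewrite exprn_gt0.
have w0 n : 0 <= w n by rewrite divr_ge0 ?subr_ge0// ltW.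
have h0 n : 0 <= h n by rewrite divr_ge0 ?subr_ge0// ltW.
have wS n : w n = w n.+1 + w n.+1.
  by rewrite /w exprS; field; rewrite gt_eqF.
have hS n : h n = h n.+1 + h n.+1.
  by rewrite /h exprS; field; rewrite gt_eqF.
(* p is the lower left corner of a rectangle of generation n. *)
pose Q n (p : R * R) := J U V p.1 (p.1 + w n) p.2 (p.2 + h n).
pose P n (p : R * R) := [/\ a <= p.1, p.1 + w n <= b, c <= p.2, p.2 + h n <= d
  & `|J U V a b c d| <= 4 ^+ n * `|Q n p| ].
pose S n (p q : R * R) := [/\ P n.+1 q, p.1 <= q.1, q.1 + w n.+1 <= p.1 + w n,
  p.2 <= q.2 & q.2 + h n.+1 <= p.2 + h n].
have step n p : P n p -> exists q, S n p q.
  move=> [a1 b1 c1 d1 Jp]; set w' := w n.+1; set h' := h n.+1.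
  have w'0 := w0 n.+1; have h'0 := h0 n.+1; have wn := wS n; have hn := hS n.
  have crp : CR_on U V p.1 (p.1 + w n) p.2 (p.2 + h n) by exact: CR_onS cr _ _ _ _.
  have crl : CR_on U V p.1 (p.1 + w') p.2 (p.2 + h n).
    by apply: CR_onS crp _ _ _ _; rewrite ?lexx// /w'; clear -w'0 wn; lra.
  have crr : CR_on U V (p.1 + w') (p.1 + w' + w') p.2 (p.2 + h n).
    by apply: CR_onS crp _ _ _ _; rewrite ?lexx// /w'; clear -w'0 wn; lra.
  have QE : Q n p = (Q n.+1 p + Q n.+1 (p.1, p.2 + h')) +
      (Q n.+1 (p.1 + w', p.2) + Q n.+1 (p.1 + w', p.2 + h')).
    rewrite /Q /= (@boundary_integral_split_x _ _ _ _ _ _ (p.1 + w') crp).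
    - rewrite (@boundary_integral_split_y _ _ _ _ _ _ (p.2 + h') crl).
      + rewrite (_ : p.1 + w n = p.1 + w' + w'); last by rewrite wn addrA.
        rewrite (@boundary_integral_split_y _ _ _ _ _ _ (p.2 + h') crr).
        * by rewrite (_ : p.2 + h n = p.2 + h' + h')// hn addrA.
        * by rewrite /w'; clear -w'0 wn; lra.
        * by rewrite /h'; clear -h'0 hn; apply/andP; split; lra.
      + by rewrite /w'; clear -w'0 wn; lra.
      + by rewrite /h'; clear -h'0 hn; apply/andP; split; lra.
    - by rewrite /w'; clear -w'0 wn; apply/andP; split; lra.
    - by rewrite lerDl.
  have big : exists2 q, [\/ q = p, q = (p.1, p.2 + h'), q = (p.1 + w', p.2)
      | q = (p.1 + w', p.2 + h')] & `|Q n p| <= 4 * `|Q n.+1 q|.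
    have [h1|h1] := leP `|Q n p| (4 * `|Q n.+1 p|); first by exists p => //; constructor 1.
    have [h2|h2] := leP `|Q n p| (4 * `|Q n.+1 (p.1, p.2 + h')|).
      by eexists; [constructor 2; reflexivity|].
    have [h3|h3] := leP `|Q n p| (4 * `|Q n.+1 (p.1 + w', p.2)|).
      by eexists; [constructor 3; reflexivity|].
    eexists; first by constructor 4; reflexivity.
    have : `|Q n p| <= (`|Q n.+1 p| + `|Q n.+1 (p.1, p.2 + h')|) +
      (`|Q n.+1 (p.1 + w', p.2)| + `|Q n.+1 (p.1 + w', p.2 + h')|).
      rewrite QE; apply: le_trans (ler_normD _ _) _.
      by apply: lerD; exact: ler_normD.
    by move: h1 h2 h3; clear; lra.
  move: big => [q qE Qq]; exists q.
  have : `|J U V a b c d| <= 4 ^+ n.+1 * `|Q n.+1 q|.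
    rewrite exprSr -mulrA; apply: le_trans Jp _.
    by apply: ler_wpM2l Qq; rewrite exprn_ge0.
  have q1 : p.1 <= q.1 /\ q.1 + w' <= p.1 + w n.
    by rewrite wn; case: qE => -> /=; rewrite ?lerDl ?lerD2l ?addrA ?lerDl// lexx.
  have q2 : p.2 <= q.2 /\ q.2 + h' <= p.2 + h n.
    by rewrite hn; case: qE => -> /=; rewrite ?lerDl ?lerD2l ?addrA ?lerDl// lexx.
  case: q1 q2 => [pq1 qp1] [pq2 qp2] Jq; split => //; split => //.
  - exact: le_trans a1 pq1.
  - exact: le_trans qp1 b1.
  - exact: le_trans c1 pq2.
  - exact: le_trans qp2 d1.
have w00 : w 0%N = b - a by rewrite /w expr0 divr1.
have h00 : h 0%N = d - c by rewrite /h expr0 divr1.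
have P0 : P 0%N (a, c).
  by split; rewrite /Q /= ?w00 ?h00 ?[_ + (_ - _)]addrC ?subrK ?expr0 ?mul1r.
(* The default [(a, c)] of [xget] is never returned: [step] gives every admissible corner a
   successor. *)
pose F := fix F n := if n is m.+1 then xget (a, c) [set q | S m (F m) q] else (a, c).
have FP n : P n (F n).
  elim: n => [//|n IH] /=; case: xgetP => [q _ []//|].
  by have [q Sq] := step _ _ IH; move=> /(_ q) /(_ Sq).
have FS n : S n (F n) (F n.+1).
  rewrite [F n.+1]/=; case: xgetP => [q _ //|].
  by have [q Sq] := step _ _ (FP n); move=> /(_ q) /(_ Sq).
have [x xP] : exists x, forall n, (F n).1 <= x <= (F n).1 + w n.
  by apply: nested_sup => // n; have [] := FS n.
have [y yP] : exists y, forall n, (F n).2 <= y <= (F n).2 + h n.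
  by apply: nested_sup => // n; have [] := FS n.
have crxy : CR U V x y.
  by apply: cr; [have := xP 0%N; rewrite w00|have := yP 0%N; rewrite h00];
    rewrite /= addrC subrK.
suff H e : 0 < e -> `|J U V a b c d| <= e * (2 * ((b - a) + (d - c)) ^+ 2).
  apply/normr0_eq0/le_anti; rewrite normr_ge0 andbT.
  set k := 2 * _ in H; have k0 : 0 <= k by rewrite mulr_ge0// sqr_ge0.
  apply/ler_addgt0Pl => e e0; rewrite addr0.
  have k1 : 0 < k + 1 by lra.
  apply: le_trans (H _ (divr_gt0 e0 k1)) _.
  rewrite mulrAC ler_pdivrMr// ler_pM2l//; lra.
move=> e0; have [r r0 rP] := boundary_integral_small a b c d crxy e0.
have [n nr] : exists n, (b - a + (d - c)) / 2 ^+ n < r.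
  pose s := (b - a) + (d - c) + 1.
  have s0 : 0 < s by rewrite ltr_wpDl// addr_ge0// subr_ge0.
  have := divr_gt0 r0 s0 => /ltr_add_invr[n]; rewrite add0r ltr_pdivlMr// => hn.
  exists n; rewrite ltr_pdivrMr//; rewrite mulrC ltr_pdivrMr// in hn.
  have : n.+1%:R <= 2 ^+ n :> R by rewrite -natrX ler_nat ltn_expl.
  rewrite -(ler_pM2l r0); apply: lt_le_trans; apply: lt_trans hn.
  by rewrite /s ltrDl.
have := FP n; have := xP n; have := yP n; move: (F n) => q.
clear F FP FS xP yP => yq xq [a1 b1 c1 d1 Jn]; apply: le_trans Jn _.
have wE : q.1 + w n - q.1 = w n by rewrite addrC addKr.
have hE : q.2 + h n - q.2 = h n by rewrite addrC addKr.
have Hn : `|Q n q| <= 2 * e * (w n + h n) ^+ 2.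
  rewrite -[w n in leRHS]wE -[h n in leRHS]hE; apply: rP => //.
  - exact: CR_onS cr _ _ _ _.
  - rewrite wE; apply: le_lt_trans nr.
    by rewrite /w ler_pM2r ?invr_gt0// lerDl subr_ge0.
  - rewrite hE; apply: le_lt_trans nr.
    by rewrite /h ler_pM2r ?invr_gt0// lerDr subr_ge0.
apply: le_trans (ler_wpM2l (exprn_ge0 _ (ler0n _ _)) Hn) _.
rewrite /w /h -mulrDl exprMn exprVn -exprM mulnC exprM.
rewrite (_ : 2 ^+ 2 = 4); last by ring.
have p4 : 0 < 4 ^+ n :> R by rewrite exprn_gt0.
rewrite le_eqVlt; apply/orP; left; apply/eqP; field.
by rewrite gt_eqF.
Qed.

End Goursat.

(** * Complex differentiability, exponential and principal logarithm *)

Section ComplexDerivative.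
Context {R : realType}.
Local Notation C := R[i].
Implicit Types (z w : C) (f g q : C -> C).

(* Caratheodory's form of complex differentiability at z; q z is f'(z). *)
Definition cdiff f z := exists2 q : C -> C,
  {for z, continuous q} & forall w, f w = f z + q w * (w - z).

Lemma continuous_near_eq f g z : {for z, continuous f} ->
  (\forall w \near z, f w = g w) -> {for z, continuous g}.
Proof.
move=> cf /nbhs_normcP[d1 d10 fg]; apply/continuous_CCP => e e0.
have [d2 d20 fe] := (continuous_CCP f z).1 cf _ e0.
exists (Num.min d1 d2) => [|w]; first by rewrite lt_min d10.
rewrite lt_min => /andP[h1 h2]; rewrite -!fg ?subrr ?normc0//; exact: fe.
Qed.

(** The identity in [cdiff] is global while q satisfies it only near z; the difference quotient of
    f, completed by [q z], is defined everywhere and agrees with q near z. *)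
Lemma cdiff_near f q z : {for z, continuous q} ->
  (\forall w \near z, f w = f z + q w * (w - z)) -> cdiff f z.
Proof.
move=> cq fq; exists (fun w => if w == z then q z else (f w - f z) / (w - z)).
  apply: continuous_near_eq cq _; move: fq.
  move=> /nbhs_normcP[d d0 fq]; apply/nbhs_normcP; exists d => // w /fq.
  case: eqVneq => [->//|wz ->]; rewrite addrC addKr mulfK// subr_eq0//.
move=> w; case: eqVneq => [->|wz]; first by rewrite subrr mulr0 addr0.
by rewrite divfK ?subr_eq0// addrC subrK.
Qed.

Lemma cdiff_near_eq f g z : cdiff f z -> (\forall w \near z, f w = g w) ->
  cdiff g z.
Proof.
move=> [q cq fq] /nbhs_normcP[d d0 fg]; apply: (cdiff_near cq).
apply/nbhs_normcP; exists d => // w /fg <-; rewrite fq; congr (_ + _).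
by apply: fg; rewrite subrr normc0.
Qed.

Lemma continuous_cst z k : {for z, continuous (fun=> k : C)}.
Proof. exact: (@cst_continuous C C). Qed.

Lemma continuousD_C f g z : {for z, continuous f} -> {for z, continuous g} ->
  {for z, continuous (fun w => f w + g w)}.
Proof. by move=> cf cg; exact: (@continuousD C C C f g z cf cg). Qed.

Lemma continuousM_C f g z : {for z, continuous f} -> {for z, continuous g} ->
  {for z, continuous (fun w => f w * g w)}.
Proof. by move=> cf cg; exact: (@continuousM C C f g z cf cg). Qed.

Lemma continuousN_C f z : {for z, continuous f} -> {for z, continuous (fun w => - f w)}.
Proof. by move=> cf; exact: (@continuousN C C C f z cf). Qed.

Lemma continuousV_C f z : f z != 0 -> {for z, continuous f} ->
  {for z, continuous (fun w => (f w)^-1)}.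
Proof. by move=> fz cf; exact: (@continuousV C C f z fz cf). Qed.

Lemma continuous_comp_C f g z : {for z, continuous g} -> {for g z, continuous f} ->
  {for z, continuous (fun w => f (g w))}.
Proof. by move=> cg cf; exact: (@continuous_comp C C C g f z cg cf). Qed.

Lemma continuous_subr z k : {for k, continuous (fun w => w - z)}.
Proof.
apply/continuous_CCP => e e0; exists e => // w; by rewrite opprB addrA subrK.
Qed.

Lemma cdiff_continuous f z : cdiff f z -> {for z, continuous f}.
Proof.
move=> [q cq fq]; have -> : f = (fun w => f z + q w * (w - z)) by apply/funext.
refine (continuousD_C (@continuous_cst _ _) (continuousM_C cq (@continuous_subr _ _))).
Qed.

Lemma cdiff_cst k z : cdiff (fun=> k) z.
Proof. by exists (fun=> 0) => [|w]; [exact: continuous_cst|rewrite mul0r addr0]. Qed.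

Lemma cdiff_id z : cdiff id z.
Proof. by exists (fun=> 1) => [|w]; [exact: continuous_cst|rewrite mul1r addrC subrK]. Qed.

Lemma cdiffD f g z : cdiff f z -> cdiff g z -> cdiff (fun w => f w + g w) z.
Proof.
move=> [q cq fq] [p cp gp]; exists (fun w => q w + p w) => [|w].
  exact: (continuousD_C cq cp).
by rewrite fq gp; ring.
Qed.

Lemma cdiffM f g z : cdiff f z -> cdiff g z -> cdiff (fun w => f w * g w) z.
Proof.
move=> cf cg; have := cdiff_continuous cg; move: cf cg.
move=> [q cq fq] [p cp gp] gc; exists (fun w => q w * g w + f z * p w) => [|w].
  refine (continuousD_C (continuousM_C cq gc) (continuousM_C _ cp)).
  exact: continuous_cst.
by rewrite fq gp; ring.
Qed.

Lemma cdiffZ k f z : cdiff f z -> cdiff (fun w => k * f w) z.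
Proof. by move=> cf; apply: cdiffM => //; exact: cdiff_cst. Qed.

Lemma cdiffB f g z : cdiff f z -> cdiff g z -> cdiff (fun w => f w - g w) z.
Proof.
move=> cf cg; apply: cdiffD => //.
have -> : (fun w => - g w) = (fun w => -1 * g w) by apply/funext => w; rewrite mulN1r.
exact: cdiffZ.
Qed.

Lemma near_neq0 f z : {for z, continuous f} -> f z != 0 ->
  \forall w \near z, f w != 0.
Proof.
move=> cf fz; have [|d d0 dP] := (continuous_CCP f z).1 cf (normc (f z)).
  by rewrite normc_gt0.
apply/nbhs_normcP; exists d => // w /dP; apply: contraTN => /eqP ->.
by rewrite sub0r normcN ltxx.
Qed.

Lemma cdiffV f z : cdiff f z -> f z != 0 -> cdiff (fun w => (f w)^-1) z.
Proof.
move=> cf fz; have fc := cdiff_continuous cf; have := near_neq0 fc fz.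
move: cf => [q cq fq] f0.
apply: (@cdiff_near _ (fun w => - q w * ((f w)^-1 * (f z)^-1))).
  refine (continuousM_C (continuousN_C cq) (continuousM_C _ (@continuous_cst _ _))).
  exact: continuousV_C fz fc.
move: f0 => /nbhs_normcP[d d0 f0]; apply/nbhs_normcP; exists d => // w /f0.
move=> fw; have E : q w * (w - z) = f w - f z by rewrite [f w]fq addrAC subrr add0r.
have -> : - q w * ((f w)^-1 * (f z)^-1) * (w - z) =
  - (q w * (w - z)) * ((f w)^-1 * (f z)^-1) by ring.
by rewrite E; field; rewrite fw fz.
Qed.

Lemma cdiff_div f g z : cdiff f z -> cdiff g z -> g z != 0 ->
  cdiff (fun w => f w / g w) z.
Proof. by move=> cf cg gz; apply: cdiffM => //; exact: cdiffV. Qed.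

Lemma cdiff_comp f g z : cdiff g z -> cdiff f (g z) ->
  cdiff (fun w => f (g w)) z.
Proof.
move=> cg; have gc := cdiff_continuous cg; move: cg => [q cq gq] [p cp fp].
exists (fun w => p (g w) * q w) => [|w].
  exact: (continuousM_C (continuous_comp_C gc cp) cq).
have E : g w - g z = q w * (w - z) by rewrite [g w]gq addrAC subrr add0r.
by rewrite [f (g w)]fp E mulrA.
Qed.

Lemma cdiffX f n z : cdiff f z -> cdiff (fun w => f w ^+ n) z.
Proof.
move=> cf; elim: n => [|n IH]; first exact: cdiff_cst.
have -> : (fun w => f w ^+ n.+1) = (fun w => f w * f w ^+ n).
  by apply/funext => w; rewrite exprS.
exact: cdiffM.
Qed.

Lemma cdiff_sum n (f : nat -> C -> C) z :
  (forall i, (i < n)%N -> cdiff (f i) z) ->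
  cdiff (fun w => \sum_(i < n) f i w) z.
Proof.
elim: n => [|n IH] cf.
  have -> : (fun w => \sum_(i < 0) f i w) = (fun=> 0).
    by apply/funext => w; rewrite big_ord0.
  exact: cdiff_cst.
have -> : (fun w => \sum_(i < n.+1) f i w) =
          (fun w => \sum_(i < n) f i w + f n w).
  by apply/funext => w; rewrite big_ord_recr.
by apply: cdiffD; [apply: IH => i iltn; apply: cf; exact: ltnW|exact: cf].
Qed.

Lemma cdiff_prod n (f : nat -> C -> C) z :
  (forall i, (i < n)%N -> cdiff (f i) z) ->
  cdiff (fun w => \prod_(i < n) f i w) z.
Proof.
elim: n => [|n IH] cf.
  have -> : (fun w => \prod_(i < 0) f i w) = (fun=> 1).
    by apply/funext => w; rewrite big_ord0.
  exact: cdiff_cst.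
have -> : (fun w => \prod_(i < n.+1) f i w) =
          (fun w => \prod_(i < n) f i w * f n w).
  by apply/funext => w; rewrite big_ord_recr.
by apply: cdiffM; [apply: IH => i iltn; apply: cf; exact: ltnW|exact: cf].
Qed.

Lemma derivable_cdiff f z : derivable f z 1 -> cdiff f z.
Proof.
move=> df; pose l := lim ((fun h => h^-1 *: ((f \o shift z) (h *: 1) - f z)) @ 0^').
exists (fun w => if w == z then l else (f w - f z) / (w - z)).
  apply/continuous_CCP => e e0; rewrite eqxx.
  have : nbhs l [set w | normc (w - l) < e] by apply/nbhs_normcP; exists e.
  move=> /df; rewrite /= => /nbhs_normcP[d d0 dP].
  exists d => // w wz; case: eqVneq => [_|wz0]; first by rewrite subrr normc0.
  have := dP (w - z); rewrite subr0 => /(_ wz); rewrite subr_eq0 => /(_ wz0).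
  by rewrite /= [(w - z) *: 1]mulr1 subrK [_ *: _]mulrC.
move=> w; case: eqVneq => [->|wz]; first by rewrite subrr mulr0 addr0.
by rewrite divfK ?subr_eq0// addrC subrK.
Qed.

Lemma is_derive_approx (f : R -> R) (x k : R) : is_derive x (1 : R) f k -> forall e, 0 < e ->
  exists2 d, 0 < d & forall h, `|h| < d -> `|f (x + h) - f x - k * h| <= e * `|h|.
Proof.
move=> [df dk] e e0.
have : (fun h => h^-1 *: ((f \o shift x) (h *: 1) - f x)) @ 0^' --> k.
  by rewrite -dk; exact: df.
move=> /cvgrPdist_lt /(_ _ e0) /nbhs_ballP[d /= d0 dP]; exists d => // h hd.
have [->|h0] := eqVneq h 0; first by rewrite addr0 subrr mulr0 subr0 normr0 mulr0.
have := dP h; rewrite /ball /= sub0r normrN => /(_ hd h0).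
rewrite [h *: 1]mulr1 [_ *: _]mulrC => /ltW.
rewrite -(ler_pM2r (x := `|h|)) ?normr_gt0// -normrM mulrBl divfK//.
by rewrite [h + x]addrC distrC.
Qed.

Definition cexp z : C := (expR (Re z))%:C%C * expi (Im z).

Lemma cexpD z w : cexp (z + w) = cexp z * cexp w.
Proof. by rewrite /cexp !raddfD /= expRD rmorphM /= expiD mulrACA. Qed.

Lemma cexp0 : cexp 0 = 1.
Proof. by rewrite /cexp /= expR0 expi0 mulr1. Qed.

Lemma normc_cexp z : normc (cexp z) = expR (Re z).
Proof.
by rewrite /cexp normcM normc_expi mulr1 normc_real ger0_norm// expR_ge0.
Qed.

Lemma cexp_neq0 z : cexp z != 0.
Proof. by rewrite -normc_eq0 normc_cexp expR_eq0. Qed.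

Lemma cexp_approx0 e : 0 < e -> exists2 d : R, 0 < d &
  forall h, normc h < d -> normc (cexp h - 1 - h) <= e * normc h.
Proof.
(* With s the modulus of h, the real and the imaginary error are at most 3 k s each, whence e / 6; k
   <= 1 gives the crude bounds by 2 s. *)
move=> e0; pose k := Num.min 1 (e / 6).
have k0 : 0 < k by rewrite lt_min ltr01 divr_gt0.
have k1 : k <= 1 by rewrite ge_min lexx.
have ke : k <= e / 6 by rewrite ge_min lexx orbT.
have [d1 d10 H1] := is_derive_approx (is_derive_expR 0) k0.
have [d2 d20 H2] := is_derive_approx (is_derive_cos 0) k0.
have [d3 d30 H3] := is_derive_approx (is_derive_sin 0) k0.
have k2 : 0 < k / 2 by lra.
exists (Num.min (Num.min d1 d2) (Num.min d3 (k / 2))).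
  by rewrite !lt_min d10 d20 d30.
move=> [x y]; rewrite !lt_min => /andP[/andP[h1 h2] /andP[h3 h4]].
have xh : `|x| <= normc (x +i* y)%C by exact: (Re_le_normc (x +i* y)%C).
have yh : `|y| <= normc (x +i* y)%C by exact: (Im_le_normc (x +i* y)%C).
move: (normc _) xh yh h1 h2 h3 h4 => s xs ys h1 h2 h3 h4.
have := H1 x (le_lt_trans xs h1); have := H2 y (le_lt_trans ys h2).
have := H3 y (le_lt_trans ys h3).
rewrite !add0r expR0 cos0 sin0 oppr0 mul0r !subr0 !addr0 !mul1r => h8 h9 h7.
have kx : k * `|x| <= k * s by rewrite ler_pM2l.
have ky : k * `|y| <= k * s by rewrite ler_pM2l.
have s1 : k * s <= s by rewrite ler_piMl// (le_trans _ xs).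
have eX : `|expR x - 1| <= 2 * s.
  by rewrite -[expR x - 1](subrK x); apply: le_trans (ler_normD _ _) _; lra.
have eXk : `|expR x - 1| <= k by lra.
have eX2 : `|expR x| <= 2.
  by rewrite -[expR x](subrK 1); apply: le_trans (ler_normD _ _) _; rewrite normr1; lra.
have sY : `|sin y| <= 2 * s.
  by rewrite -[sin y](subrK y); apply: le_trans (ler_normD _ _) _; lra.
apply: le_trans (normc_le_ReIm _) _.
rewrite /cexp /expi /= !mul0r !subr0 !addr0.
have -> : expR x * cos y - 1 - x = (expR x - 1 - x) + expR x * (cos y - 1) by ring.
have -> : expR x * sin y - y = (expR x - 1) * sin y + (sin y - y) by ring.
have t1 : `|expR x * (cos y - 1)| <= 2 * (k * s).
  by rewrite normrM; apply: ler_pM => //; exact: le_trans h9 ky.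
have t2 : `|(expR x - 1) * sin y| <= k * (2 * s) by rewrite normrM; apply: ler_pM.
have es : k * s <= e / 6 * s by rewrite ler_wpM2r// (le_trans _ xs).
have n1 := ler_normD (expR x - 1 - x) (expR x * (cos y - 1)).
have n2 := ler_normD ((expR x - 1) * sin y) (sin y - y).
move: t1 t2 es n1 n2 h7 h8 kx ky; clear; lra.
Qed.

(** The value of q at z is recorded because it is nonzero, which lets [cdiff_clog] invert the
    identity. *)
Lemma cexp_caratheodory z : exists2 q : C -> C, {for z, continuous q} &
  (forall w, cexp w = cexp z + q w * (w - z)) /\ q z = cexp z.
Proof.
exists (fun w => cexp z * (if w == z then 1 else (cexp (w - z) - 1) / (w - z))).
  refine (continuousM_C (@continuous_cst _ _) _).
  apply/continuous_CCP => e e0; rewrite eqxx.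
  have e2 : 0 < e / 2 by lra.
  have [d d0 dP] := cexp_approx0 e2; exists d => // w wz.
  case: eqVneq => [_|wz0]; first by rewrite subrr normc0.
  have wz1 : w - z != 0 by rewrite subr_eq0.
  have -> : (cexp (w - z) - 1) / (w - z) - 1 =
            (cexp (w - z) - 1 - (w - z)) / (w - z) by field.
  rewrite normcM normcV ltr_pdivrMr ?normc_gt0//.
  apply: le_lt_trans (dP _ wz) _; rewrite ltr_pM2r ?normc_gt0//; lra.
split=> [w|]; last by rewrite eqxx mulr1.
case: eqVneq => [->|wz]; first by rewrite subrr mulr0 addr0.
rewrite -mulrA divfK ?subr_eq0// mulrBr -cexpD mulr1.
by rewrite [z + _]addrC subrK addrC subrK.
Qed.

Lemma cdiff_cexp z : cdiff cexp z.
Proof. by have [q cq [qP _]] := cexp_caratheodory z; exists q. Qed.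

(** The principal logarithm on the half-plane Re z > 0, where this arctangent is the argument. *)
Definition clog z : C := (ln (normc z) +i* atan (Im z / Re z))%C.

Lemma clogK z : 0 < Re z -> cexp (clog z) = z.
Proof.
case: z => a b /= a0; rewrite /cexp /= lnK; last first.
  by rewrite posrE sqrtr_gt0 ltr_pwDl ?sqr_ge0// exprn_gt0.
have n0 : 0 < Num.sqrt (1 + (b / a) ^+ 2).
  by rewrite sqrtr_gt0 ltr_pwDl ?sqr_ge0.
have nE : Num.sqrt (a ^+ 2 + b ^+ 2) = a * Num.sqrt (1 + (b / a) ^+ 2).
  rewrite -{2}[a](@ger0_norm _ a) ?ltW// -sqrtr_sqr -sqrtrM ?sqr_ge0//.
  by congr Num.sqrt; field; rewrite gt_eqF.
have cosE := cos_atan (b / a).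
have sinE : sin (atan (b / a)) = b / a * cos (atan (b / a)).
  have c0 : cos (atan (b / a)) != 0 by rewrite cosE invr_eq0 gt_eqF.
  have := congr1 (fun t => t * cos (atan (b / a))) (atanK (b / a)).
  by rewrite /tan divfK.
apply/eqP; rewrite eq_complex /= !mul0r subr0 addr0 sinE cosE nE.
by apply/andP; split; apply/eqP; field; rewrite ?gt_eqF.
Qed.

Lemma Re_clog z : Re (clog z) = ln (normc z).
Proof. by []. Qed.

Lemma continuous_clog z : 0 < Re z -> {for z, continuous clog}.
Proof.
move=> z0; apply/continuous_ReIm; split => /=.
  refine (@continuous_comp C R R (@normc R) (@ln R) z (@continuous_normc _ _) _).
  by apply: continuous_ln; rewrite normc_gt0; apply: contraTneq z0 => ->; rewrite ltxx.
refine (@continuous_comp C R R (fun w => Im w / Re w) (@atan R) z _ _); last first.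
  exact: continuous_atan.
refine (@continuousM R C (@complex.Im R) _ z (@continuous_Im _ _) _).
refine (@continuousV R C (@complex.Re R) z _ (@continuous_Re _ _)).
by rewrite gt_eqF.
Qed.

Lemma near_Re_gt0 z : 0 < Re z -> \forall w \near z, 0 < Re w.
Proof.
move=> z0; apply/nbhs_normcP; exists (Re z) => // w wz.
have := le_lt_trans (Re_le_normc _) wz; rewrite raddfB ltr_distl => /andP[+ _].
by rewrite subrr.
Qed.

(** Reading the identity for [cexp] at [clog z] backwards gives the quotient 1 / q (clog w),
    continuous since [clog] is. *)
Lemma cdiff_clog z : 0 < Re z -> cdiff clog z.
Proof.
move=> z0; have [q cq [qP qz]] := cexp_caratheodory (clog z).
apply: (@cdiff_near _ (fun w => (q (clog w))^-1)).
  refine (continuousV_C _ (continuous_comp_C (continuous_clog z0) cq)).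
  by rewrite qz cexp_neq0.
have := near_Re_gt0 z0; move=> /nbhs_normcP[d d0 dP]; apply/nbhs_normcP.
exists d => // w /dP w0; have := qP (clog w); rewrite !clogK// => wz.
have [->|wz0] := eqVneq w z; first by rewrite subrr mulr0 addr0.
have q0 : q (clog w) != 0.
  by apply: contra_neq wz0 => q0; rewrite wz q0 mul0r addr0.
by rewrite [w in w - z]wz addrAC subrr add0r mulrA mulVf// mul1r addrC subrK.
Qed.

End ComplexDerivative.

(** * Uniform continuity, Riemann sums and means over a period *)

Section CircleMean.
Context {R : realType}.
Implicit Types (a b e s t : R) (phi psi : R -> R) (N : nat).

Local Notation I := segment_integral.

(** Only x is confined to K; y may leave it, because f is continuous in the full space at the points
    of K. *)
Lemma heine (U : pseudoMetricType R) (f : U -> R) (K : set U) e :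
  compact K -> (forall x, K x -> {for x, continuous f}) -> 0 < e ->
  exists2 d, 0 < d & forall x y, K x -> ball x d y -> `|f y - f x| < e.
Proof.
move=> /compact_near_coveringP cK cf e0.
have e2 : 0 < e / 2 by rewrite divr_gt0.
have H : \forall d \near 0^'+,
    K `<=` (fun x => forall y, ball x d y -> `|f y - f x| < e).
  apply: cK => x Kx; have /cvgrPdist_lt /(_ _ e2) := cf x Kx.
  move=> /nbhs_ballP[r /= r0 rP].
  have r2 : 0 < r / 2 by rewrite divr_gt0.
  exists (ball x (r / 2), [set d : R | d < r / 2]); first split.
  - by apply: nbhsx_ballx.
  - exact: nbhs_right_lt.
  move=> [z d] /= [xz dr] y zy.
  have xy : ball x r y.
    rewrite (splitr r); apply: ball_triangle xz _; exact: le_ball (ltW dr) _ zy.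
  have xz' : ball x r z by apply: le_ball xz; rewrite ler_pdivrMr// ler_peMr ?ler1n// ltW.
  rewrite (splitr e); apply: le_lt_trans (ler_distD (f x) _ _) _.
  by apply: ltrD; [rewrite distrC; exact: (rP _ xy)|exact: (rP _ xz')].
have [d [d0 dP]] := filter_ex (filterI (nbhs_right_gt 0) H).
by exists d => // x y Kx; exact: dP.
Qed.

Definition riemann_sum N a b phi :=
  (b - a) / N%:R * \sum_(j < N) phi (a + (b - a) / N%:R * j%:R).

Lemma riemann_sum_bound N a b phi e : (0 < N)%N -> a <= b ->
  continuous_seg a b phi ->
  (forall x y, a <= x <= b -> a <= y <= b -> `|y - x| <= (b - a) / N%:R ->
     `|phi y - phi x| <= e) ->
  `|I a b phi - riemann_sum N a b phi| <= e * (b - a).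
Proof.
move=> N0 ab cphi phie; have N1 : 0 < N%:R :> R by rewrite ltr0n.
pose h := (b - a) / N%:R; have h0 : 0 <= h by rewrite divr_ge0 ?subr_ge0// ltW.
pose x k := a + h * k%:R.
have xb k : (k <= N)%N -> x k <= b.
  move=> kN; rewrite /x -lerBrDl /h mulrAC ler_pdivrMr//.
  by rewrite ler_wpM2l ?subr_ge0// ler_nat.
have ax k : a <= x k by rewrite lerDl mulr_ge0.
have xS k : x k.+1 = x k + h by rewrite /x -natr1 mulrDr mulr1 addrA.
have xN : x N = b by rewrite /x /h divfK ?gt_eqF// addrC subrK.
have H k : (k <= N)%N ->
    `|I a (x k) phi - h * \sum_(j < k) phi (x j)| <= e * (h * k%:R).
  elim: k => [|k IH] kN.
    rewrite big_ord0 !mulr0 subr0 /x mulr0 addr0 /segment_integral set_itv1.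
    by rewrite Rintegral_set1 normr0.
  have xk := xb _ kN; have xk' := xb _ (ltnW kN).
  have xkk : x k <= x k.+1 by rewrite xS lerDl.
  rewrite (@seg_split _ a (x k)); last 2 first.
  - by rewrite ax xkk.
  - exact: continuous_segS cphi.
  rewrite big_ord_recr /= mulrDr.
  have -> : I a (x k) phi + I (x k) (x k.+1) phi -
      (h * \sum_(i < k) phi (x i) + h * phi (x k)) =
      (I a (x k) phi - h * \sum_(i < k) phi (x i)) +
      (I (x k) (x k.+1) phi - phi (x k) * (x k.+1 - x k)).
    by rewrite xS; ring.
  have -> : e * (h * k.+1%:R) = e * (h * k%:R) + e * h by rewrite -natr1; ring.
  apply: le_trans (ler_normD _ _) _.
  apply: lerD; first exact: IH (ltnW kN).
  have -> : e * h = e * (x k.+1 - x k) by rewrite xS addrAC subrr add0r.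
  apply: seg_approx => //; first exact: continuous_segS cphi.
  move=> y /andP[xy yx]; apply: phie.
  - by rewrite ax xk'.
  - by rewrite (le_trans (ax k) xy) (le_trans yx xk).
  - by rewrite ger0_norm ?subr_ge0// lerBlDl -xS.
have := H _ (leqnn N); rewrite xN /h divfK ?gt_eqF//.
Qed.

Lemma continuous_seg_uniform a b phi e : continuous_seg a b phi -> 0 < e ->
  exists2 N0, (0 < N0)%N & forall N, (N0 <= N)%N ->
  forall x y, a <= x <= b -> a <= y <= b -> `|y - x| <= (b - a) / N%:R ->
  `|phi y - phi x| <= e.
Proof.
move=> cphi e0.
have [|d d0 dP] := @heine R phi `[a, b] e (@segment_compact _ a b) _ e0.
  by move=> x; rewrite /= in_itv /=; exact: cphi.
have [ba|ab] := ltP b a.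
  exists 1%N => // N _ x y /andP[ax xb]; have := le_trans ax xb.
  by rewrite leNgt ba.
have s0 : 0 < b - a + 1 by rewrite ltr_wpDl// subr_ge0.
have := divr_gt0 d0 s0 => /ltr_add_invr[n]; rewrite add0r ltr_pdivlMr// => hn.
exists n.+1 => // N nN x y xab yab xy; apply/ltW/dP.
  by rewrite /= in_itv.
rewrite /ball /= distrC; apply: le_lt_trans xy _; apply: le_lt_trans hn.
have N0 : 0 < N%:R :> R by rewrite ltr0n (leq_trans _ nN).
have h1 : N%:R^-1 <= n.+1%:R^-1 :> R by rewrite lef_pV2 ?posrE// ler_nat.
by rewrite mulrC; apply: ler_pM => //; rewrite ?invr_ge0 ?subr_ge0 ?lerDl// ltW.
Qed.

Lemma riemann_sum_cvg a b phi e : a <= b -> continuous_seg a b phi -> 0 < e ->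
  exists2 N0, (0 < N0)%N & forall N, (N0 <= N)%N ->
  `|I a b phi - riemann_sum N a b phi| <= e.
Proof.
move=> ab cphi e0; have s0 : 0 < b - a + 1 by rewrite ltr_wpDl// subr_ge0.
have [N0 N00 NP] := continuous_seg_uniform cphi (divr_gt0 e0 s0).
exists N0 => // N N0N.
apply: le_trans (riemann_sum_bound _ ab cphi (NP _ N0N)) _.
  exact: leq_trans N0N.
rewrite mulrAC ler_pdivrMr// ler_pM2l// lerDl//.
Qed.

(** Both integrals are limits of the same Riemann sums. *)
Lemma seg_translate a b s phi : a <= b -> continuous_seg (a + s) (b + s) phi ->
  I a b (fun t => phi (t + s)) = I (a + s) (b + s) phi.
Proof.
move=> ab cphi; have abs : a + s <= b + s by rewrite lerD2r.
have cphi' : continuous_seg a b (fun t => phi (t + s)).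
  move=> x xab; refine (@continuous_comp R R R (+%R^~ s) phi x _ _); last first.
    by apply: cphi; rewrite !lerD2r.
  refine (@continuousD R R R id (fun=> s) x _ _); [exact: cvg_id|exact: cvg_cst].
apply/eqP; rewrite -subr_eq0 -normr_le0; apply/ler_addgt0Pl => e e0; rewrite addr0.
have e2 : 0 < e / 2 by rewrite divr_gt0.
have [N1 _ H1] := riemann_sum_cvg ab cphi' e2.
have [N2 _ H2] := riemann_sum_cvg abs cphi e2.
have := H1 _ (leq_maxl N1 N2); have := H2 _ (leq_maxr N1 N2).
have -> : riemann_sum (maxn N1 N2) (a + s) (b + s) phi =
          riemann_sum (maxn N1 N2) a b (fun t => phi (t + s)).
  rewrite /riemann_sum; have -> : b + s - (a + s) = b - a by ring.
  by congr (_ * _); apply: eq_bigr => j _; rewrite addrAC.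
move=> h2 h1; rewrite (splitr e); apply: le_trans (ler_distD _ _ _) (lerD h1 _).
by rewrite distrC.
Qed.

Definition mean phi : R := (2 * pi)^-1 * I 0 (2 * pi) phi.

Lemma twopi_gt0 : 0 < 2 * pi :> R.
Proof. by rewrite mulr_gt0// pi_gt0. Qed.

Lemma continuous_seg_of phi a b : continuous phi -> continuous_seg a b phi.
Proof. by move=> cphi x _; exact: cphi. Qed.



Let pi2 := twopi_gt0.
Let ipi2 : 0 <= (2 * pi)^-1 :> R. Proof. by rewrite invr_ge0 ltW. Qed.

Lemma mean_cst (k : R) : mean (fun=> k) = k.
Proof. by rewrite /mean seg_cst ?ltW// subr0 mulrCA mulVf ?mulr1// gt_eqF. Qed.

Lemma mean_le phi psi : continuous phi -> continuous psi ->
  (forall t, 0 <= t <= 2 * pi -> phi t <= psi t) -> mean phi <= mean psi.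
Proof. by move=> c1 c2 H; rewrite ler_wpM2l// seg_le//; exact: continuous_seg_of. Qed.

Lemma eq_mean phi psi : (forall t, phi t = psi t) -> mean phi = mean psi.
Proof. by move=> H; congr (_ * _); apply: eq_seg. Qed.

Lemma meanD phi psi : continuous phi -> continuous psi ->
  mean (fun t => phi t + psi t) = mean phi + mean psi.
Proof.
by move=> c1 c2; rewrite /mean segD ?mulrDr//; exact: continuous_seg_of.
Qed.

Lemma meanB phi psi : continuous phi -> continuous psi ->
  mean (fun t => phi t - psi t) = mean phi - mean psi.
Proof.
by move=> c1 c2; rewrite /mean segB ?mulrBr//; exact: continuous_seg_of.
Qed.

Lemma meanZ (k : R) phi : continuous phi ->
  mean (fun t => k * phi t) = k * mean phi.
Proof. by move=> c1; rewrite /mean segZ 1?mulrCA//; exact: continuous_seg_of. Qed.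

Lemma continuous_sum_R N (phi : nat -> R -> R) : (forall j, continuous (phi j)) ->
  continuous (fun t => \sum_(j < N) phi j t).
Proof.
move=> c1; elim: N => [|N IH] t.
  have -> : (fun t => \sum_(j < 0) phi j t) = (fun=> 0).
    by apply/funext => u; rewrite big_ord0.
  exact: cvg_cst.
have -> : (fun t => \sum_(j < N.+1) phi j t) =
          (fun t => \sum_(j < N) phi j t + phi N t).
  by apply/funext => u; rewrite big_ord_recr.
exact: (@continuousD R R R _ _ t (IH t) (c1 N t)).
Qed.

Lemma mean_sum N (phi : nat -> R -> R) : (forall j, continuous (phi j)) ->
  mean (fun t => \sum_(j < N) phi j t) = \sum_(j < N) mean (phi j).
Proof.
move=> c1; elim: N => [|N IH].
  by rewrite big_ord0 -[RHS]mean_cst; apply: eq_mean => t; rewrite big_ord0.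
rewrite big_ord_recr /= -IH -meanD//; last exact: continuous_sum_R.
by apply: eq_mean => t; rewrite big_ord_recr.
Qed.

Lemma meanE phi : mean phi * (2 * pi) = I 0 (2 * pi) phi.
Proof. by rewrite /mean mulrAC mulVf ?mul1r// gt_eqF. Qed.

Lemma mean_approx phi (k : R) e : continuous phi ->
  (forall t, 0 <= t <= 2 * pi -> `|phi t - k| <= e) -> `|mean phi - k| <= e.
Proof.
move=> c1 H; have := seg_approx (ltW pi2) (@continuous_seg_of phi 0 (2 * pi) c1) H.
rewrite subr0 -meanE -mulrBl normrM (ger0_norm (ltW pi2)).
by rewrite ler_pM2r.
Qed.

Lemma mean_ge0_eq0 phi : continuous phi -> (forall t, 0 <= phi t) ->
  mean phi <= 0 -> forall t, 0 <= t <= 2 * pi -> phi t = 0.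
Proof.
move=> c1 p0; rewrite pmulr_rle0 ?invr_gt0// => H.
by apply: seg_ge0_eq0 => //; exact: continuous_seg_of.
Qed.

(** The part of [s, s + 2 pi] beyond 2 pi is moved back to [0, s] by periodicity. *)
Lemma mean_shift phi s : continuous phi -> (forall t, phi (t + 2 * pi) = phi t) ->
  0 <= s <= 2 * pi -> mean (fun t => phi (t + s)) = mean phi.
Proof.
move=> c1 per /andP[s0 s2]; congr (_ * _).
rewrite seg_translate ?ltW// ?add0r; last exact: continuous_seg_of.
rewrite (@seg_split _ s (2 * pi)) ?s2 ?lerDl//; last exact: continuous_seg_of.
rewrite [RHS](@seg_split _ 0 s) ?s0//; last exact: continuous_seg_of.
rewrite addrC; congr (_ + _).
have := @seg_translate 0 s (2 * pi) phi s0 (continuous_seg_of c1).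
by rewrite add0r [s + _]addrC => <-; apply: eq_seg => t _; rewrite per.
Qed.

Lemma mean_riemann phi N e : (0 < N)%N -> continuous phi ->
  (forall x y, 0 <= x <= 2 * pi -> 0 <= y <= 2 * pi ->
     `|y - x| <= 2 * pi / N%:R -> `|phi y - phi x| <= e) ->
  `|mean phi - N%:R^-1 * \sum_(j < N) phi (2 * pi / N%:R * j%:R)| <= e.
Proof.
move=> N0 c1 H; have N1 : N%:R != 0 :> R by rewrite pnatr_eq0 -lt0n.
have := @riemann_sum_bound N 0 (2 * pi) phi e N0 (ltW pi2) (continuous_seg_of c1).
rewrite subr0 => /(_ H); rewrite /riemann_sum subr0 => h.
move: h; under eq_bigr do rewrite add0r.
set S := \sum_(j < N) _.
have -> : I 0 (2 * pi) phi - 2 * pi / N%:R * S = (mean phi - N%:R^-1 * S) * (2 * pi).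
  by rewrite -meanE; ring.
by rewrite normrM (ger0_norm (ltW pi2)) ler_pM2r.
Qed.

Lemma continuous_fst_slice (Phi : R * R -> R) s : continuous Phi ->
  continuous (fun t => Phi (s, t)).
Proof.
move=> cP t; have c : {for t, continuous (fun t => (s, t))}.
  move=> A [[P Q] [/= Ps Qt] PQA]; apply: filterS Qt => y Qy.
  by apply: PQA; split => //=; exact: nbhs_singleton Ps.
exact: (@continuous_comp R (R * R)%type R (fun t => (s, t)) Phi t c (cP _)).
Qed.

Lemma continuous_snd_slice (Phi : R * R -> R) t : continuous Phi ->
  continuous (fun s => Phi (s, t)).
Proof.
move=> cP s; have c : {for s, continuous (fun s => (s, t))}.
  move=> A [[P Q] [/= Ps Qt] PQA]; apply: filterS Ps => y Py.
  by apply: PQA; split => //=; exact: nbhs_singleton Qt.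
exact: (@continuous_comp R (R * R)%type R (fun s => (s, t)) Phi s c (cP _)).
Qed.

Lemma heine2 (Phi : R * R -> R) a b e : continuous Phi -> 0 < e ->
  exists2 d, 0 < d & forall s t s' t', a <= s <= b -> 0 <= t <= 2 * pi ->
    `|s - s'| < d -> `|t - t'| < d -> `|Phi (s', t') - Phi (s, t)| < e.
Proof.
move=> cP e0.
have cK : compact (`[a, b] `*` `[0, 2 * pi] : set (R * R)).
  by apply: compact_setX; exact: segment_compact.
have [|d d0 dP] := @heine (R * R)%type Phi _ e cK _ e0.
  by move=> x _; exact: cP.
exists d => // s t s' t' sab t2 ss tt; apply: dP; first by split; rewrite /= in_itv.
by split.
Qed.

Lemma continuous_mean (Phi : R * R -> R) : continuous Phi ->
  continuous (fun s => mean (fun t => Phi (s, t))).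
Proof.
move=> cP s; apply/cvgrPdistC_lt => e e0.
have e2 : 0 < e / 2 by rewrite divr_gt0.
have [d d0 dP] := @heine2 Phi s s (e / 2) cP e2.
apply/nbhs_ballP; exists d => // s'; rewrite /ball /= => ss.
rewrite -meanB; [|exact: continuous_fst_slice..].
rewrite -[X in `|X|]subr0; apply: le_lt_trans (_ : e / 2 < e); last first.
  by rewrite ltr_pdivrMr// ltr_pMr// ltr1n.
apply: mean_approx => [t|t t2].
  exact: (@continuousB R R R _ _ t (@continuous_fst_slice Phi s' cP t)
    (@continuous_fst_slice Phi s cP t)).
by rewrite subr0 ltW// dP ?lexx// subrr normr0.
Qed.

(** The mean in t is replaced by a Riemann sum, uniformly in s by [heine2]; a finite sum commutes
    with the mean in s. *)
Lemma mean_exchange (Phi : R * R -> R) : continuous Phi ->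
  mean (fun s => mean (fun t => Phi (s, t))) =
  mean (fun t => mean (fun s => Phi (s, t))).
Proof.
move=> cP; pose Psi := fun p : R * R => Phi (p.2, p.1).
have cPsi : continuous Psi.
  move=> p; have c : {for p, continuous (fun p : R * R => (p.2, p.1))}.
    move=> A [[P Q] [/= Pp Qp] PQA]; exists (Q, P) => //= -[x y] /= [Qx Py].
    by apply: PQA.
  exact: (@continuous_comp _ (R * R)%type R (fun p => (p.2, p.1)) Phi p c (cP _)).
have c1 := continuous_mean cP; have c2 := continuous_mean cPsi.
apply/eqP; rewrite -subr_eq0 -normr_le0; apply/ler_addgt0Pl => e e0; rewrite addr0.
have e2 : 0 < e / 2 by rewrite divr_gt0.
have [d d0 dP] := heine2 0 (2 * pi) cP e2.
have := divr_gt0 d0 pi2 => /ltr_add_invr[n]; rewrite add0r ltr_pdivlMr// mulrC => hn.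
have nd x y : `|y - x| <= 2 * pi / n.+1%:R -> `|x - y| < d.
  by rewrite distrC => h; exact: le_lt_trans h hn.
set T := mean (fun t => mean (fun s => Phi (s, t))).
pose A := n.+1%:R^-1 * \sum_(j < n.+1)
  mean (fun s => Phi (s, 2 * pi / n.+1%:R * j%:R)).
have TA : `|T - A| <= e / 2.
  apply: (@mean_riemann (fun t => mean (fun s => Phi (s, t)))) => //.
  move=> x y x2 y2 xy; rewrite -meanB; [|exact: continuous_snd_slice..].
  rewrite -[X in `|X|]subr0; apply: mean_approx => [s|s s2].
    exact: (@continuousB R R R _ _ s (@continuous_snd_slice Phi _ cP s)
      (@continuous_snd_slice Phi _ cP s)).
  by rewrite subr0 ltW// dP ?subrr ?normr0// nd.
have AE : A = mean (fun s => n.+1%:R^-1 *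
    \sum_(j < n.+1) Phi (s, 2 * pi / n.+1%:R * j%:R)).
  rewrite meanZ; last by apply: (@continuous_sum_R _ (fun j s => Phi (s, 2 * pi / n.+1%:R * j%:R))) => j;
    exact: continuous_snd_slice.
  rewrite (@mean_sum _ (fun j s => Phi (s, 2 * pi / n.+1%:R * j%:R)))//.
  by move=> j; exact: continuous_snd_slice.
rewrite (splitr e); apply: le_trans (ler_distD A _ _) _; apply: lerD; last first.
  by rewrite distrC.
have c3 : continuous (fun s => n.+1%:R^-1 *
    \sum_(j < n.+1) Phi (s, 2 * pi / n.+1%:R * j%:R)).
  move=> s; refine (@continuousM R R (fun=> n.+1%:R^-1) _ s (cvg_cst _) _).
  apply: (@continuous_sum_R _ (fun j s => Phi (s, 2 * pi / n.+1%:R * j%:R))) => j.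
  exact: continuous_snd_slice.
rewrite AE -meanB// -[X in `|X|]subr0; apply: mean_approx => [s|s s2].
  exact: (@continuousB R R R _ _ s (c1 s) (c3 s)).
rewrite subr0; apply: mean_riemann => //; first exact: continuous_fst_slice.
by move=> x y x2 y2 xy; rewrite ltW// dP ?subrr ?normr0// nd.
Qed.

End CircleMean.

(** * Circle means of real parts of holomorphic functions *)

Section HolomorphicMeans.
Context {R : realType}.
Local Notation C := R[i].
Implicit Types (a z w : C) (r s t x y : R) (f g G Phi : C -> C).

Local Notation I := segment_integral.

Definition circle a r t : C := a + r%:C%C * expi t.

Lemma normc_circle a r t : normc (circle a r t - a) = `|r|.
Proof. by rewrite /circle addrC addKr normcM normc_expi mulr1 normc_real. Qed.

Lemma circle_periodic a r t : circle a r (t + 2 * pi) = circle a r t.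
Proof. by rewrite /circle expi_periodic. Qed.

Lemma continuous_circle a r : continuous (circle a r : R -> C).
Proof.
move=> t; refine (@continuousD C C R (fun=> a) _ t (cvg_cst _) _).
exact: (@continuousM C R (fun=> r%:C%C) expi t (cvg_cst _) (@continuous_expi R t)).
Qed.

Lemma continuous_circle2 a :
  continuous (fun p : R * R => circle a p.1 p.2 : C).
Proof.
move=> p; refine (@continuousD C C _ (fun=> a) _ p (cvg_cst _) _).
refine (@continuousM C _ (fun p : R * R => p.1%:C%C) (fun p => expi p.2) p _ _).
  exact: (@continuous_comp _ R C fst (fun x : R => x%:C%C) p cvg_fst
    (@continuous_real_complex R p.1)).
exact: (@continuous_comp _ R C snd expi p cvg_snd (@continuous_expi R p.2)).
Qed.

Lemma ReB z w : Re (z - w) = Re z - Re w.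
Proof. by case: z w => a b [c d]. Qed.

Lemma ImB z w : Im (z - w) = Im z - Im w.
Proof. by case: z w => a b [c d]. Qed.

Lemma ReM z w : Re (z * w) = Re z * Re w - Im z * Im w.
Proof. by case: z w => a b [c d]. Qed.

Lemma ImM z w : Im (z * w) = Re z * Im w + Im z * Re w.
Proof. by case: z w => a b [c d]. Qed.

Lemma CR_of_cdiff G x y : cdiff G (x +i* y)%C ->
  CR (fun x y => Re (G (x +i* y)%C)) (fun x y => Im (G (x +i* y)%C)) x y.
Proof.
move=> [q cq Gq]; exists (Re (q (x +i* y)%C)), (Im (q (x +i* y)%C)) => e e0.
have [d d0 dP] := (continuous_CCP q _).1 cq _ e0.
have d2 : 0 < d / 2 by rewrite divr_gt0.
exists (d / 2) => // x' y' xx yy.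
have wz : (x' +i* y')%C - (x +i* y)%C = ((x' - x) +i* (y' - y))%C by [].
have nwz : normc ((x' - x) +i* (y' - y))%C <= `|x' - x| + `|y' - y|.
  exact: normc_le_ReIm.
have qe : normc (q (x' +i* y')%C - q (x +i* y)%C) < e.
  by apply: dP; rewrite wz; apply: le_lt_trans nwz _; rewrite (splitr d) ltrD.
set z := (x +i* y)%C in Gq qe *; set w := (x' +i* y')%C in wz qe *.
have E : G w - G z - q z * (w - z) = (q w - q z) * (w - z).
  by rewrite [G w]Gq; ring.
have nE : normc (G w - G z - q z * (w - z)) <= e * (`|x' - x| + `|y' - y|).
  rewrite E normcM wz; apply: ler_pM; rewrite ?normc_ge0//; exact: ltW.
have RE : Re (G w) - Re (G z) - (Re (q z) * (x' - x) - Im (q z) * (y' - y)) =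
    Re (G w - G z - q z * (w - z)).
  by rewrite wz !ReB ReM.
have IE : Im (G w) - Im (G z) - (Im (q z) * (x' - x) + Re (q z) * (y' - y)) =
    Im (G w - G z - q z * (w - z)).
  by rewrite wz !ImB ImM [Re _ * _ + _]addrC.
rewrite RE IE; split; apply: le_trans nE.
  exact: Re_le_normc.
exact: Im_le_normc.
Qed.

(** Goursat on the rectangle of height 2 pi: the horizontal sides contribute only the constant jump
    k. The value k = 0 serves circle means, and k = 2 pi n serves logarithms with winding number
    n. *)
Lemma period_flux G x1 x2 (k : R) : x1 <= x2 ->
  (forall x y, x1 <= x <= x2 -> 0 <= y <= 2 * pi -> cdiff G (x +i* y)%C) ->
  (forall x, x1 <= x <= x2 -> Im (G (x +i* (2 * pi))%C) - Im (G (x +i* 0)%C) = k) ->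
  I 0 (2 * pi) (fun y => Re (G (x2 +i* y)%C)) -
  I 0 (2 * pi) (fun y => Re (G (x1 +i* y)%C)) = k * (x2 - x1).
Proof.
move=> x12 dG per.
have cr : CR_on (fun x y => Re (G (x +i* y)%C)) (fun x y => Im (G (x +i* y)%C))
    x1 x2 0 (2 * pi).
  by move=> x y xx yy; apply: CR_of_cdiff; exact: dG.
have := goursat x12 (ltW twopi_gt0) cr.
rewrite /boundary_integral.
have -> : I x1 x2 (fun x => Im (G (x +i* 0)%C) - Im (G (x +i* (2 * pi))%C)) =
    I x1 x2 (fun=> - k).
  by apply: eq_seg => x xx; rewrite -(per x xx) opprB.
rewrite seg_cst// segB; last 2 first.
- by apply: (CR_on_ver cr); rewrite lexx x12.
- by apply: (CR_on_ver cr); rewrite lexx x12.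
by rewrite mulNr => /eqP; rewrite addrC subr_eq0 => /eqP.
Qed.

Definition cmean (W : C -> R) a r : R := mean (fun t => W (circle a r t)).

Lemma cexp_circle a x y : a + cexp (x +i* y)%C = circle a (expR x) y.
Proof. by []. Qed.

Lemma cdiff_add_cexp a z : cdiff (fun w => a + cexp w) z.
Proof. by apply: cdiffD; [exact: cdiff_cst|exact: cdiff_cexp]. Qed.

(** The map w to a + exp w turns the annulus into a rectangle on which the pulled back function has
    period 2 pi i, hence no jump. *)
Lemma circle_mean_const f a r1 r2 : 0 < r1 -> r1 <= r2 ->
  (forall z, r1 <= normc (z - a) <= r2 -> cdiff f z) ->
  cmean (fun z => Re (f z)) a r1 = cmean (fun z => Re (f z)) a r2.
Proof.
move=> r10 r12 df; have r20 := lt_le_trans r10 r12.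
have l12 : ln r1 <= ln r2 by rewrite ler_ln.
have dG x y : ln r1 <= x <= ln r2 -> 0 <= y <= 2 * pi ->
    cdiff (fun w => f (a + cexp w)) (x +i* y)%C.
  move=> /andP[x1 x2] _; apply: cdiff_comp; first exact: cdiff_add_cexp.
  apply: df; rewrite cexp_circle normc_circle ger0_norm ?expR_ge0//.
  by rewrite -[r1]lnK// -[r2]lnK// !ler_expR x1 x2.
have := period_flux (k := 0) l12 dG; rewrite mul0r => H.
rewrite /cmean /mean; congr (_ * _); apply/eqP; rewrite eq_sym -subr_eq0; apply/eqP.
rewrite -[RHS]H => [|x _]; last first.
  by rewrite !cexp_circle -[2 * pi]add0r circle_periodic subrr.
by congr (_ - _); apply: eq_seg => y _; rewrite cexp_circle lnK.
Qed.

Lemma continuous_Re_comp f z : {for z, continuous f} ->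
  {for z, continuous (fun w => Re (f w))}.
Proof.
by move=> cf; exact: (@continuous_comp C C R f (@complex.Re R) z cf (@continuous_Re R _)).
Qed.

Lemma continuous_on_circle (W : C -> R) a r :
  (forall t, {for circle a r t, continuous W}) ->
  continuous (fun t => W (circle a r t)).
Proof.
by move=> cW t; exact: (@continuous_comp R C R (circle a r) W t (@continuous_circle a r t) (cW t)).
Qed.

Lemma circle_mean_value f a r : 0 < r -> {for a, continuous f} ->
  (forall z, 0 < normc (z - a) <= r -> cdiff f z) ->
  cmean (fun z => Re (f z)) a r = Re (f a).
Proof.
move=> r0 cf df.
apply/eqP; rewrite -subr_eq0 -normr_le0; apply/ler_addgt0Pl => e e0; rewrite addr0.
have [d d0 dP] := (continuous_CRP _ _).1 (continuous_Re_comp cf) _ e0.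
pose r1 := Num.min (d / 2) r.
have r10 : 0 < r1 by rewrite lt_min r0 divr_gt0.
have r1d : r1 < d by rewrite gt_min ltr_pdivrMr// ltr_pMr// ltr1n.
have r1r : r1 <= r by rewrite ge_min lexx orbT.
rewrite -(circle_mean_const r10 r1r); last first.
  by move=> z /andP[z1 z2]; apply: df; rewrite (lt_le_trans r10 z1).
apply: mean_approx => [|t _].
  refine (@continuous_on_circle (fun z => Re (f z)) a r1
    (fun t => continuous_Re_comp (cdiff_continuous (df _ _)))).
  by rewrite normc_circle gtr0_norm// r10.
by apply/ltW/dP; rewrite normc_circle gtr0_norm.
Qed.

(** A multiple of 2 pi brings t into [0, 2 pi); there cos s = 1 forces s = 0, by injectivity of cos
    on [0, pi] applied to s or to 2 pi - s. *)
Lemma expi_eq1 t : expi t = 1 :> C -> exists n : int, t = 2 * pi * n%:~R.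
Proof.
move=> e1; pose n := Num.floor (t / (2 * pi)); exists n.
have p2 : 0 < 2 * pi :> R := twopi_gt0.
pose s := t - 2 * pi * n%:~R.
have [s0 s2] : 0 <= s /\ s < 2 * pi.
  have /andP[n1 n2] : n%:~R <= t / (2 * pi) < (n + 1)%:~R by exact: floor_itv.
  split; first by rewrite subr_ge0 mulrC -ler_pdivlMr.
  by move: n2; rewrite ltr_pdivrMr// intrD /s; clear; lra.
have es : cos s = 1.
  have : expi s = 1 :> C.
    have eper (m : int) u : expi (u + 2 * pi * m%:~R) = expi u :> C.
      have eperN k v : expi (v + 2 * pi * k%:R) = expi v :> C.
        elim: k v => [|k IH] v; first by rewrite mulr0 addr0.
        by rewrite -[k.+1%:R]natr1 mulrDr mulr1 addrA expi_periodic IH.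
      case: m => k; first exact: eperN.
      by rewrite NegzE mulrNz mulrN -pmulrn -[LHS](eperN k.+1) subrK.
    by rewrite -[LHS](eper n) /s subrK.
  by move=> /(congr1 (@complex.Re R)).
suff : s = 0 by move/eqP; rewrite subr_eq0 => /eqP.
have [sp|sp] := leP s pi.
  by apply: cos_inj; rewrite ?in_itv/= ?s0 ?sp ?lexx ?pi_ge0// es cos0.
have : 2 * pi - s = 0.
  apply: cos_inj; rewrite ?in_itv/= ?lexx ?pi_ge0//; first by apply/andP; split; lra.
  have -> : cos (2 * pi - s) = cos s.
    by rewrite -[RHS]cosN -[RHS]cosD2pi; congr cos; rewrite mulr_natl addrC.
  by rewrite es cos0.
lra.
Qed.

(** Otherwise the intermediate value theorem would produce a value 2 pi (k + 1/2) with k an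
    integer. *)
Lemma int_valued_const (D : R -> R) x1 x2 : x1 <= x2 -> continuous_seg x1 x2 D ->
  (forall x, x1 <= x <= x2 -> exists n : int, D x = 2 * pi * n%:~R) ->
  exists n : int, forall x, x1 <= x <= x2 -> D x = 2 * pi * n%:~R.
Proof.
move=> x12 cD Dn; have [|n nE] := Dn x1; first by rewrite lexx x12.
have p2 : 0 < 2 * pi :> R := twopi_gt0.
have p2n : 2 * pi != 0 :> R by rewrite gt_eqF.
exists n => x xx; have [m mE] := Dn x xx; have [x1x xx2] := andP xx.
have [mn|mn] := eqVneq m n; first by rewrite mE mn.
have cw : {within `[x1, x], continuous D}.
  apply: continuous_in_subspaceT => y; rewrite inE /= in_itv /= => /andP[y1 y2].
  by apply: cD; rewrite y1 (le_trans y2).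
have no (k : int) : ~ (exists2 c, c \in `[x1, x] & D c = 2 * pi * (k%:~R + 2^-1)).
  move=> [c]; rewrite in_itv /= => /andP[c1 c2].
  have [|l ->] := Dn c; first by rewrite c1 (le_trans c2).
  move=> /(mulfI p2n) h.
  have : (2 * l)%:~R = (2 * k + 1)%:~R :> R.
    by rewrite intrD !intrM h; field.
  by move=> /intr_inj; lia.
have sgap (u v : int) : (u < v)%R ->
    2 * pi * u%:~R <= 2 * pi * (u%:~R + 2^-1) :> R /\
    2 * pi * (u%:~R + 2^-1) <= 2 * pi * v%:~R :> R.
  move=> uv; rewrite !ler_pM2l//.
  have : (u + 1)%:~R <= v%:~R :> R by rewrite ler_int; lia.
  rewrite intrD; split; lra.
have [mn1|mn1|/eqP] := ltgtP m n; last by rewrite (negPf mn).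
  have [g1 g2] := sgap _ _ mn1.
  exfalso; apply: (no m); apply: IVT => //.
  by rewrite nE mE ge_min le_max g1 g2 orbT.
have [g1 g2] := sgap _ _ mn1.
exfalso; apply: (no n); apply: IVT => //.
by rewrite nE mE ge_min le_max g1 g2 orbT.
Qed.

End HolomorphicMeans.

(** * Logarithms on rectangles and winding numbers *)

Section LogarithmLift.
Context {R : realType}.
Local Notation C := R[i].
Implicit Types (a z w : C) (r s t x y e : R) (f g G H Phi : C -> C).

Local Notation I := segment_integral.

Lemma continuous_ln_normc f z : {for z, continuous f} -> f z != 0 ->
  {for z, continuous (fun w => ln (normc (f w)))}.
Proof.
move=> cf fz; refine (@continuous_comp C R R (fun w => normc (f w)) (@ln R) z
  (continuous_normcE cf) (continuous_ln _)).
by rewrite normc_gt0.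
Qed.

Definition rectangle x1 x2 z := x1 <= Re z <= x2 /\ 0 <= Im z <= 2 * pi.

Lemma Re_near1_gt0 z : normc (z - 1) < 1 -> 0 < Re z.
Proof.
move=> /(le_lt_trans (Re_le_normc _)); rewrite ReB ltr_distl => /andP[+ _].
by rewrite subrr.
Qed.

(** Uniform continuity is measured against the minimum of |G| on the compact rectangle. The bound 1
    puts the quotient in the half-plane where [clog] inverts [cexp]. *)
Lemma rectangle_uniform G x1 x2 : x1 <= x2 ->
  (forall z, rectangle x1 x2 z -> {for z, continuous G}) ->
  (forall z, rectangle x1 x2 z -> G z != 0) ->
  exists2 d, 0 < d & forall z w, rectangle x1 x2 z -> normc (w - z) < d ->
    normc (G w / G z - 1) < 1.
Proof.
move=> x12 cG G0.
pose K : set (R * R) := `[x1, x2] `*` `[0, 2 * pi].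
have cK : compact K by apply: compact_setX; exact: segment_compact.
pose P (p : R * R) : C := (p.1 +i* p.2)%C.
have KP p : K p -> rectangle x1 x2 (P p).
  by case: p => u v [] /=; rewrite !in_itv /=.
have cP (p : R * R) : {for p, continuous P}.
  by apply/continuous_ReIm; split; [exact: cvg_fst|exact: cvg_snd].
have cGP p : K p -> {for p, continuous (fun p => G (P p))}.
  by move=> /KP Kp; exact: (@continuous_comp _ C C P G p (cP p) (cG _ Kp)).
have [m m0 mP] : exists2 m : R, 0 < m & forall z, rectangle x1 x2 z -> m <= normc (G z).
  have K0 : K !=set0.
    by exists (x1, 0); split; rewrite /= in_itv /= lexx ?x12// ltW// twopi_gt0.
  have cn : {within K, continuous (fun p => normc (G (P p)))}.
    apply: continuous_in_subspaceT => p; rewrite inE => Kp.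
    exact: (continuous_normcE (cGP _ Kp)).
  have [c] := compact_EVT_min K0 cK cn; rewrite inE => Kc cmin.
  exists (normc (G (P c))); first by rewrite normc_gt0 G0//; exact: KP.
  case=> u v [uu vv]; apply: (cmin (u, v)).
  by rewrite inE; split; rewrite /= in_itv.
have m2 : 0 < m / 2 by rewrite divr_gt0.
have cRe p : K p -> {for p, continuous (fun p => Re (G (P p)))}.
  by move=> /cGP /continuous_ReIm[].
have cIm p : K p -> {for p, continuous (fun p => Im (G (P p)))}.
  by move=> /cGP /continuous_ReIm[].
have [d1 d10 d1P] := heine cK cRe m2.
have [d2 d20 d2P] := heine cK cIm m2.
exists (Num.min d1 d2) => [|[u v] [u' v'] [/= uu vv]]; first by rewrite lt_min d10.
rewrite lt_min => /andP[n1 n2].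
have Kuv : K (u, v) by split; rewrite /= in_itv.
have nr := Re_le_normc ((u' +i* v')%C - (u +i* v)%C).
have ni := Im_le_normc ((u' +i* v')%C - (u +i* v)%C).
rewrite ReB /= in nr; rewrite ImB /= in ni.
have b1 : ball (u, v) d1 (u', v').
  split; rewrite /ball /= distrC; [exact: le_lt_trans nr n1|exact: le_lt_trans ni n1].
have b2 : ball (u, v) d2 (u', v').
  split; rewrite /ball /= distrC; [exact: le_lt_trans nr n2|exact: le_lt_trans ni n2].
have h1 := d1P _ _ Kuv b1; have h2 := d2P _ _ Kuv b2.
have G0' := G0 _ (KP _ Kuv).
have mG := mP _ (KP _ Kuv).
have -> : G (u' +i* v')%C / G (u +i* v)%C - 1 =
    (G (u' +i* v')%C - G (u +i* v)%C) / G (u +i* v)%C by rewrite mulrBl divff.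
rewrite normcM normcV ltr_pdivrMr ?normc_gt0// mul1r; apply: lt_le_trans mG.
apply: le_lt_trans (normc_le_ReIm _) _; rewrite ReB ImB (splitr m).
exact: ltrD.
Qed.

Lemma prod_telescope (u : nat -> C) N : (forall i, (i <= N)%N -> u i != 0) ->
  \prod_(i < N) (u i.+1 / u i) = u N / u 0%N.
Proof.
elim: N => [|N IH] u0; first by rewrite big_ord0 divff// u0.
rewrite big_ord_recr /= IH => [|i iN]; last by rewrite u0// leqW.
by field; rewrite !u0.
Qed.

Lemma cexp_sum N (h : nat -> C) : cexp (\sum_(i < N) h i) = \prod_(i < N) cexp (h i).
Proof.
elim: N => [|N IH]; first by rewrite !big_ord0 cexp0.
by rewrite !big_ord_recr /= cexpD IH.
Qed.

(* The logarithm of G is the telescoping sum of principal logarithms of the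
   ratios of the values of G at N equidistant points of the segment [z0, z];
   for N large all these ratios are close to 1. *)
Lemma log_lift G x1 x2 : x1 <= x2 ->
  (forall z, rectangle x1 x2 z -> cdiff G z) ->
  (forall z, rectangle x1 x2 z -> G z != 0) ->
  exists H, forall z, rectangle x1 x2 z ->
    cdiff H z /\ cexp (H z) = G z / G (x1 +i* 0)%C.
Proof.
move=> x12 dG G0; pose z0 : C := (x1 +i* 0)%C.
have [d d0 dP] := rectangle_uniform x12 (fun z zr => cdiff_continuous (dG z zr)) G0.
pose M := (x2 - x1) + 2 * pi.
have M0 : 0 < M by rewrite ltr_wpDl ?subr_ge0// twopi_gt0.
have [n hn] : exists n : nat, M / n.+1%:R < d.
  have := divr_gt0 d0 M0 => /ltr_add_invr[n]; rewrite add0r ltr_pdivlMr// => hn.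
  by exists n; rewrite mulrC.
have N0 : 0 < n.+1%:R :> R by rewrite ltr0n.
pose c (i : nat) : R := i%:R / n.+1%:R.
pose p (i : nat) z : C := z0 + (c i)%:C%C * (z - z0).
have c01 i : (i <= n.+1)%N -> 0 <= c i <= 1.
  by move=> iN; rewrite divr_ge0//= ler_pdivrMr// mul1r ler_nat.
have rp i z : (i <= n.+1)%N -> rectangle x1 x2 z -> rectangle x1 x2 (p i z).
  move=> /c01 /andP[c0 c1]; case: z => u v [/= /andP[u1 u2] /andP[v1 v2]].
  rewrite /rectangle /p /z0 /= !mul0r !subr0 !add0r !addr0.
  have e1 : 0 <= c i * (u - x1) by rewrite mulr_ge0// subr_ge0.
  have e2 : c i * (u - x1) <= u - x1 by rewrite ler_piMl// subr_ge0.
  have e3 : 0 <= c i * v by rewrite mulr_ge0.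
  have e4 : c i * v <= v by rewrite ler_piMl.
  by split; apply/andP; split; move: e1 e2 e3 e4 u1 u2 v1 v2; clear; lra.
have pS i z : p i.+1 z - p i z = (n.+1%:R^-1)%:C%C * (z - z0).
  have -> : p i.+1 z - p i z = (c i.+1 - c i)%:C%C * (z - z0).
    by rewrite /p rmorphB /=; ring.
  congr (_ * _); congr (_%:C)%C; rewrite /c -mulrBl -[i.+1%:R]natr1 addrAC subrr add0r.
  by rewrite mul1r.
have pd i z : rectangle x1 x2 z -> normc (p i.+1 z - p i z) < d.
  move=> zr; rewrite pS normcM normc_real ger0_norm ?invr_ge0// mulrC.
  apply: le_lt_trans hn; rewrite ler_pM2r ?invr_gt0//.
  apply: le_trans (normc_le_ReIm _) _; rewrite /z0 ReB ImB /= subr0.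
  by case: zr => /andP[? ?] /andP[? ?]; apply: lerD; rewrite ger0_norm ?subr_ge0// lerD2r.
pose q i z := G (p i.+1 z) / G (p i z).
have q0 i z : (i < n.+1)%N -> rectangle x1 x2 z -> 0 < Re (q i z).
  move=> iN zr; apply/Re_near1_gt0/dP; last exact: pd.
  by apply: rp => //; exact: ltnW.
exists (fun z => \sum_(i < n.+1) clog (q i z)) => z zr; split.
  apply: (@cdiff_sum _ _ (fun i z => clog (q i z))) => i iN.
  have dp j : cdiff (p j) z.
    apply: cdiffD; first exact: cdiff_cst.
    by apply: cdiffZ; apply: cdiffB; [exact: cdiff_id|exact: cdiff_cst].
  apply: (@cdiff_comp _ clog (q i)); last by apply: cdiff_clog; exact: q0.
  apply: cdiff_div.
  - by apply: cdiff_comp => //; apply: dG; exact: rp.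
  - by apply: cdiff_comp => //; apply: dG; apply: rp => //; exact: ltnW.
  - by apply: G0; apply: rp => //; exact: ltnW.
rewrite (@cexp_sum _ (fun i => clog (q i z))).
under eq_bigr => i _ do rewrite clogK ?q0//.
rewrite (@prod_telescope (fun i => G (p i z))) => [|i iN]; last first.
  by apply: G0; exact: rp.
rewrite /p /c divff ?gt_eqF// mul0r !mul1r mul0r addr0.
by rewrite addrC subrK.
Qed.

(** n is the winding number of Phi along the circles. The pullback of Phi by w to a + exp w has a
    logarithm H whose imaginary part grows by 2 pi n over a period, and [period_flux] makes n the
    slope of the mean in x = ln r. *)
Lemma log_mean_winding Phi a x1 x2 : x1 <= x2 ->
  (forall z, expR x1 <= normc (z - a) <= expR x2 -> cdiff Phi z /\ Phi z != 0) ->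
  exists n : int, forall x, x1 <= x <= x2 ->
    cmean (fun z => ln (normc (Phi z))) a (expR x) -
    cmean (fun z => ln (normc (Phi z))) a (expR x1) = n%:~R * (x - x1).
Proof.
move=> x12 dPhi; pose G w := Phi (a + cexp w).
have rc z : rectangle x1 x2 z -> expR x1 <= normc (a + cexp z - a) <= expR x2.
  by move=> [zr _]; rewrite addrC addKr normc_cexp !ler_expR.
have dG z : rectangle x1 x2 z -> cdiff G z.
  move=> zr; apply: cdiff_comp; first exact: cdiff_add_cexp.
  by have [] := dPhi _ (rc _ zr).
have G0 z : rectangle x1 x2 z -> G z != 0.
  by move=> zr; have [] := dPhi _ (rc _ zr).
have [H HP] := log_lift x12 dG G0.
have p20 : 0 <= 2 * pi :> R by rewrite ltW// twopi_gt0.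
have rb x : x1 <= x <= x2 -> rectangle x1 x2 (x +i* 0)%C by split; rewrite //= lexx.
have rt x : x1 <= x <= x2 -> rectangle x1 x2 (x +i* (2 * pi))%C.
  by split; rewrite //= lexx andbT.
have r0 := rb x1; rewrite lexx x12 in r0.
set g0 := G (x1 +i* 0)%C in HP; have g00 : g0 != 0 by exact: G0 (r0 isT).
have ReH z : rectangle x1 x2 z -> Re (H z) = ln (normc (G z)) - ln (normc g0).
  move=> zr; have [_ /(congr1 (@normc R))] := HP z zr.
  rewrite normc_cexp normcM normcV => /(congr1 (@ln R)); rewrite expRK => ->.
  by rewrite ln_div// posrE normc_gt0// G0.
have [n nP] : exists n : int, forall x, x1 <= x <= x2 ->
    Im (H (x +i* (2 * pi))%C) - Im (H (x +i* 0)%C) = 2 * pi * n%:~R.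
  apply: (@int_valued_const _ (fun x => Im (H (x +i* (2 * pi))%C) - Im (H (x +i* 0)%C))) => //.
    move=> x xx; refine (@continuousB R R R (fun x => Im (H (x +i* (2 * pi))%C))
      (fun x => Im (H (x +i* 0)%C)) x _ _).
      have [dH _] := HP _ (rt x xx).
      by have [_ _ c _] := CR_continuous (CR_of_cdiff dH).
    have [dH _] := HP _ (rb x xx).
    by have [_ _ c _] := CR_continuous (CR_of_cdiff dH).
  (* The pullback G has period 2 pi i, so exp H agrees at both ends and the jump of Im H is a
     multiple of 2 pi. *)
  move=> x xx; apply: expi_eq1.
  have [_ e1] := HP _ (rt x xx); have [_ e2] := HP _ (rb x xx).
  have GE : G (x +i* (2 * pi))%C = G (x +i* 0)%C.
    by rewrite /G !cexp_circle -[2 * pi]add0r circle_periodic.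
  have : cexp (H (x +i* (2 * pi))%C) = cexp (H (x +i* 0)%C) by rewrite e1 e2 GE.
  rewrite /cexp !ReH; [|exact: rb|exact: rt]; rewrite GE => /mulfI h.
  rewrite expiD expiN h ?divff ?expi_neq0//.
  by rewrite -normc_eq0 normc_real normr_eq0 expR_eq0.
exists n => x xx; have [x1x xx2] := andP xx.
have cdH u y : x1 <= u <= x -> 0 <= y <= 2 * pi -> cdiff H (u +i* y)%C.
  move=> /andP[u1 u2] yy; apply: (HP _ _).1; split => //=.
  by rewrite u1 (le_trans u2).
have := period_flux (k := 2 * pi * n%:~R) x1x cdH.
have nP' u : x1 <= u <= x ->
    Im (H (u +i* (2 * pi))%C) - Im (H (u +i* 0)%C) = 2 * pi * n%:~R.
  by move=> /andP[u1 u2]; apply: nP; rewrite u1 (le_trans u2).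
move=> /(_ nP') flux.
have IE u : x1 <= u <= x2 -> I 0 (2 * pi) (fun y => Re (H (u +i* y)%C)) =
    I 0 (2 * pi) (fun t => ln (normc (Phi (circle a (expR u) t)))) -
    ln (normc g0) * (2 * pi).
  move=> uu; rewrite -[2 * pi in X in _ - X]subr0 -seg_cst// -segB.
  - by apply: eq_seg => y yy; rewrite ReH.
  - move=> y yy; have zr : rectangle x1 x2 (u +i* y)%C by [].
    refine (@continuous_comp R C R (circle a (expR u)) (fun z => ln (normc (Phi z))) y
      (@continuous_circle R a (expR u) y) _).
    apply: continuous_ln_normc; last exact: G0 zr.
    by apply: cdiff_continuous; have [] := dPhi _ (rc _ zr).
  - exact: continuous_seg_cst.
rewrite !IE ?lexx ?x12// in flux.
rewrite /cmean /mean -mulrBr; move: flux.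
set i1 := I _ _ _; set i2 := I _ _ _ => flux.
have -> : i1 - i2 = 2 * pi * n%:~R * (x - x1) by rewrite -flux; ring.
by rewrite -[_ * n%:~R * _]mulrA mulKf// gt_eqF// twopi_gt0.
Qed.

End LogarithmLift.

(** * Submean inequality and maximum principles *)

Section Submean.
Context {R : realType}.
Local Notation C := R[i].
Implicit Types (a c z w : C) (r s t x y e M : R) (f g : C -> C) (W : C -> R).

Lemma polar z : exists2 t, 0 <= t <= 2 * pi & z = (normc z)%:C%C * expi t.
Proof.
have p2 : 0 <= 2 * pi :> R by rewrite ltW// twopi_gt0.
have [->|z0] := eqVneq z 0.
  by exists 0; rewrite ?lexx// normc0 mul0r.
have n0 : 0 < normc z by rewrite normc_gt0.
pose x := Re z / normc z.
have xE : Re z = normc z * x by rewrite /x mulrCA divff ?mulr1// gt_eqF.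
have x1 : -1 <= x <= 1.
  by rewrite -ler_norml /x normrM normfV (ger0_norm (ltW n0)) ler_pdivrMr// mul1r Re_le_normc.
clearbody x.
have sE : Num.sqrt (1 - x ^+ 2) = `|Im z| / normc z.
  rewrite -[RHS]ger0_norm ?divr_ge0// ?normc_ge0// -sqrtr_sqr; congr Num.sqrt.
  apply: (mulfI (_ : normc z ^+ 2 != 0)); first by rewrite expf_neq0// gt_eqF.
  rewrite exprMn real_normK ?num_real// exprVn mulrCA divff ?mulr1; last first.
    by rewrite expf_neq0// gt_eqF.
  by rewrite mulrBr mulr1 -exprMn -xE sqr_normc addrAC subrr add0r.
have xi : x \in `[-1, 1] by rewrite in_itv.
have [i0|i0] := leP 0 (Im z).
  exists (acos x).
    by rewrite acos_ge0// (le_trans (acos_lepi _))// ler_peMl ?pi_ge0// ler1n.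
  apply/eqP; rewrite eq_complex /= !mul0r subr0 addr0 acosK// sin_acos// sE -xE eqxx/=.
  by rewrite ger0_norm// mulrCA divff ?mulr1// gt_eqF.
exists (2 * pi - acos x).
  by rewrite subr_ge0 gerBl acos_ge0// (le_trans (acos_lepi _))// ler_peMl ?pi_ge0// ler1n.
have cE : cos (2 * pi - acos x) = cos (acos x).
  by rewrite -[RHS]cosN -[RHS]cosD2pi; congr cos; rewrite mulr_natl addrC.
have siE : sin (2 * pi - acos x) = - sin (acos x).
  by rewrite -[RHS]sinN -[RHS]sinD2pi; congr sin; rewrite mulr_natl addrC.
apply/eqP; rewrite eq_complex /= !mul0r subr0 addr0 cE siE acosK// sin_acos// sE -xE eqxx/=.
by rewrite ltr0_norm// mulrN mulNr mulrN opprK mulrCA divff ?mulr1// gt_eqF.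
Qed.

Lemma circle_polar a z : exists2 t, 0 <= t <= 2 * pi & z = circle a (normc (z - a)) t.
Proof.
by have [t tt zE] := polar (z - a); exists t => //; rewrite /circle -zE addrC subrK.
Qed.

(** The point of the small circle on the ray from c through z is the farthest from c. *)
Lemma circle_extend c z r : 0 <= r ->
  exists2 t, 0 <= t <= 2 * pi & normc (circle z r t - c) = normc (z - c) + r.
Proof.
move=> r0; have [t tt zE] := polar (z - c); exists t => //.
have -> : circle z r t - c = (normc (z - c) + r)%:C%C * expi t.
  by rewrite /circle addrAC {1}zE rmorphD /= mulrDl.
by rewrite normcM normc_expi mulr1 normc_real ger0_norm// addr_ge0// normc_ge0.
Qed.

Definition submean_at W a :=
  exists2 r0 : R, 0 < r0 & forall r, 0 < r < r0 -> W a <= cmean W a r.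

Lemma circle_max W a r : (forall t, {for circle a r t, continuous W}) ->
  (forall t, W (circle a r t) <= W a) -> W a <= cmean W a r ->
  forall t, 0 <= t <= 2 * pi -> W (circle a r t) = W a.
Proof.
move=> cW le ge t tt; apply/eqP; rewrite eq_sym -subr_eq0; apply/eqP.
have cc : continuous (fun t => W (circle a r t)) by exact: continuous_on_circle.
have ck : continuous (fun _ : R => W a) by move=> s; exact: cvg_cst.
apply: (@mean_ge0_eq0 _ (fun t => W a - W (circle a r t))) => //.
- by move=> s; exact: (@continuousB R R R _ _ s (ck s) (cc s)).
- by move=> s; rewrite subr_ge0.
- by rewrite meanB// mean_cst subr_le0.
Qed.

(** Among the maximum points take one farthest from c. If it were interior, W would be equal to the
    maximum on a small circle around it, which contains a point still farther from c. *)
Lemma max_principle W c r M :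
  (forall z, normc (z - c) <= r -> {for z, continuous W}) ->
  (forall z, normc (z - c) < r -> submean_at W z) ->
  (forall z, normc (z - c) = r -> W z <= M) ->
  forall z, normc (z - c) <= r -> W z <= M.
Proof.
move=> cW sW WM z0 z0r.
pose K := [set z | normc (z - c) <= r].
have cK : compact K by exact: closed_disk_compact.
have cwK (V : C -> R) (A : set C) : (forall z, A z -> {for z, continuous V}) ->
    {within A, continuous V}.
  by move=> cV; apply: continuous_in_subspaceT => z; rewrite inE; exact: cV.
have [z1] := compact_EVT_max (ex_intro _ z0 z0r : K !=set0) cK (cwK _ _ cW).
rewrite inE => Kz1 z1max.
have {z1max} z1max z : K z -> W z <= W z1 by move=> Kz; apply: z1max; rewrite inE.
pose Z := K `&` [set z | W z = W z1].
have clK : closed K by apply: compact_closed => //; exact: norm_hausdorff.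
have cZ : compact Z.
  apply: (subclosed_compact _ cK); last by move=> z [].
  move=> z clz; have Kz : K z.
    by apply: clK => A /clz[w [[Kw _] Aw]]; exists w.
  split => //; apply/eqP; apply/negPn/negP => Wz.
  have e0 : 0 < `|W z - W z1| by rewrite normr_gt0 subr_eq0.
  have [d d0 dP] := (continuous_CRP _ _).1 (cW z Kz) _ e0.
  have : nbhs z [set w | normc (w - z) < d] by apply/nbhs_normcP; exists d.
  move=> /clz[w [[_ /= wE] /= wz]]; have := dP _ wz.
  by rewrite wE distrC ltxx.
have Zz1 : Z z1 by split.
have [z2] := compact_EVT_max (ex_intro _ z1 Zz1) cZ
  (cwK _ _ (fun z _ => @continuous_normcB R c z)).
rewrite inE => -[Kz2 Wz2] z2max; apply: le_trans (z1max _ z0r) _; rewrite -Wz2.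
have [z2r|] := ltP (normc (z2 - c)) r; last first.
  by move=> rz2; apply: WM; apply/le_anti; rewrite rz2 andbT.
have [r0 r00 sz2] := sW _ z2r.
pose s := Num.min (r0 / 2) (r - normc (z2 - c)).
have s0 : 0 < s by rewrite lt_min subr_gt0 z2r divr_gt0.
have sr0 : 0 < s < r0 by rewrite s0 gt_min ltr_pdivrMr// ltr_pMr// ltr1n.
have Kc t : K (circle z2 s t).
  apply: le_trans (normcB_tri z2 _ _) _; rewrite normc_circle gtr0_norm//.
  by rewrite -lerBrDr ge_min lexx orbT.
have [t tt tE] := circle_extend c z2 (ltW s0).
have Wt : W (circle z2 s t) = W z2.
  apply: circle_max => //; first by move=> u; exact: cW (Kc u).
    by move=> u; rewrite Wz2; exact: z1max.
  exact: sz2.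
have Zc : Z (circle z2 s t) by split; [exact: Kc|rewrite /= Wt].
by have := z2max _ (mem_set Zc); rewrite tE gerDl leNgt s0.
Qed.

(** A possibly removable point z: the mean value property needs no more, and the quotient f z / z is
    at first only known to be continuous at 0. *)
Definition holo_near f z := {for z, continuous f} /\
  exists2 d : R, 0 < d & forall w, 0 < normc (w - z) < d -> cdiff f w.

Lemma holo_near_mean f z : holo_near f z ->
  exists2 d : R, 0 < d & forall r, 0 < r < d ->
    cmean (fun z => Re (f z)) z r = Re (f z).
Proof.
move=> [cf [d d0 df]]; exists d => // r /andP[r0 rd].
apply: circle_mean_value => // w /andP[w0 wr]; apply: df.
by rewrite w0 (le_lt_trans wr).
Qed.

Lemma holo_nearZ k f z : holo_near f z -> holo_near (fun w => k * f w) z.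
Proof.
move=> [cf [d d0 df]]; split; first exact: (continuousM_C (@continuous_cst _ _ _) cf).
by exists d => // w /df dw; exact: cdiffZ.
Qed.

Lemma cdiff_holo_near f z (d : R) : 0 < d ->
  (forall w, normc (w - z) < d -> cdiff f w) -> holo_near f z.
Proof.
move=> d0 df; split; last by exists d => // w /andP[_]; exact: df.
by apply: cdiff_continuous; apply: df; rewrite subrr normc0.
Qed.

(** For a given z the factor [k] rotates f z onto the positive axis, and the maximum principle is
    applied to Re (k f). If f z = 0, it only has to be seen that M >= 0. *)
Lemma max_modulus f c r M :
  (forall z, normc (z - c) <= r -> {for z, continuous f}) ->
  (forall z, normc (z - c) < r -> holo_near f z) ->
  (forall z, normc (z - c) = r -> normc (f z) <= M) ->
  forall z, normc (z - c) <= r -> normc (f z) <= M.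
Proof.
move=> cf hf fM z zr.
have [fz|fz] := eqVneq (f z) 0.
  rewrite fz normc0; have r0 : 0 <= r by apply: le_trans zr; exact: normc_ge0.
  apply: le_trans (fM (c + r%:C%C) _); first exact: normc_ge0.
  by rewrite addrC addKr normc_real ger0_norm.
pose k := (normc (f z))%:C%C / f z.
have nk : normc k = 1.
  by rewrite normcM normcV normc_real ger0_norm ?normc_ge0// divff// normc_eq0.
have -> : normc (f z) = Re (k * f z) by rewrite divfK.
have le w : Re (k * f w) <= normc (f w).
  by apply: le_trans (ler_norm _) _; rewrite -[leRHS]mul1r -nk -normcM Re_le_normc.
apply: (@max_principle (fun w => Re (k * f w)) c r M) => //.
- move=> w wr; exact: (continuous_Re_comp (continuousM_C (@continuous_cst _ _ _) (cf w wr))).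
- move=> w wr; have [d d0 dP] := holo_near_mean (holo_nearZ k (hf w wr)).
  by exists d => // s /dP ->.
- by move=> w wr; apply: le_trans (le w) (fM w wr).
Qed.

(** The set where f = 1 is open and closed in X: where f = 1, the real part of f is maximal, hence
    equal to 1 on small circles, and |f| <= 1 then leaves no imaginary part. *)
Lemma strong_max f (X : set C) z1 : connected X -> X z1 ->
  (forall z, X z -> exists2 d : R, 0 < d & forall w, normc (w - z) < d -> X w) ->
  (forall z, X z -> holo_near f z) ->
  (forall z, X z -> normc (f z) <= 1) -> f z1 = 1 ->
  forall z, X z -> f z = 1.
Proof.
move=> cX Xz1 oX hf f1 fz1; pose B := X `&` [set z | f z = 1].
have unit z : X z -> Re (f z) = 1 -> f z = 1.
  move=> /f1 fz re1; have : normc (f z) ^+ 2 <= 1 by rewrite expr_le1// normc_ge0.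
  rewrite sqr_normc re1 expr1n gerDl => im0.
  have /eqP : Im (f z) ^+ 2 = 0 by apply/le_anti; rewrite im0 sqr_ge0.
  rewrite sqrf_eq0 => /eqP im; apply/eqP; rewrite eq_complex re1 im /=.
  by rewrite !eqxx.
suff XB : B = X by move=> z; rewrite -XB => -[].
apply: cX; first by exists z1; split.
- exists B; last by rewrite setIA setIid.
  rewrite openE => z [Xz fz]; have [d1 d10 d1P] := oX z Xz.
  have [d2 d20 d2P] := holo_near_mean (hf z Xz).
  apply/nbhs_normcP; exists (Num.min d1 d2); first by rewrite lt_min d10.
  move=> w; rewrite lt_min => /andP[w1 w2]; have Xw := d1P _ w1.
  split => //; apply: unit => //.
  have [wz|wz] := eqVneq w z; first by rewrite wz fz.
  have n0 : 0 < normc (w - z) by rewrite normc_gt0 subr_eq0.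
  have [t tt wE] := circle_polar z w.
  have Xt u : X (circle z (normc (w - z)) u).
    by apply: d1P; rewrite normc_circle ger0_norm// ltW.
  have : Re (f (circle z (normc (w - z)) t)) = Re (f z).
    apply: (@circle_max (fun z => Re (f z))) => //.
    + move=> u; have [cf _] := hf _ (Xt u); exact: (continuous_Re_comp cf).
    + move=> u; rewrite fz; apply: le_trans (f1 _ (Xt u)).
      by apply: le_trans (ler_norm _) (Re_le_normc _).
    + by rewrite d2P ?n0.
  by rewrite -wE fz.
- exists (closure B); first exact: closed_closure.
  apply/seteqP; split=> z [Xz]; first by move=> fz; split=> //; apply: subset_closure.
  move=> clz; split=> //; apply/eqP; apply/negPn/negP => fz.
  have e0 : 0 < normc (f z - 1) by rewrite normc_gt0 subr_eq0.
  have [cf _] := hf z Xz; have [d d0 dP] := (continuous_CCP _ _).1 cf _ e0.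
  have : nbhs z [set w | normc (w - z) < d] by apply/nbhs_normcP; exists d.
  move=> /clz[w [[_ /= wE] /= wz]]; have := dP _ wz.
  by rewrite wE normcBC ltxx.
Qed.

Lemma common_radius N (P : nat -> R -> Prop) :
  (forall j, (j < N)%N -> exists2 r0 : R, 0 < r0 & forall r, 0 < r < r0 -> P j r) ->
  exists2 r0 : R, 0 < r0 & forall j, (j < N)%N -> forall r, 0 < r < r0 -> P j r.
Proof.
elim: N => [|N IH] H; first by exists 1.
have [|r1 r10 H1] := IH; first by move=> j jN; apply: H; exact: ltnW.
have [r2 r20 H2] := H N (ltnSn N).
exists (Num.min r1 r2) => [|j jN r /andP[r0]]; first by rewrite lt_min r10.
rewrite lt_min => /andP[rr1 rr2]; move: jN; rewrite ltnS leq_eqVlt.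
by case/orP => [/eqP->|jN]; [apply: H2; rewrite r0|apply: H1 => //; rewrite r0].
Qed.

End Submean.

(** * Monotonicity and rigidity of circle means *)

Section SubharmonicMeans.
Context {R : realType}.
Local Notation C := R[i].
Implicit Types (a c z w : C) (r s t x y e M : R) (f g : C -> C) (W : C -> R).

Lemma eq_mean_in (phi psi : R -> R) :
  (forall t, 0 <= t <= 2 * pi -> phi t = psi t) -> mean phi = mean psi.
Proof. by move=> H; congr (_ * _); apply: eq_seg. Qed.

Lemma continuous_swap (Phi : R * R -> R) : continuous Phi ->
  continuous (fun p : R * R => Phi (p.2, p.1)).
Proof.
move=> cP p; have c : {for p, continuous (fun p : R * R => (p.2, p.1))}.
  move=> A [[P Q] [/= Pp Qp] PQA]; exists (Q, P) => //= -[x y] /= [Qx Py].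
  by apply: PQA.
exact: (@continuous_comp _ (R * R)%type R (fun p => (p.2, p.1)) Phi p c (cP _)).
Qed.

Lemma circleD c r s t : circle c r (s + t) - c = expi s * (circle c r t - c).
Proof. by rewrite /circle !(addrC c) !addrK expiD mulrCA. Qed.

Lemma cmean_shift W c r s : 0 <= s <= 2 * pi ->
  (forall t, {for circle c r t, continuous W}) ->
  mean (fun t => W (circle c r (t + s))) = cmean W c r.
Proof.
move=> s2 cW; apply: (@mean_shift _ (fun t => W (circle c r t))) => //.
  exact: continuous_on_circle.
by move=> t; rewrite circle_periodic.
Qed.

(* The averages of W over N rotations about c satisfy the maximum principle and
   converge uniformly on circles to the circle means of W. *)
Lemma cmean_mono W c r0 r1 r2 : 0 <= r1 -> r1 <= r2 -> r2 < r0 ->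
  (forall z, normc (z - c) < r0 -> {for z, continuous W}) ->
  (forall z, normc (z - c) < r0 -> submean_at W z) ->
  cmean W c r1 <= cmean W c r2.
Proof.
move=> r10 r12 r20 cW sW; have r2p := le_trans r10 r12.
have p2 : 0 < 2 * pi :> R := twopi_gt0.
have in0 r t : 0 <= r <= r2 -> normc (circle c r t - c) < r0.
  by move=> /andP[rp rr]; rewrite normc_circle ger0_norm// (le_lt_trans rr).
have cc r : 0 <= r <= r2 -> forall t, {for circle c r t, continuous W}.
  by move=> rr t; apply: cW; exact: in0.
have r1r : 0 <= r1 <= r2 by rewrite r10.
have r2r : 0 <= r2 <= r2 by rewrite r2p lexx.
have c1 := continuous_on_circle (cc _ r1r).
have c2 := continuous_on_circle (cc _ r2r).
apply/ler_addgt0Pl => e e0; have e2 : 0 < e / 2 by rewrite divr_gt0.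
(* Angles x + t with x and t in a period occur below, so uniform continuity is taken on twice the
   period. *)
have [N1 N10 HN1] := continuous_seg_uniform (@continuous_seg_of R _ 0 (2 * (2 * pi)) c1) e2.
have [N2 N20 HN2] := continuous_seg_uniform (@continuous_seg_of R _ 0 (2 * (2 * pi)) c2) e2.
pose N := maxn N1 N2.
have N0 : (0 < N)%N by rewrite leq_max N10.
have NR : 0 < N%:R :> R by rewrite ltr0n.
pose h : R := 2 * pi / N%:R; have h0 : 0 <= h by rewrite divr_ge0 ?ltW.
have hj j : (j < N)%N -> 0 <= h * j%:R <= 2 * pi.
  move=> jN; rewrite mulr_ge0//= /h mulrAC ler_pdivrMr// ler_pM2l//.
  by rewrite ler_nat ltnW.
have fine (phi : R -> R) (M : nat) :
  (forall N, (M <= N)%N -> forall x y, 0 <= x <= 2 * (2 * pi) ->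
     0 <= y <= 2 * (2 * pi) -> `|y - x| <= (2 * (2 * pi) - 0) / N%:R ->
     `|phi y - phi x| <= e / 2) -> (M <= N)%N ->
  forall x y, 0 <= x <= 2 * (2 * pi) -> 0 <= y <= 2 * (2 * pi) ->
     `|y - x| <= 2 * pi / N%:R -> `|phi y - phi x| <= e / 2.
  move=> H MN x y xx yy xy; apply: (H N) => //; apply: le_trans xy _.
  by rewrite subr0 ler_pM2r ?invr_gt0// ler_peMl ?ler1n// ltW.
have {}HN1 := fine _ _ HN1 (leq_maxl _ _).
have {}HN2 := fine _ _ HN2 (leq_maxr _ _).
have wide x : 0 <= x <= 2 * pi -> 0 <= x <= 2 * (2 * pi).
  move=> /andP[-> xx]; apply: le_trans xx _; by rewrite ler_peMl ?ler1n// ltW.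
pose u j z : C := c + expi (h * j%:R) * (z - c).
have uc j z : u j z - c = expi (h * j%:R) * (z - c) by rewrite /u addrC addKr.
have nu j z : normc (u j z - c) = normc (z - c).
  by rewrite uc normcM normc_expi mul1r.
have uD j z w : u j (z + w) = u j z + expi (h * j%:R) * w.
  by rewrite /u; ring.
pose v z := N%:R^-1 * \sum_(j < N) W (u j z).
have cu j z : {for z, continuous (u j)}.
  refine (continuousD_C (@continuous_cst _ _ _) (continuousM_C (@continuous_cst _ _ _) _)).
  exact: continuous_subr.
have cWu j z : normc (z - c) < r0 -> {for z, continuous (fun z => W (u j z))}.
  move=> zr; refine (@continuous_comp C C R (u j) W z (@cu j z) (cW _ _)).
  by rewrite nu.
have csum k z : normc (z - c) < r0 ->
    {for z, continuous (fun z => \sum_(j < k) W (u j z))}.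
  move=> zr; elim: k => [|k IH].
    have -> : (fun z => \sum_(j < 0) W (u j z)) = (fun=> 0).
      by apply/funext => w; rewrite big_ord0.
    exact: (@cst_continuous C R 0 z).
  have -> : (fun z => \sum_(j < k.+1) W (u j z)) =
            (fun z => \sum_(j < k) W (u j z) + W (u k z)).
    by apply/funext => w; rewrite big_ord_recr.
  exact: (@continuousD R R C _ _ z IH (cWu k z zr)).
have cv z : normc (z - c) < r0 -> {for z, continuous v}.
  move=> zr; exact: (@continuousM R C (fun=> N%:R^-1) _ z (@cst_continuous C R _ z) (csum N z zr)).
have sv z : normc (z - c) < r0 -> submean_at v z.
  move=> zr; have [|d d0 dP] := @common_radius R N (fun j r => W (u j z) <= cmean W (u j z) r).
    by move=> j jN; apply: sW; rewrite nu.
  exists (Num.min d (r0 - normc (z - c))); first by rewrite lt_min d0 subr_gt0.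
  move=> r /andP[rp]; rewrite lt_min => /andP[rd rr].
  have inr t : normc (circle z r t - c) < r0.
    apply: le_lt_trans (normcB_tri z _ _) _; rewrite normc_circle gtr0_norm//.
    by rewrite -ltrBrDr.
  have cWc j : continuous (fun t => W (u j (circle z r t))).
    by apply: (@continuous_on_circle _ (fun z => W (u j z))) => t; exact: cWu.
  have -> : cmean v z r = N%:R^-1 * \sum_(j < N) mean (fun t => W (u j (circle z r t))).
    rewrite /cmean /v meanZ; last first.
      exact: (@continuous_sum_R _ N (fun j t => W (u j (circle z r t)))).
    by rewrite (@mean_sum _ N (fun j t => W (u j (circle z r t)))).
  rewrite ler_pM2l ?invr_gt0//; apply: ler_sum => j _.
  have -> : mean (fun t => W (u j (circle z r t))) = cmean W (u j z) r.
    rewrite -(@cmean_shift W (u j z) r (h * j%:R)) ?hj//; last first.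
      move=> t; apply: cW; apply: le_lt_trans (normcB_tri (u j z) _ _) _.
      by rewrite normc_circle gtr0_norm// nu -ltrBrDr.
    by apply: eq_mean => t; congr W; rewrite /circle uD expiD mulrCA [expi t * _]mulrC.
  by apply: dP => //; rewrite rp.
(* On the circle of radius r2 the average v w is a Riemann sum of W starting at the angle of w,
   hence within e / 2 of the mean; the maximum principle carries the bound inside. *)
have vmax z : normc (z - c) <= r2 -> v z <= e / 2 + cmean W c r2.
  apply: max_principle => [w wr|w wr|w wr].
  - by apply: cv; exact: le_lt_trans r20.
  - by apply: sv; exact: lt_trans r20.
  have [t tt wE] := circle_polar c w; rewrite wr in wE.
  have cs : continuous (fun x => W (circle c r2 (x + t))).
    move=> x; refine (@continuous_comp R R R (+%R^~ t) (fun t => W (circle c r2 t)) x _ (c2 _)).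
    exact: (@continuousD R R R id (fun=> t) x cvg_id (cvg_cst _)).
  have := @mean_riemann R _ N (e / 2) N0 cs.
  rewrite (cmean_shift tt (cc _ r2r)) => /(_ _).
  have H x y : 0 <= x <= 2 * pi -> 0 <= y <= 2 * pi -> `|y - x| <= 2 * pi / N%:R ->
      `|W (circle c r2 (y + t)) - W (circle c r2 (x + t))| <= e / 2.
    move=> /andP[x0 x2] /andP[y0 y2] xy; have [t0 t2] := andP tt.
    apply: HN2; rewrite ?addr_ge0//=; last by rewrite opprD addrACA subrr addr0.
    - by rewrite mulr_natl [leRHS]mulr2n lerD.
    - by rewrite mulr_natl [leRHS]mulr2n lerD.
  move=> /(_ H); rewrite distrC ler_distl => /andP[_ +]; rewrite [_ + e / 2]addrC.
  apply: le_trans; rewrite le_eqVlt; apply/orP; left; apply/eqP; congr (_ * _).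
  apply: eq_bigr => j _; congr W.
  by rewrite -[LHS](subrK c) uc wE -circleD subrK.
have := @mean_riemann R _ N (e / 2) N0 c1 _.
move=> /(_ (fun x y xx yy => HN1 x y (wide _ xx) (wide _ yy))).
rewrite -/(cmean W c r1) ler_distl => /andP[_ +].
have -> : N%:R^-1 * \sum_(j < N) W (circle c r1 (2 * pi / N%:R * j%:R)) = v (circle c r1 0).
  congr (_ * _); apply: eq_bigr => j _; congr W.
  by rewrite -[RHS](subrK c) uc -circleD subrK addr0.
move=> h1; have := vmax (circle c r1 0); rewrite normc_circle ger0_norm// => /(_ r12).
by rewrite [e in e + _]splitr; move: h1; clear; lra.
Qed.

Lemma cmean0 W c : cmean W c 0 = W c.
Proof.
rewrite /cmean -[RHS]mean_cst; apply: eq_mean => t.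
by rewrite /circle mul0r addr0.
Qed.

Lemma submean_le W c r0 r : 0 <= r < r0 ->
  (forall z, normc (z - c) < r0 -> {for z, continuous W}) ->
  (forall z, normc (z - c) < r0 -> submean_at W z) ->
  W c <= cmean W c r.
Proof.
by move=> /andP[r1 r2] cW sW; rewrite -(cmean0 W c); exact: (cmean_mono _ r1 r2 cW sW).
Qed.

Lemma continuous_cmean W r0 : 0 <= r0 ->
  (forall z, normc z <= r0 -> {for z, continuous W}) ->
  exists2 A : R -> R, continuous A & forall r, 0 <= r <= r0 -> A r = cmean W 0 r.
Proof.
(* k clamps the radius to [0, r0], which makes A continuous on the whole line. *)
move=> r00 cW; pose k (x : R) := Num.min (Num.max x 0) r0.
have ck : continuous k.
  move=> x; apply: (@continuous_min R R (fun x => Num.max x 0) (fun=> r0) x); last exact: cvg_cst.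
  by apply: (@continuous_max R R id (fun=> 0) x); [exact: cvg_id|exact: cvg_cst].
have k01 x : 0 <= k x <= r0 by rewrite le_min le_max lexx orbT r00 ge_min lexx orbT.
exists (fun x => mean (fun t => W (circle 0 (k x) t))).
  apply: (@continuous_mean R (fun p => W (circle 0 (k p.1) p.2))) => p.
  have c1 : {for p, continuous (fun p : R * R => circle 0 (k p.1) p.2 : C)}.
    refine (@continuous_comp (R * R)%type (R * R)%type C (fun p => (k p.1, p.2))
      (fun p => circle 0 p.1 p.2) p _ (@continuous_circle2 R 0 _)).
    have c2 : {for p, continuous (fun p : R * R => k p.1)}.
      exact: (@continuous_comp (R * R)%type R R fst k p cvg_fst (ck _)).
    move=> B [[P Q] [/= Pp Qp] PQB].
    have c3 : {for p, continuous (@snd R R)} by exact: cvg_snd.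
    have Pp' : nbhs p ((fun p : R * R => k p.1) @^-1` P) by exact: (c2 _ Pp).
    have Qp' : nbhs p ((@snd R R) @^-1` Q) by exact: (c3 _ Qp).
    refine (@filterS _ (nbhs p) _ _ _ _ (filterI Pp' Qp')) => q [Pq Qq].
    exact: PQB.
  refine (@continuous_comp (R * R)%type C R _ W p c1 (cW _ _)).
  rewrite -[circle _ _ _]subr0 normc_circle; have /andP[k0 k1] := k01 p.1.
  by rewrite ger0_norm.
move=> r /andP[rp rr]; rewrite /cmean /k max_l// min_l//.
Qed.

(* Averaging the mean over small circles along the circle of radius r gives a
   weighted average of the circle means around 0. *)
Lemma submean_rigid W r d r0 : 0 <= r -> 0 <= d -> r + d < r0 ->
  (forall z, normc z < r0 -> {for z, continuous W}) ->
  (forall z, normc z < r0 -> submean_at W z) ->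
  (forall x, 0 <= x <= r + d -> cmean W 0 x <= cmean W 0 r) ->
  forall s, 0 <= s <= 2 * pi -> cmean W (circle 0 r s) d = W (circle 0 r s).
Proof.
move=> rp dp rd cW sW le s s2.
have nc x t : normc (circle 0 x t : C) = `|x| by rewrite -[circle _ _ _]subr0 normc_circle.
have nin x t : normc (circle (circle 0 r x) d t) <= r + d.
  rewrite -[circle (circle _ _ _) _ _](subrK (circle 0 r x)) addrC.
  by apply: le_trans (normcD _ _) _; rewrite nc normc_circle !ger0_norm.
have cPhi : continuous (fun p : R * R => W (circle (circle 0 r p.1) d p.2)).
  move=> p; refine (@continuous_comp (R * R)%type C R
    (fun p => circle (circle 0 r p.1) d p.2) W p _ (cW _ (le_lt_trans (nin _ _) rd))).
  refine (@continuousD C C _ (fun p : R * R => circle 0 r p.1)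
    (fun p => d%:C%C * expi p.2) p _ _).
    exact: (@continuous_comp (R * R)%type R C fst (circle 0 r) p cvg_fst
      (@continuous_circle R 0 r p.1)).
  refine (@continuousM C _ (fun _ : R * R => d%:C%C) (fun p => expi p.2) p (cvg_cst _) _).
  exact: (@continuous_comp _ R C snd expi p cvg_snd (@continuous_expi R p.2)).
(* With the angle on the small circle written x + t, its points are the rotations by x of r + d
   exp(i t). After the exchange of means the inner one is over a circle about 0 of radius at most r
   + d. *)
have cPsi : continuous (fun p : R * R => W (expi p.1 * (r%:C%C + d%:C%C * expi p.2))).
  move=> p; have E : expi p.1 * (r%:C%C + d%:C%C * expi p.2) =
      circle (circle 0 r p.1) d (p.1 + p.2).
    by rewrite /circle add0r mulrDr expiD; ring.
  refine (@continuous_comp (R * R)%type C R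
    (fun p => expi p.1 * (r%:C%C + d%:C%C * expi p.2)) W p _ (cW _ _)); last first.
    by rewrite E; exact: le_lt_trans (nin _ _) rd.
  refine (@continuousM C _ (fun p : R * R => expi p.1) _ p _ _).
    exact: (@continuous_comp _ R C fst expi p cvg_fst (@continuous_expi R p.1)).
  refine (@continuousD C C _ (fun _ : R * R => r%:C%C) _ p (cvg_cst _) _).
  refine (@continuousM C _ (fun _ : R * R => d%:C%C) (fun p => expi p.2) p (cvg_cst _) _).
  exact: (@continuous_comp _ R C snd expi p cvg_snd (@continuous_expi R p.2)).
have avg : mean (fun x => cmean W (circle 0 r x) d) <= cmean W 0 r.
  have -> : mean (fun x => cmean W (circle 0 r x) d) =
      mean (fun x => mean (fun t => W (expi x * (r%:C%C + d%:C%C * expi t)))).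
    apply: eq_mean_in => x x2; rewrite -(cmean_shift x2); last first.
      by move=> t; apply: cW; exact: le_lt_trans (nin _ _) rd.
    by apply: eq_mean => t; congr W; rewrite /circle add0r expiD; ring.
  rewrite (mean_exchange cPsi) -[leRHS]mean_cst; apply: mean_le => [||t tt].
  - have cS := @continuous_swap (fun p => W (expi p.1 * (r%:C%C + d%:C%C * expi p.2))) cPsi.
    exact: (@continuous_mean R _ cS).
  - by move=> x; exact: cvg_cst.
  set q := r%:C%C + d%:C%C * expi t.
  have qr : normc q <= r + d.
    apply: le_trans (normcD _ _) _; rewrite normcM normc_expi !normc_real mulr1.
    by rewrite !ger0_norm.
  have [y y2 qE] := polar q.
  have -> : mean (fun x => W (expi x * q)) = cmean W 0 (normc q).
    rewrite -(cmean_shift y2); last first.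
      move=> x; apply: cW; rewrite nc ger0_norm ?normc_ge0//; exact: le_lt_trans qr rd.
    by apply: eq_mean => x; congr W; rewrite /circle add0r {1}qE expiD; ring.
  by apply: le; rewrite normc_ge0.
have c1 : continuous (fun x => cmean W (circle 0 r x) d) by exact: (continuous_mean cPhi).
have c2 : continuous (fun x => W (circle 0 r x)).
  apply: continuous_on_circle => t; apply: cW; rewrite nc ger0_norm//.
  by apply: le_lt_trans rd; rewrite lerDl.
apply/eqP; rewrite -subr_eq0; apply/eqP.
(* The difference is nonnegative by the submean inequality and its average is at most 0 by [avg]. *)
apply: (@mean_ge0_eq0 _ (fun x => cmean W (circle 0 r x) d - W (circle 0 r x))) => //.
- by move=> x; exact: (@continuousB R R R _ _ x (c1 x) (c2 x)).
- move=> x; rewrite subr_ge0; apply: (@submean_le _ _ (r0 - r)).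
  + by rewrite dp/= ltrBrDl.
  + move=> z zx; apply: cW; rewrite -[z](subrK (circle 0 r x)).
    by apply: le_lt_trans (normcD _ _) _; rewrite nc ger0_norm// -ltrBrDr.
  + move=> z zx; apply: sW; rewrite -[z](subrK (circle 0 r x)).
    by apply: le_lt_trans (normcD _ _) _; rewrite nc ger0_norm// -ltrBrDr.
- by rewrite meanB// subr_le0.
Qed.

End SubharmonicMeans.

(** * Injective holomorphic functions: openness, inverse, nonzero derivative *)

Section InjectiveHolomorphic.
Context {R : realType}.
Local Notation C := R[i].
Implicit Types (a c z w : C) (r s t x y e M : R) (f g q : C -> C) (Omega : set C).

Lemma approx_is_derive (f : R -> R) (x k : R) :
  (forall e, 0 < e -> exists2 d, 0 < d & forall h, `|h| < d ->
     `|f (x + h) - f x - k * h| <= e * `|h|) -> is_derive x (1 : R) f k.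
Proof.
move=> H.
have lim : (fun h => h^-1 *: ((f \o shift x) (h *: 1) - f x)) @ 0^' --> k.
  apply/cvgrPdistC_lt => e e0; have e2 : 0 < e / 2 by rewrite divr_gt0.
  have [d d0 dP] := H _ e2; apply/nbhs_ballP; exists d => // h.
  rewrite /ball /= sub0r normrN => hd h0; have := dP _ hd.
  rewrite [h *: 1]mulr1 [_ *: _]mulrC [h + x]addrC => le.
  have -> : (f (x + h) - f x) / h - k = (f (x + h) - f x - k * h) / h.
    by rewrite [RHS]mulrBl mulfK.
  rewrite normrM normfV ltr_pdivrMr ?normr_gt0//; apply: le_lt_trans le _.
  by rewrite ltr_pM2r ?normr_gt0// ltr_pdivrMr// ltr_pMr// ltr1n.
have df : derivable f x 1 by apply/cvg_ex; exists k.
by split => //; exact: cvg_lim lim.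
Qed.

Lemma circle_min f z r : (forall t, {for circle z r t, continuous f}) ->
  (forall t, f (circle z r t) != 0) ->
  exists2 m : R, 0 < m & forall t, m <= normc (f (circle z r t)).
Proof.
move=> cf f0; have p2 : 0 <= 2 * pi :> R by rewrite ltW// twopi_gt0.
have cn : continuous (fun t => normc (f (circle z r t))).
  move=> t; apply: (@continuous_on_circle R (fun w => normc (f w))) => u.
  exact: (continuous_normcE (cf u)).
have [c _ cmin] := EVT_min p2 (continuous_subspaceT cn (A := `[0, 2 * pi])).
exists (normc (f (circle z r c))); first by rewrite normc_gt0.
move=> t; have [u uu ->] : exists2 u, 0 <= u <= 2 * pi & circle z r t = circle z r u.
  have [r0|r0] := leP 0 r.
    have [u uu E] := circle_polar z (circle z r t).
    by exists u => //; rewrite [LHS]E normc_circle ger0_norm.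
  have [u uu E] := polar (expi t : C).
  by exists u => //; rewrite /circle E normc_expi mul1r.
by apply: cmin; rewrite in_itv.
Qed.

(** If f omitted a value w within m / 2 of f z0, with m the minimum of |f - f z0| on the circle,
    then 1 / (f - w) would be bounded by 2 / m on the circle and exceed it at z0. *)
Lemma open_map f z0 r : 0 < r ->
  (forall z, normc (z - z0) <= r -> cdiff f z) ->
  (forall z w, normc (z - z0) <= r -> normc (w - z0) <= r -> f z = f w -> z = w) ->
  exists2 e : R, 0 < e & forall w, normc (w - f z0) < e ->
    exists2 z, normc (z - z0) <= r & f z = w.
Proof.
move=> r0 df inj.
have z0r : normc (z0 - z0) <= r by rewrite subrr normc0 ltW.
have cr t : normc (circle z0 r t - z0) <= r by rewrite normc_circle gtr0_norm.
have [t|t|m m0 mP] := @circle_min (fun z => f z - f z0) z0 r.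
- have d := cdiffB (df _ (cr t)) (cdiff_cst (f z0) _).
  exact: (cdiff_continuous d).
- rewrite subr_eq0; apply/eqP => /inj E.
  have := normc_circle z0 r t; rewrite E// subrr normc0 gtr0_norm// => rE.
  by rewrite -rE ltxx in r0.
exists (m / 2) => [|w wm]; first by rewrite divr_gt0.
have [//|no] := pselect (exists2 z, normc (z - z0) <= r & f z = w).
have fw z : normc (z - z0) <= r -> f z - w != 0.
  by move=> zr; rewrite subr_eq0; apply/eqP => fz; apply: no; exists z.
have dQ z : normc (z - z0) <= r -> cdiff (fun z => (f z - w)^-1) z.
  move=> zr; apply: (@cdiffV _ (fun z => f z - w)); last exact: fw.
  by apply: cdiffB; [exact: df|exact: cdiff_cst].
have : normc ((f z0 - w)^-1) <= (m / 2)^-1.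
  apply: (@max_modulus _ (fun z => (f z - w)^-1) z0 r) => //.
  - by move=> z zr; exact: (cdiff_continuous (dQ _ zr)).
  - move=> z zr; apply: (@cdiff_holo_near _ _ _ (r - normc (z - z0))).
      by rewrite subr_gt0.
    move=> u ur; apply: dQ; apply: le_trans (normcB_tri z _ _) _.
    by rewrite -lerBrDr ltW.
  - move=> z zr; have [t _ zE] := circle_polar z0 z; rewrite zr in zE.
    rewrite normcV lef_pV2 ?posrE ?divr_gt0 ?normc_gt0 ?fw ?zr//.
    have := mP t; rewrite -zE => mz.
    have -> : f z - w = (f z - f z0) - (w - f z0) by rewrite opprB addrA subrK.
    apply: le_trans (normcB_ge _ _); rewrite lerBrDl.
    apply: le_trans mz; rewrite [leRHS]splitr lerD2r ltW//.
rewrite normcV lef_pV2 ?posrE ?divr_gt0 ?normc_gt0 ?fw//.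
by rewrite normcBC leNgt wm.
Qed.

Lemma open_disk Omega z : open Omega -> Omega z ->
  exists2 d : R, 0 < d & forall w, normc (w - z) <= d -> Omega w.
Proof.
move=> oO Oz; have : nbhs z Omega by exact: open_nbhs_nbhs.
move=> /nbhs_normcP[d d0 dP]; exists (d / 2); first by rewrite divr_gt0.
move=> w wd; apply: dP; apply: le_lt_trans wd _.
by rewrite ltr_pdivrMr// ltr_pMr// ltr1n.
Qed.

(** The set is the image of a closed disk under the inverse of f, which [open_map] shows to be
    continuous. *)
Lemma sublevel_compact Omega f s s' : open Omega ->
  (forall z, Omega z -> cdiff f z) -> injective_on Omega f ->
  (forall w, normc w < s -> exists2 z, Omega z & f z = w) -> s' < s ->
  compact [set z | Omega z /\ normc (f z) <= s'].
Proof.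
move=> oO df inj sur ss.
pose g w := xget 0 [set z | Omega z /\ f z = w].
have gP w : normc w < s -> Omega (g w) /\ f (g w) = w.
  move=> ws; rewrite /g; case: xgetP => [z _ //|].
  by have [z Oz fz] := sur _ ws; move=> /(_ z); case; split.
have cg w : normc w < s -> {for w, continuous g}.
  move=> ws; have [Og fg] := gP _ ws; apply/continuous_CCP => e e0.
  have [d d0 dO] := open_disk oO Og.
  pose r := Num.min d (e / 2).
  have r0 : 0 < r by rewrite lt_min d0 divr_gt0.
  have rO z : normc (z - g w) <= r -> Omega z.
    by move=> zr; apply: dO; apply: le_trans zr _; rewrite ge_min lexx.
  have [z zr|z u zr ur|k k0 kP] := @open_map f (g w) r r0.
  - by apply: df; exact: rO.
  - by apply: inj; exact: rO.
  exists (Num.min k (s - normc w)) => [|u]; first by rewrite lt_min k0 subr_gt0.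
  rewrite lt_min => /andP[uk us]; rewrite fg in kP.
  have [z zr fz] := kP _ uk.
  have us' : normc u < s.
    rewrite -[u](subrK w); apply: le_lt_trans (normcD _ _) _.
    by rewrite -ltrBrDr.
  have [Ogu fgu] := gP _ us'.
  have -> : g u = z by apply: inj => //; [exact: rO|rewrite fgu].
  apply: le_lt_trans zr _; rewrite gt_min; apply/orP; right.
  by rewrite ltr_pdivrMr// ltr_pMr// ltr1n.
have -> : [set z | Omega z /\ normc (f z) <= s'] =
    g @` [set w | normc (w - 0) <= s'].
  apply/seteqP; split=> [z [Oz fz]|_ [w /= ws <-]].
    exists (f z); first by rewrite /= subr0.
    have [Og fg] := gP _ (le_lt_trans fz ss); exact: inj.
  rewrite subr0 in ws; have [Og fg] := gP _ (le_lt_trans ws ss).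
  by split=> //; rewrite fg.
apply: continuous_compact; last exact: closed_disk_compact.
apply: continuous_in_subspaceT => w; rewrite inE /= subr0 => ws.
exact: (cg _ (le_lt_trans ws ss)).
Qed.

Lemma zero_derivative_const f r :
  (forall a, normc a < r -> exists q, [/\ {for a, continuous q},
     forall w, f w = f a + q w * (w - a) & q a = 0]) ->
  forall z, normc z < r -> f z = f 0.
Proof.
move=> H z zr.
have K (p : C -> R) : (forall u v, p (u - v) = p u - p v) ->
    (forall u, `|p u| <= normc u) -> p (f z) = p (f 0).
  move=> pB pn; pose phi t := p (f ((sin t)%:C%C * z)).
  have D t : is_derive t (1 : R) phi 0.
    apply: approx_is_derive => e e0.
    have tz : normc ((sin t)%:C%C * z) < r.
      apply: le_lt_trans zr; rewrite normcM normc_real ler_piMl ?normc_ge0//.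
      by rewrite ler_norml sin_geN1 sin_le1.
    have [q [cq fq qa]] := H _ tz.
    pose k := 2 * (normc z + 1); have k0 : 0 < k by rewrite mulr_gt0// ltr_wpDl// normc_ge0.
    have [d1 d10 d1P] := (continuous_CCP _ _).1 cq _ (divr_gt0 e0 k0).
    have [d2 d20 d2P] := is_derive_approx (is_derive_sin t) ltr01.
    exists (Num.min d2 (d1 / k)) => [|h]; first by rewrite lt_min d20 divr_gt0.
    rewrite lt_min ltr_pdivlMr// => /andP[h1 h2].
    have sh : `|sin (t + h) - sin t| <= 2 * `|h|.
      have := d2P _ h1; rewrite mul1r => le.
      rewrite -[sin (t + h) - sin t](subrK (cos t * h)); apply: le_trans (ler_normD _ _) _.
      rewrite mulr_natl mulr2n; apply: lerD => //.
      by rewrite normrM ler_piMl// ler_norml cos_geN1 cos_le1.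
    set w' := (sin (t + h))%:C%C * z; set w := (sin t)%:C%C * z.
    have ww : normc (w' - w) <= k * `|h|.
      rewrite /w' /w -mulrBl -rmorphB normcM normc_real /k mulrAC.
      by apply: ler_pM; rewrite ?normc_ge0 ?lerDl.
    have qw : normc (q w') <= e / k.
      have := d1P w' (le_lt_trans ww _); rewrite qa subr0 mulrC => /(_ h2).
      exact: ltW.
    rewrite mul0r subr0 /phi -pB; apply: le_trans (pn _) _.
    rewrite -/w' -/w fq addrAC subrr add0r normcM.
    apply: le_trans (ler_pM _ _ qw ww) _; rewrite ?normc_ge0//.
    by rewrite mulrA divfK// gt_eqF.
  have := @is_derive_0_is_cst R phi (pi / 2) 0 D.
  by rewrite /phi sin_pihalf sin0 mul1r mul0r.
apply/eqP; rewrite eq_complex; apply/andP; split; apply/eqP.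
  apply: K; [exact: ReB|exact: Re_le_normc].
apply: K; [exact: ImB|exact: Im_le_normc].
Qed.

(* If a is close to 0 and f'(a) <> 0, the difference quotient of f at a has no
   zero, so the maximum principle for its inverse bounds |f a / a| below; and
   f' cannot vanish identically near 0. *)
Lemma injective_derivative_neq0 f (F : C -> C) r : 0 < r -> f 0 = 0 ->
  (forall z, normc z <= r -> cdiff f z) ->
  (forall z w, normc z <= r -> normc w <= r -> f z = f w -> z = w) ->
  {for 0, continuous F} -> (forall z, f z = F z * z) -> F 0 != 0.
Proof.
move=> r0 f0 df inj cF fF; apply/eqP => F0.
have n0r : normc (0 : C) <= r by rewrite normc0 ltW.
have nc t : normc (circle 0 r t : C) = r.
  by rewrite -[circle _ _ _]subr0 normc_circle gtr0_norm.
have [t|t|m m0 mP] := @circle_min f 0 r.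
- by apply: cdiff_continuous; apply: df; rewrite nc.
- apply/eqP => fc; have E : circle 0 r t = 0 :> C by apply: inj; rewrite ?nc ?fc ?f0.
  by have := nc t; rewrite E normc0 => rE; rewrite -rE ltxx in r0.
have m2 : 0 < m / 2 by rewrite divr_gt0.
(* On |w| = r the difference quotient of f at a has modulus at least this number, as |f w| >= m, |f
   a| < m / 2 and |w - a| <= 2 r. *)
have k0 : 0 < m / 2 / (2 * r) by rewrite !divr_gt0// mulr_gt0.
have [d1 d10 d1P] := (continuous_CCP _ _).1 (cdiff_continuous (df _ n0r)) _ m2.
have [d2 d20 d2P] := (continuous_CCP _ _).1 cF _ k0.
pose d := Num.min (Num.min d1 d2) r.
have d0 : 0 < d by rewrite !lt_min d10 d20.
have H a : normc a < d -> exists q, [/\ {for a, continuous q},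
     forall w, f w = f a + q w * (w - a) & q a = 0].
  rewrite !lt_min => /andP[/andP[ad1 ad2] ar].
  have [aE|a0] := eqVneq a 0.
    by rewrite aE; exists F; split => // w; rewrite f0 add0r subr0.
  have [q cq fq] := df _ (ltW ar); exists q; split => //; apply/eqP/negPn/negP => qa.
  have qE w : w != a -> q w = (f w - f a) / (w - a).
    by move=> wa; rewrite [f w]fq addrAC subrr add0r mulfK// subr_eq0.
  have q0 w : normc w <= r -> q w != 0.
    move=> wr; have [->//|wa] := eqVneq w a.
    rewrite qE// mulf_neq0// ?invr_eq0 subr_eq0//; apply: contra_neq wa => fwa.
    by apply: inj => //; exact: ltW.
  have dq w : normc w <= r -> w != a -> cdiff q w.
    move=> wr wa; apply: (@cdiff_near_eq _ (fun w => (f w - f a) / (w - a))).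
      apply: cdiff_div; last by rewrite subr_eq0.
        by apply: cdiffB; [exact: df|exact: cdiff_cst].
      by apply: cdiffB; [exact: cdiff_id|exact: cdiff_cst].
    apply/nbhs_normcP; exists (normc (w - a)); first by rewrite normc_gt0 subr_eq0.
    move=> u uw; rewrite qE//; apply: contraTneq uw => ->.
    by rewrite normcBC ltxx.
  have cQ w : normc w <= r -> {for w, continuous (fun w => (q w)^-1)}.
    move=> wr; refine (continuousV_C (q0 _ wr) _).
    by have [->//|wa] := eqVneq w a; exact: (cdiff_continuous (dq _ wr wa)).
  have : normc ((q 0)^-1) <= (m / 2 / (2 * r))^-1.
    apply: (@max_modulus _ (fun w => (q w)^-1) 0 r).
    - by move=> w; rewrite subr0; exact: cQ.
    - move=> w; rewrite subr0 => wr; split; first exact: (cQ _ (ltW wr)).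
      have [wa|wa] := eqVneq w a.
        exists (r - normc w) => [|u /andP[u0 ur]]; first by rewrite subr_gt0.
        have ur' : normc u <= r.
          rewrite -[u](subrK w); apply: le_trans (normcD _ _) _.
          by rewrite -lerBrDr ltW.
        apply: cdiffV (q0 _ ur'); apply: dq => //.
        by apply: contraTneq u0 => ->; rewrite wa subrr normc0 ltxx.
      exists (Num.min (r - normc w) (normc (w - a))) => [|u /andP[u0]].
        by rewrite lt_min subr_gt0 wr normc_gt0 subr_eq0.
      rewrite lt_min => /andP[ur ua].
      have ur' : normc u <= r.
        rewrite -[u](subrK w); apply: le_trans (normcD _ _) _.
        by rewrite -lerBrDr ltW.
      apply: cdiffV (q0 _ ur'); apply: dq => //.
      by apply: contraTneq ua => ->; rewrite normcBC ltxx.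
    - move=> w; rewrite subr0 => wr; rewrite normcV lef_pV2 ?posrE ?normc_gt0 ?q0 ?wr//.
      have wa : w != a by apply: contraTneq ar => <-; rewrite wr ltxx.
      rewrite qE// normcM normcV; apply: ler_pM; rewrite ?invr_ge0 ?(ltW m2)//.
      + by rewrite mulr_ge0// ltW.
      + apply: (le_trans _ (normcB_ge _ _)); rewrite lerBrDl.
        have [t _ wE] := circle_polar 0 w; rewrite subr0 wr in wE.
        rewrite wE; apply: (le_trans _ (mP t)); rewrite [leRHS]splitr lerD2r ltW//.
        by have := d1P a; rewrite subr0 f0 subr0; apply.
      + rewrite lef_pV2 ?posrE ?mulr_gt0 ?normc_gt0 ?subr_eq0//.
        apply: le_trans (normcD _ _) _; rewrite normcN wr mulr_natl mulr2n.
        by rewrite lerD2l ltW.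
    by rewrite subrr normc0 ltW.
  rewrite normcV lef_pV2 ?posrE ?normc_gt0 ?q0//.
  have -> : q 0 = F a.
    by rewrite qE 1?eq_sym// f0 !sub0r fF invrN mulrNN mulfK.
  by have := d2P a; rewrite subr0 F0 subr0 => /(_ ad2); rewrite leNgt => ->.
have d2' : 0 < d / 2 by rewrite divr_gt0.
have := zero_derivative_const H (z := (d / 2)%:C%C).
have dd : normc (d / 2)%:C%C < d.
  by rewrite normc_real gtr0_norm// ltr_pdivrMr// ltr_pMr// ltr1n.
move=> /(_ dd) /inj; rewrite n0r => /(_ _ isT) E.
have : (d / 2)%:C%C = 0 :> C by apply: E; rewrite (le_trans (ltW dd))// /d ge_min lexx orbT.
by move=> /(congr1 (@normc R)); rewrite normc0 normc_real gtr0_norm// => h; rewrite h ltxx in d2'.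
Qed.

End InjectiveHolomorphic.

(** * Truncated logarithms of holomorphic functions *)

Section TruncatedLogarithm.
Context {R : realType}.
Local Notation C := R[i].
Implicit Types (a c z w : C) (r s t x y e k M : R) (f g q Phi : C -> C) (Omega : set C).

(** After division by Phi z the values near z are near 1, where [clog] makes ln |Phi| a real part up
    to a constant. *)
Lemma log_mean_value Phi z : holo_near Phi z -> Phi z != 0 ->
  exists2 d : R, 0 < d & forall r, 0 < r < d ->
    [/\ forall t, {for circle z r t, continuous (fun w => ln (normc (Phi w)))},
        forall t, Phi (circle z r t) != 0 &
        cmean (fun w => ln (normc (Phi w))) z r = ln (normc (Phi z))].
Proof.
move=> [cPhi [d1 d10 dPhi]] Pz.
pose Psi w := Phi w / Phi z.
have Psiz : Psi z = 1 by rewrite /Psi divff.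
have cPsi : {for z, continuous Psi}.
  exact: (continuousM_C cPhi (@continuous_cst _ _ _)).
have [d2 d20 d2P] := (continuous_CCP _ _).1 cPsi _ ltr01.
have rePsi w : normc (w - z) < d2 -> 0 < Re (Psi w).
  by move=> /d2P; rewrite Psiz; exact: Re_near1_gt0.
pose d := Num.min d1 d2.
have hl : holo_near (fun w => clog (Psi w)) z.
  split; first by refine (continuous_comp_C cPsi (continuous_clog _)); rewrite Psiz.
  exists d => [|w /andP[w0]]; first by rewrite lt_min d10.
  rewrite lt_min => /andP[w1 w2]; apply: (@cdiff_comp _ clog Psi).
    by apply: cdiffM; [apply: dPhi; rewrite w0|exact: cdiff_cst].
  by apply: cdiff_clog; exact: rePsi.
have [d3 d30 d3P] := holo_near_mean hl.
exists (Num.min d d3) => [|r /andP[r0]]; first by rewrite !lt_min d10 d20.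
rewrite !lt_min => /andP[/andP[r1 r2] r3].
have nc t : normc (circle z r t - z) = r by rewrite normc_circle gtr0_norm.
have Psi0 w : normc (w - z) < d2 -> Phi w != 0.
  by move=> /rePsi; apply: contraTneq => E; rewrite /Psi E mul0r ltxx.
have dc t : cdiff Phi (circle z r t) by apply: dPhi; rewrite nc r0.
have cln t : {for circle z r t, continuous (fun w => ln (normc (Phi w)))}.
  by refine (continuous_ln_normc (cdiff_continuous (dc t)) (Psi0 _ _)); rewrite nc.
split => //; first by move=> t; apply: Psi0; rewrite nc.
have := d3P r; rewrite r0 r3 => /(_ isT); rewrite !Re_clog Psiz normc1 ln1 => E.
have lnE w : normc (w - z) < d2 ->
    ln (normc (Psi w)) = ln (normc (Phi w)) - ln (normc (Phi z)).
  by move=> wd; rewrite normcM normcV ln_div// posrE normc_gt0// Psi0.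
have ct := continuous_on_circle cln.
have ck : continuous (fun _ : R => ln (normc (Phi z))) by move=> u; exact: cvg_cst.
apply/eqP; rewrite -subr_eq0 -E /cmean -[X in _ - X]mean_cst -meanB//.
by apply/eqP; apply: eq_mean => t; rewrite Re_clog lnE// nc.
Qed.

(** The subharmonic function max (ln |Phi|) (ln k), glued to its least value ln k outside Omega.
    Such a gluing works when |Phi| is asymptotically at most k at the boundary. *)
Definition ext_ln Omega Phi k z :=
  if z \in Omega then ln (Num.max (normc (Phi z)) k) else ln k.

Lemma ext_ln_ge Omega Phi k z : 0 < k -> ln k <= ext_ln Omega Phi k z.
Proof.
move=> k0; rewrite /ext_ln; case: ifP => // _.
by rewrite ler_ln ?posrE// ?lt_max ?k0 ?orbT// le_max lexx orbT.
Qed.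

Lemma ext_ln_ge_ln Omega Phi k z : 0 < k -> Omega z -> Phi z != 0 ->
  ln (normc (Phi z)) <= ext_ln Omega Phi k z.
Proof.
move=> k0 Oz Pz; rewrite /ext_ln mem_set// ler_ln ?posrE ?normc_gt0//.
  by rewrite le_max lexx.
by rewrite lt_max k0 orbT.
Qed.

Lemma ext_lnE Omega Phi k z : Omega z -> k <= normc (Phi z) ->
  ext_ln Omega Phi k z = ln (normc (Phi z)).
Proof. by move=> Oz kz; rewrite /ext_ln mem_set// max_l. Qed.

Lemma ext_ln_eq Omega Phi k z : (Omega z -> normc (Phi z) <= k) ->
  ext_ln Omega Phi k z = ln k.
Proof. by rewrite /ext_ln; case: ifPn => // /set_mem Oz /(_ Oz) zk; rewrite max_r. Qed.

(** Outside Omega only an upper bound for |Phi| is demanded, as the truncation supplies the lower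
    one. *)
Lemma continuous_ext_ln Omega Phi k z : open Omega -> 0 < k ->
  (Omega z -> {for z, continuous Phi}) ->
  (~ Omega z -> forall e, 0 < e -> exists2 d, 0 < d & forall w,
     normc (w - z) < d -> Omega w -> normc (Phi w) < k + e) ->
  {for z, continuous (ext_ln Omega Phi k)}.
Proof.
move=> oO k0 cPhi lim; apply/continuous_CRP => e e0.
have [Oz|Oz] := pselect (Omega z).
  have c : {for z, continuous (fun w => ln (Num.max (normc (Phi w)) k))}.
    have c1 : {for z, continuous (fun w => Num.max (normc (Phi w)) k)}.
      exact: (@continuous_max R C _ (fun=> k) z (continuous_normcE (cPhi Oz))
        (@cst_continuous C R k z)).
    refine (@continuous_comp C R R _ (@ln R) z c1 (continuous_ln _)).
    by rewrite lt_max k0 orbT.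
  have [d1 d10 d1P] := open_disk oO Oz.
  have [d2 d20 d2P] := (continuous_CRP _ _).1 c _ e0.
  exists (Num.min d1 d2) => [|w]; first by rewrite lt_min d10.
  rewrite lt_min => /andP[w1 w2].
  by rewrite /ext_ln !mem_set//; [exact: d2P|apply: d1P; exact: ltW].
have cln : {for k, continuous (@ln R)} by exact: continuous_ln.
move: cln => /cvgrPdistC_lt /(_ _ e0) /nbhs_ballP[d1 /= d10 d1P].
have [d d0 dP] := lim Oz _ d10; exists d => // w wd.
rewrite [ext_ln _ _ _ z]/ext_ln memNset// /ext_ln; case: ifPn => [/set_mem Ow|_].
  have [wk|kw] := leP (normc (Phi w)) k; first by rewrite subrr normr0.
  apply: (d1P (normc (Phi w))); rewrite /ball /= distrC gtr0_norm ?subr_gt0//.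
  by rewrite ltrBlDl dP.
by rewrite subrr normr0.
Qed.

(** Where the value is ln k, it is the global minimum and the inequality is clear. Elsewhere ln
    |Phi| is a minorant with the mean value property and the same value at z. *)
Lemma submean_ext_ln Omega Phi k z r : 0 < k -> 0 < r ->
  (Omega z -> exists2 d : R, 0 < d & forall w, normc (w - z) <= d -> Omega w) ->
  (Omega z -> holo_near Phi z /\ Phi z != 0) ->
  (forall w, normc (w - z) < r -> {for w, continuous (ext_ln Omega Phi k)}) ->
  submean_at (ext_ln Omega Phi k) z.
Proof.
move=> k0 r0 oO hPhi cW.
have cc s : 0 < s < r -> continuous (fun t => ext_ln Omega Phi k (circle z s t)).
  move=> /andP[s0 sr]; apply: continuous_on_circle => t; apply: cW.
  by rewrite normc_circle gtr0_norm.
have cst (x : R) : continuous (fun _ : R => x) by move=> u; exact: cvg_cst.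
have [Oz|Oz] := pselect (Omega z /\ k < normc (Phi z)); last first.
  exists r => // s sr; rewrite ext_ln_eq.
    by rewrite -[leLHS]mean_cst; apply: mean_le => // [|t _]; [exact: cc|exact: ext_ln_ge].
  by move=> h; rewrite leNgt; apply/negP => h'; exact: Oz.
move: Oz => [Oz kz]; have [h1 h2] := hPhi Oz; have [d1 d10 d1P] := oO Oz.
have [d2 d20 d2P] := log_mean_value h1 h2.
exists (Num.min (Num.min d1 d2) r) => [|s /andP[s0]]; first by rewrite !lt_min d10 d20.
rewrite !lt_min => /andP[/andP[s1 s2] sr].
have := d2P s; rewrite s0 s2 => /(_ isT) [c1 c2 c3].
rewrite ext_lnE//; last exact: ltW.
rewrite -c3; apply: mean_le => [||t _]; first exact: (continuous_on_circle c1).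
  by have := cc s; rewrite s0 sr; apply.
apply: ext_ln_ge_ln => //; apply: d1P.
by rewrite normc_circle gtr0_norm// ltW.
Qed.

End TruncatedLogarithm.

(** * Connected subsets of the plane *)

Section Connectedness.
Context {R : realType}.
Local Notation C := R[i].
Implicit Types (a c z w : C) (r s t x y : R) (X B : set C).

Lemma star_connected X c :
  (forall z, X z -> exists B, [/\ connected B, B `<=` X, B c & B z]) -> connected X.
Proof.
move=> H; pose B (z : C) := xget set0 [set B | [/\ connected B, B `<=` X, B c & B z]].
have BP z : X z -> [/\ connected (B z), B z `<=` X, B z c & B z z].
  move=> Xz; rewrite /B; case: xgetP => [D _ //|no].
  by have [D HD] := H z Xz; case: (no D).
have -> : X = \bigcup_(z in X) B z.
  apply/seteqP; split=> [z Xz|z [w Xw Bz]].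
    by exists z => //; have [] := BP z Xz.
  by have [_ BX _ _] := BP w Xw; exact: BX.
apply: bigcup_connected => [|z Xz]; last by have [] := BP z Xz.
by exists c => z Xz; have [] := BP z Xz.
Qed.

Lemma interval_image_connected (i : interval R) (g : R -> C) :
  continuous g -> connected (g @` [set` i]).
Proof.
move=> cg; apply: connected_continuous_connected; last exact: continuous_subspaceT.
by apply/connected_intervalP; exact: interval_is_interval.
Qed.

Lemma continuous_ray t : continuous (fun x => circle 0 x t : C).
Proof.
move=> x; refine (@continuousD C C R (fun=> 0) _ x (cvg_cst _) _).
exact: (@continuousM C R (fun x => x%:C%C) (fun=> expi t) x
  (@continuous_real_complex R x) (cvg_cst _)).
Qed.

Lemma normc_circle0 r t : 0 <= r -> normc (circle 0 r t : C) = r.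
Proof. by move=> r0; rewrite -[circle _ _ _]subr0 normc_circle ger0_norm. Qed.

Lemma polar0 z : exists2 t, 0 <= t <= 2 * pi & z = circle 0 (normc z) t.
Proof. by have [t tt zE] := polar z; exists t => //; rewrite /circle add0r. Qed.

(** B is the circle of radius x with the open radial segment through z. The free angle t lets
    [slit_domain_connected] attach B to a radius through a gap between slits. *)
Lemma annulus_joint x1 x2 x t z : 0 <= x1 -> x1 < x < x2 -> x1 < normc z < x2 ->
  exists B, [/\ connected B, forall w, B w -> x1 < normc w < x2,
    B (circle 0 x t) & B z].
Proof.
move=> x10 xx zz; have [u uu zE] := polar0 z.
have x0 : 0 <= x by rewrite ltW// (le_lt_trans x10)//; case/andP: xx.
exists ((circle 0 x @` [set` `]-oo, +oo[]) `|`
        ((fun y => circle 0 y u) @` [set` `]x1, x2[])); split.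
- apply: connectedU.
  + exists (circle 0 x u); split; first by exists u.
    by exists x => //; rewrite /= in_itv.
  + by apply: interval_image_connected; exact: continuous_circle.
  + by apply: interval_image_connected; exact: continuous_ray.
- move=> w [[v _ <-]|[y]]; first by rewrite normc_circle0.
  rewrite /= in_itv /= => yy <-; rewrite normc_circle0//.
  by rewrite ltW// (le_lt_trans x10)//; case/andP: yy.
- by left; exists t.
- by right; exists (normc z) => //; rewrite /= in_itv.
Qed.

Lemma annulus_connected x1 x2 : 0 <= x1 -> connected [set z : C | x1 < normc z < x2].
Proof.
move=> x10; have [x12|x12] := ltP x1 x2; last first.
  have -> : [set z : C | x1 < normc z < x2] = set0; last exact: connected0.
  by apply/seteqP; split=> z //= /andP[h1 h2]; have := lt_trans h1 h2; rewrite ltNge x12.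
have xm : x1 < (x1 + x2) / 2 < x2 by apply/andP; split; lra.
apply: (@star_connected _ (circle 0 ((x1 + x2) / 2) 0)) => z zz.
by have [B [cB BX Bc Bz]] := annulus_joint 0 x10 xm zz; exists B.
Qed.

End Connectedness.

(** A negative n would give K n + q <= |q| - K < 0. *)
Lemma int_slope_ge0 (K : nat) (n q : int) :
  (`|q| < K)%N -> 0 <= K%:Z * n + q -> 0 <= n.
Proof. by move=> qK Kn; rewrite leNgt; apply/negP => n0; nia. Qed.

(** * Rigidity of the quotient F of f z by z *)

Section Rigidity.
Context {R : realType}.
Local Notation C := R[i].
Implicit Types (a c z w : C) (r s t x y e k M : R).

(** The shape of the slits does not enter: Omega contains the unit disk without the circle |z| = 1/2
    and misses at least the point p of that circle. [sur] expresses that the image contains the disk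
    of radius 1/2. *)
Context (Omega : set C) (f F : C -> C) (p : C).
Context (oO : open Omega) (O1 : forall z, Omega z -> normc z < 1)
  (Oc : connected Omega)
  (slit : forall z, normc z < 1 -> normc z != 2^-1 -> Omega z)
  (pn : normc p = 2^-1) (np : ~ Omega p).
Context (df : forall z, Omega z -> cdiff f z) (inj : injective_on Omega f)
  (f1 : forall z, Omega z -> normc (f z) < 1) (f0 : f 0 = 0)
  (sur : forall w, normc w < 2^-1 -> exists2 z, Omega z & f z = w)
  (cF : {for 0, continuous F}) (fF : forall z, f z = F z * z).

Let O0 : Omega 0.
Proof. by apply: slit; rewrite normc0 ?ltr01// eq_sym invr_eq0 pnatr_eq0. Qed.

Let Osmall z : normc z <= 4^-1 -> Omega z.
Proof.
move=> z4; apply: slit; first by apply: le_lt_trans z4 _; lra.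
by rewrite lt_eqF//; apply: le_lt_trans z4 _; lra.
Qed.

Let Obig z : 2^-1 < normc z < 1 -> Omega z.
Proof. by move=> /andP[z2 z1]; apply: slit => //; rewrite gt_eqF. Qed.

Lemma quotient_neq0 z : Omega z -> F z != 0.
Proof.
move=> Oz; have [->|z0] := eqVneq z 0.
  apply: (@injective_derivative_neq0 _ f F 4^-1) => //.
    by move=> w /Osmall; exact: df.
  by move=> w u /Osmall Ow /Osmall Ou; exact: inj.
apply: contra_neq z0 => Fz; apply: inj => //.
by rewrite f0 fF Fz mul0r.
Qed.

Lemma quotient_cdiff z : Omega z -> z != 0 -> cdiff F z.
Proof.
move=> Oz z0; apply: (@cdiff_near_eq _ (fun w => f w / w)).
  by apply: cdiff_div; [exact: df|exact: cdiff_id|].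
apply/nbhs_normcP; exists (normc z); first by rewrite normc_gt0.
move=> w wz; rewrite fF mulfK//; apply: contraTneq wz => ->.
by rewrite sub0r normcN ltxx.
Qed.

Lemma quotient_continuous z : Omega z -> {for z, continuous F}.
Proof.
move=> Oz; have [->//|z0] := eqVneq z 0.
exact: (cdiff_continuous (quotient_cdiff Oz z0)).
Qed.

Lemma quotient_holo_near z : Omega z -> holo_near F z.
Proof.
move=> Oz; split; first exact: (quotient_continuous Oz).
have [z0|z0] := eqVneq z 0.
  exists 4^-1 => [|w /andP[w0 w4]]; first by rewrite invr_gt0.
  rewrite z0 subr0 in w0 w4; apply: quotient_cdiff; last by rewrite -normc_gt0.
  by apply: Osmall; exact: ltW.
have [d d0 dO] := open_disk oO Oz.
exists (Num.min d (normc z)) => [|w /andP[_]]; first by rewrite lt_min d0 normc_gt0.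
rewrite lt_min => /andP[wd wz]; apply: quotient_cdiff; first by apply: dO; exact: ltW.
by apply: contraTneq wz => ->; rewrite sub0r normcN ltxx.
Qed.

Lemma inv_holo_near z : Omega z -> holo_near (fun w => (F w)^-1) z.
Proof.
move=> Oz; have [cFz [d d0 dP]] := quotient_holo_near Oz.
split; first exact: (continuousV_C (quotient_neq0 Oz) cFz).
have [d1 d10 dO] := open_disk oO Oz.
exists (Num.min d d1) => [|w /andP[w0]]; first by rewrite lt_min d0.
rewrite lt_min => /andP[wd wd1]; apply: cdiffV; first by apply: dP; rewrite w0.
by apply: quotient_neq0; apply: dO; exact: ltW.
Qed.

Let sub s := [set z | Omega z /\ normc (f z) <= s].

Let sub_compact s : s < 2^-1 -> compact (sub s).
Proof. by move=> s2; exact: (sublevel_compact oO df inj sur s2). Qed.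

(** The set where |f| <= s is compact, hence closed in the plane, and q is not in it. *)
Lemma large_near_slit q s : ~ Omega q -> s < 2^-1 ->
  exists2 d : R, 0 < d & forall z, normc (z - q) < d -> Omega z -> s < normc (f z).
Proof.
move=> nq s2; have cl : closed (sub s).
  by apply: compact_closed (sub_compact s2); exact: norm_hausdorff.
have [|d d0 dP] := (nbhs_normcP q (~` sub s)).1.
  by apply: open_nbhs_nbhs; split; [exact: closed_openC|case].
exists d => // z zd Oz; rewrite ltNge; apply/negP => fz.
by apply: (dP _ zd); split.
Qed.

(** The largest modulus of a point in the compact set where |f| <= s is attained in Omega, so it is
    below 1. *)
Lemma large_near_circle s : 0 <= s -> s < 2^-1 ->
  exists2 r : R, r < 1 & forall z, Omega z -> r < normc z -> s < normc (f z).
Proof.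
move=> s0 s2.
have n0 : sub s !=set0 by exists 0; split; rewrite ?f0 ?normc0.
have [|c] := compact_EVT_max n0 (sub_compact s2) (f := @normc R).
  by apply: continuous_in_subspaceT => z _; exact: continuous_normc.
rewrite inE => -[Oc' fc] cmax; exists (normc c); first exact: O1.
move=> z Oz cz; rewrite ltNge; apply/negP => fz.
have := cmax z; rewrite inE => /(_ (conj Oz fz)).
by rewrite leNgt cz.
Qed.

(* v = max (ln |z / f z|) 0, extended by 0 across the slits. *)
Let v := ext_ln Omega (fun z => (F z)^-1) 1.

Let normF z : normc (f z) = normc (F z) * normc z.
Proof. by rewrite fF normcM. Qed.

Lemma v_continuous z : normc z < 1 -> {for z, continuous v}.
Proof.
move=> z1; refine (@continuous_ext_ln R Omega (fun z => (F z)^-1) 1 z oO ltr01 _ _).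
  by move=> Oz; exact: (continuousV_C (quotient_neq0 Oz) (quotient_continuous Oz)).
move=> nO e e0; have z2 : normc z = 2^-1.
  by apply/eqP/negPn/negP => h; apply: nO; exact: slit.
have e2 : 0 < 2 + e by rewrite ltr_wpDl.
(* Near the slit |f w| > s and |w| < (1 + e) s, so |1 / F w| < 1 + e; the chosen s < 1/2 satisfies
   1/2 < (1 + e) s. *)
pose s := (2 + e)^-1; have s0 : 0 < s by rewrite invr_gt0.
have s2 : s < 2^-1 by rewrite ltf_pV2 ?posrE// ltrDl.
have se : 2^-1 < (1 + e) * s.
  by rewrite /s ltr_pdivlMr// mulrDr mulVf// mulrC; lra.
have [d d0 dP] := large_near_slit nO s2.
exists (Num.min d ((1 + e) * s - 2^-1)) => [|w]; first by rewrite lt_min d0 subr_gt0.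
rewrite lt_min => /andP[wd we] Ow; have fw := dP _ wd Ow.
have wn : normc w < (1 + e) * s.
  have := normcB_ge w z; rewrite z2; move: we; set X := _ * s; lra.
rewrite normcV -[_^-1]mul1r ltr_pdivrMr ?normc_gt0 ?quotient_neq0//.
have [w0|w0] := eqVneq w 0.
  by rewrite w0 f0 normc0 ltNge ltW in fw.
have wn0 : 0 < normc w by rewrite normc_gt0.
rewrite -(ltr_pM2r wn0) mul1r -mulrA -normF; apply: lt_trans wn _.
by rewrite ltr_pM2l// addr_gt0.
Qed.

Lemma v_submean z : normc z < 1 -> submean_at v z.
Proof.
move=> z1; refine (@submean_ext_ln R Omega (fun w => (F w)^-1) 1 z (1 - normc z)
  ltr01 _ (fun Oz => open_disk oO Oz) _ _).
- by rewrite subr_gt0.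
- by move=> Oz; split; [exact: inv_holo_near|rewrite invr_eq0 quotient_neq0].
- move=> w wz; refine (v_continuous _); rewrite -[w](subrK z).
  by apply: le_lt_trans (normcD _ _) _; rewrite -ltrBrDr.
Qed.

Let vc z : normc (z - 0) < 1 -> {for z, continuous v}.
Proof. by rewrite subr0 => z1; exact: (v_continuous z1). Qed.

Let vs z : normc (z - 0) < 1 -> submean_at v z.
Proof. by rewrite subr0; exact: v_submean. Qed.

Lemma v_ge0 z : 0 <= v z.
Proof. by rewrite -ln1; exact: ext_ln_ge. Qed.

(** On circles near |z| = 1 one has |f| > 1 / (2 + e), hence |1 / F| <= 2 + e, and the maximum
    principle for v carries this inside. The bound keeps the barrier W above its truncation on the
    annulus of radii 3/4 and 7/8. *)
Lemma quotient_ge z : Omega z -> 2^-1 <= normc (F z).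
Proof.
move=> Oz; suff H : normc (F z)^-1 <= 2.
  by rewrite -[leRHS]invrK -normcV lef_pV2 ?posrE// normc_gt0 invr_eq0 quotient_neq0.
apply/ler_addgt0Pl => e e0; rewrite addrC.
have e2 : 0 < 2 + e by rewrite ltr_wpDl.
pose s := (2 + e)^-1; have s0 : 0 < s by rewrite invr_gt0.
have s2 : s < 2^-1 by rewrite ltf_pV2 ?posrE// ltrDl.
have [r r1 rP] := large_near_circle (ltW s0) s2.
pose M := Num.max r (Num.max 2^-1 (normc z)).
have M1 : M < 1 by rewrite !gt_max r1 (O1 Oz) andbT /=; lra.
pose b := (M + 1) / 2.
have [Mb b1] : M < b /\ b < 1 by rewrite /b; split; lra.
have [rb zb b2] : [/\ r < b, normc z < b & 2^-1 < b].
  by move: Mb; rewrite !gt_max => /andP[-> /andP[-> ->]].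
have ln2e : v z <= ln (2 + e).
  refine (@max_principle R v 0 b (ln (2 + e)) _ _ _ z _); last by rewrite subr0 ltW.
  - by move=> w; rewrite subr0 => wb; exact: (v_continuous (le_lt_trans wb b1)).
  - by move=> w; rewrite subr0 => wb; exact: (v_submean (lt_trans wb b1)).
  - move=> w; rewrite subr0 => wb; have Ow : Omega w by apply: Obig; rewrite wb b2.
    rewrite /v /ext_ln mem_set// ler_ln ?posrE ?lt_max ?ltr01 ?orbT//.
    rewrite ge_max; apply/andP; split; last by lra.
    have fw := rP _ Ow; rewrite wb in fw; have {fw} := fw rb.
    rewrite normF wb normcV /s => h.
    have Fw : 0 < normc (F w) by rewrite normc_gt0 quotient_neq0.
    rewrite -[leRHS]invrK lef_pV2 ?posrE ?invr_gt0//.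
    by apply: le_trans (ltW h) _; rewrite ler_piMr ?ltW.
rewrite -(ler_ln (x := normc (F z)^-1)) ?posrE//; last first.
  by rewrite normc_gt0 invr_eq0 quotient_neq0.
refine (le_trans (@ext_ln_ge_ln R Omega (fun w => (F w)^-1) 1 z ltr01 Oz _) ln2e).
by rewrite invr_eq0 quotient_neq0.
Qed.

(** The variable is the logarithm of the radius, in which this mean is affine on (ln (1/2), 0). *)
Let mu x := cmean (fun z => ln (normc (F z))) 0 (expR x).

Lemma quotient_winding x1 x2 : ln 2^-1 < x1 -> x1 <= x2 -> x2 < 0 ->
  exists n : int, forall x, x1 <= x <= x2 -> mu x - mu x1 = n%:~R * (x - x1).
Proof.
move=> l1 x12 l2; apply: log_mean_winding => // z; rewrite subr0 => /andP[z1 z2].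
have zb : 2^-1 < normc z < 1.
  rewrite (lt_le_trans _ z1) ?(le_lt_trans z2)//=; first by rewrite -expR0 ltr_expR.
  by rewrite -[ltLHS]lnK ?posrE ?invr_gt0// ltr_expR.
have Oz := Obig zb; split; last exact: quotient_neq0.
apply: quotient_cdiff => //; rewrite -normc_gt0; apply: lt_trans (andP zb).1.
by rewrite invr_gt0.
Qed.

(** k is a truncation level for G = F^K P. With |F| >= 1/2, [Plow] gives |G| >= k on the annulus;
    with |F| <= 4 near the slits, [Pup] gives |G| < k there. *)
Context (P : C -> C) (K : nat) (k : R) (q : int).
Context (dP : forall z, cdiff P z) (P0 : forall z, Omega z -> P z != 0)
  (k0 : 0 < k) (qK : (`|q| < K)%N)
  (qP : cmean (fun z => ln (normc (P z))) 0 (7 / 8) -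
        cmean (fun z => ln (normc (P z))) 0 (3 / 4) = q%:~R * (ln (7 / 8) - ln (3 / 4)))
  (Plow : forall z, 3 / 4 <= normc z <= 7 / 8 -> 2 ^+ K * k <= normc (P z))
  (Pup : forall z, normc z < 1 -> ~ Omega z -> 4 ^+ K * normc (P z) < k).

Let G z := F z ^+ K * P z.

Let G_neq0 z : Omega z -> G z != 0.
Proof. by move=> Oz; rewrite mulf_neq0 ?P0// expf_neq0// quotient_neq0. Qed.

Let G_cdiff z : cdiff F z -> cdiff G z.
Proof. by move=> dF; apply: cdiffM; [exact: cdiffX|exact: dP]. Qed.

Let G_holo_near z : Omega z -> holo_near G z.
Proof.
move=> Oz; have [cFz [d d0 dPz]] := quotient_holo_near Oz.
split; last by exists d => // w /dPz; exact: G_cdiff.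
refine (continuousM_C _ (cdiff_continuous (dP z))).
elim: (K) => [|n IH].
  have -> : (fun w => F w ^+ 0) = (fun=> 1) by apply/funext => w; rewrite expr0.
  exact: (@continuous_cst _ _ _).
have -> : (fun w => F w ^+ n.+1) = (fun w => F w * F w ^+ n).
  by apply/funext => w; rewrite exprS.
exact: (continuousM_C cFz IH).
Qed.

Let W := ext_ln Omega G k.

(** Within 1/4 of a slit point |w| > 1/4, so |f| < 1 gives |F w| <= 4, and [Pup] leaves room for the
    variation of P. *)
Let W_continuous z : normc z < 1 -> {for z, continuous W}.
Proof.
move=> z1; refine (@continuous_ext_ln R Omega G k z oO k0 _ _).
  by move=> Oz; have [] := G_holo_near Oz.
move=> nO e e0; have z2 : normc z = 2^-1.
  by apply/eqP/negPn/negP => h; apply: nO; exact: slit.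
have := Pup z1 nO; rewrite -subr_gt0; set g := k - _ => g0.
have p4 : 0 < 4 ^+ K :> R by rewrite exprn_gt0.
have [d d0 dPd] := (continuous_CCP P z).1 (cdiff_continuous (dP z)) _ (divr_gt0 g0 p4).
exists (Num.min d 4^-1) => [|w]; first by rewrite lt_min d0 /= invr_gt0.
rewrite lt_min => /andP[wd w4] Ow.
have wn : 4^-1 < normc w.
  have := normcB_ge z w; rewrite z2 normcBC; lra.
have F4 : normc (F w) <= 4.
  rewrite -(ler_pM2r (lt_trans _ wn)) ?invr_gt0// -normF.
  by apply: le_trans (ltW (f1 Ow)) _; lra.
have Pw : normc (P w) <= normc (P z) + g / 4 ^+ K.
  rewrite -lerBlDl; apply: le_trans (normcB_ge _ _) _; exact: ltW (dPd _ wd).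
apply: le_lt_trans (_ : k < _); last by rewrite ltrDl.
rewrite normcM normcX.
apply: le_trans (ler_pM _ _ (lerXn2r K _ _ F4) Pw) _; rewrite ?nnegrE ?exprn_ge0 ?normc_ge0//.
by rewrite mulrDr [_ * (g / _)]mulrC divfK ?gt_eqF// /g addrC subrK.
Qed.

Let W_submean z : normc z < 1 -> submean_at W z.
Proof.
move=> z1; refine (@submean_ext_ln R Omega G k z (1 - normc z)
  k0 _ (fun Oz => open_disk oO Oz) _ _).
- by rewrite subr_gt0.
- by move=> Oz; split; [exact: G_holo_near|exact: G_neq0].
- move=> w wz; refine (W_continuous _); rewrite -[w](subrK z).
  by apply: le_lt_trans (normcD _ _) _; rewrite -ltrBrDr.
Qed.

Let lnF_continuous r : 2^-1 < r -> r < 1 ->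
  continuous (fun t => ln (normc (F (circle 0 r t)))).
Proof.
move=> r2 r1; have r0 : 0 < r by apply: lt_trans r2; rewrite invr_gt0.
have Oc' t : Omega (circle 0 r t).
  by apply: Obig; rewrite -[circle _ _ _]subr0 normc_circle gtr0_norm// r2 r1.
refine (@continuous_on_circle R (fun z => ln (normc (F z))) 0 r
  (fun t => continuous_ln_normc (quotient_continuous (Oc' t)) (quotient_neq0 (Oc' t)))).
Qed.

Let cmean_W r : 3 / 4 <= r <= 7 / 8 -> cmean W 0 r =
  K%:R * cmean (fun z => ln (normc (F z))) 0 r + cmean (fun z => ln (normc (P z))) 0 r.
Proof.
move=> /andP[r1 r2]; have r0 : 0 < r by lra.
have nc t : normc (circle 0 r t : C) = r by rewrite -[circle _ _ _]subr0 normc_circle gtr0_norm.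
have Oc' t : Omega (circle 0 r t) by apply: Obig; rewrite nc; apply/andP; split; lra.
have cF' : continuous (fun t => ln (normc (F (circle 0 r t)))).
  by apply: lnF_continuous; lra.
have cP' : continuous (fun t => ln (normc (P (circle 0 r t)))).
  refine (@continuous_on_circle R (fun z => ln (normc (P z))) 0 r
    (fun t => continuous_ln_normc (cdiff_continuous (dP _)) (P0 (Oc' t)))).
rewrite /cmean -meanZ// -meanD//; last first.
  move=> t; exact: (@continuousM R R (fun=> K%:R) _ t (cvg_cst _) (cF' t)).
apply: eq_mean => t; rewrite /W ext_lnE//.
  rewrite normcM normcX lnM ?posrE ?exprn_gt0 ?normc_gt0 ?P0 ?quotient_neq0//.
  by rewrite lnXn ?normc_gt0 ?quotient_neq0// mulr_natl.
rewrite normcM normcX; have Pl := Plow (z := circle 0 r t); rewrite nc r1 r2 in Pl.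
apply: le_trans (ler_pM _ _ (lerXn2r K _ _ (quotient_ge (Oc' t))) (Pl isT));
  rewrite ?nnegrE ?invr_ge0 ?exprn_ge0 ?mulr_ge0 ?exprn_ge0 ?normc_ge0 ?(ltW k0) ?invr_ge0//.
by rewrite exprVn mulrA mulVf ?mul1r// expf_neq0.
Qed.

Let ln34 : ln (3 / 4) < ln (7 / 8) :> R.
Proof. by rewrite ltr_ln ?posrE//; lra. Qed.

(** Between radii 3/4 and 7/8 the mean of W has slope K n + q in ln r, with n the slope of [mu]. The
    means of W increase, so K n + q >= 0 and n >= 0. *)
Lemma mu_nondecreasing x1 x2 : ln 2^-1 < x1 -> x1 <= x2 -> x2 < 0 -> mu x1 <= mu x2.
Proof.
have [u1 u2 u3] : [/\ 0 <= 3 / 4 :> R, 3 / 4 <= 7 / 8 :> R & 7 / 8 < 1 :> R].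
  by split; lra.
have u4 : 2^-1 < 3 / 4 :> R by lra.
(* The interval is widened to contain ln (3/4) and ln (7/8), so that one integer n is the slope at
   all the points compared. *)
move=> l1 x12 l2; pose y1 := Num.min x1 (ln (3 / 4)); pose y2 := Num.max x2 (ln (7 / 8)).
have y1l : ln 2^-1 < y1.
  by rewrite lt_min l1 ltr_ln ?posrE ?invr_gt0// divr_gt0.
have y2l : y2 < 0 by rewrite gt_max l2 -ln1 ltr_ln ?posrE// divr_gt0.
have yx1 : y1 <= x1 by rewrite ge_min lexx.
have xy2 : x2 <= y2 by rewrite le_max lexx.
have y1a : y1 <= ln (3 / 4) by rewrite ge_min lexx orbT.
have by2 : ln (7 / 8) <= y2 by rewrite le_max lexx orbT.
have [n nP] := quotient_winding y1l (le_trans yx1 (le_trans x12 xy2)) y2l.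
have [h1 h2] : mu x1 - mu y1 = n%:~R * (x1 - y1) /\ mu x2 - mu y1 = n%:~R * (x2 - y1).
  split; apply: nP; first by rewrite yx1 (le_trans x12 xy2).
  by rewrite xy2 (le_trans yx1 x12).
have [h3 h4] : mu (ln (3 / 4)) - mu y1 = n%:~R * (ln (3 / 4) - y1) /\ mu (ln (7 / 8)) - mu y1 = n%:~R * (ln (7 / 8) - y1).
  split; apply: nP; first by rewrite y1a (le_trans (ltW ln34) by2).
  by rewrite by2 (le_trans y1a (ltW ln34)).
suff n0 : 0 <= n%:~R :> R.
  move: h1 h2 => /eqP; rewrite subr_eq => /eqP-> /eqP; rewrite subr_eq => /eqP->.
  by rewrite lerD2r ler_wpM2l// lerD2r.
have : cmean W 0 (3 / 4) <= cmean W 0 (7 / 8).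
  refine (@cmean_mono R W 0 1 _ _ u1 u2 u3 _ _).
  - by move=> z; rewrite subr0; exact: W_continuous.
  - by move=> z; rewrite subr0; exact: W_submean.
rewrite !cmean_W ?lexx ?u2//.
rewrite /mu !lnK ?posrE ?divr_gt0// in h3 h4 => mono.
have qP' := qP; set d := ln (7 / 8) - ln (3 / 4) in qP' *; have d0 : 0 < d by rewrite subr_gt0.
have : 0 <= (K%:R * n%:~R + q%:~R) * d.
  rewrite mulrDl -qP' -mulrA.
  have -> : n%:~R * d = cmean (fun z => ln (normc (F z))) 0 (7 / 8) -
      cmean (fun z => ln (normc (F z))) 0 (3 / 4).
    rewrite /d; move: h3 h4; move: (ln (3 / 4)) (ln (7 / 8)) (cmean _ _ (3 / 4))
      (cmean _ _ (7 / 8)) => a b A B /eqP; rewrite subr_eq => /eqP-> /eqP.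
    by rewrite subr_eq => /eqP->; ring.
  rewrite mulrBr addrACA -opprD subr_ge0; exact: mono.
rewrite pmulr_lge0// -[K%:R]/(K%:~R) -intrM -intrD !ler0z => Kn.
exact: int_slope_ge0 qK Kn.
Qed.

(** The sum is the positive part of ln |F|, and |f| < 1 gives |F| <= 1 / |z|. *)
Let v_lnF z : 2^-1 < normc z < 1 ->
  0 <= v z + ln (normc (F z)) <= - ln (normc z).
Proof.
move=> zb; have Oz := Obig zb; have F0 := quotient_neq0 Oz.
have z0 : 0 < normc z by apply: lt_trans (andP zb).1; rewrite invr_gt0.
have nF : 0 < normc (F z) by rewrite normc_gt0.
have lnFV : ln (normc (F z)^-1) = - ln (normc (F z)).
  by rewrite normcV lnV ?posrE.
have Fz0 : 0 < normc (F z) * normc z by rewrite mulr_gt0.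
have R1 : ln (normc (F z) * normc z)^-1 = - ln (normc z) - ln (normc (F z)).
  by rewrite lnV ?posrE// lnM ?posrE// opprD addrC.
apply/andP; split.
  rewrite -lerBlDr sub0r -lnFV; apply: (@ext_ln_ge_ln R Omega (fun w => (F w)^-1) 1 z ltr01 Oz).
  by rewrite invr_eq0.
rewrite -lerBrDr -R1 /v /ext_ln mem_set// ler_ln ?posrE ?invr_gt0//; last first.
  by rewrite lt_max ltr01 orbT.
rewrite ge_max normcV lef_pV2 ?posrE// ler_piMr ?(ltW nF) ?(ltW (andP zb).2)//=.
by rewrite invf_ge1// -normF ltW// f1.
Qed.

Let A x := cmean v 0 (expR x).

Let v_circle r : 0 <= r -> r < 1 -> continuous (fun t => v (circle 0 r t)).
Proof.
move=> r0 r1.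
have c1 t : normc (circle 0 r t : C) < 1 by rewrite normc_circle0.
exact: (@continuous_on_circle R v 0 r (fun t => v_continuous (c1 t))).
Qed.

Let expR_half x : ln 2^-1 < x -> 2^-1 < expR x.
Proof.
by move=> lx; rewrite -[ltLHS]lnK ?posrE ?invr_gt0// ltr_expR.
Qed.

Let expR_lt1 x : x < 0 -> expR x < 1 :> R.
Proof. by move=> x0; rewrite -expR0 ltr_expR. Qed.

Let A_mu_le x : ln 2^-1 < x -> x < 0 -> A x + mu x <= - x.
Proof.
move=> lx x0; have e2 := expR_half lx; have e1 := expR_lt1 x0.
have cv := v_circle (expR_ge0 x) e1; have cl := lnF_continuous e2 e1.
rewrite /A /mu /cmean -meanD// -[leRHS]mean_cst; apply: mean_le => [||t _].
- by move=> t; exact: (@continuousD R R R _ _ t (cv t) (cl t)).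
- by move=> t; exact: cvg_cst.
have nc := normc_circle0 t (expR_ge0 x).
have := @v_lnF (circle 0 (expR x) t); rewrite nc e2 e1 => /(_ isT) /andP[_].
by rewrite expRK.
Qed.

Let A_mono r1 r2 : 0 <= r1 -> r1 <= r2 -> r2 < 1 -> cmean v 0 r1 <= cmean v 0 r2.
Proof. by move=> r10 r12 r21; exact: (@cmean_mono R v 0 1 r1 r2 r10 r12 r21 vc vs). Qed.

(* The circle means of v increase, those of ln |F| do not decrease, and their
   sum, the mean of the positive part of ln |F|, tends to 0 at the unit circle. *)
Let A_mu_le0 x : ln 2^-1 < x -> x < 0 -> A x + mu x <= 0.
Proof.
move=> lx x0; apply/ler_addgt0Pl => e e0; rewrite addr0.
(* The sum of means does not decrease from x to y and is at most - y <= e at y. *)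
pose y := Num.max x (- e).
have xy : x <= y by rewrite le_max lexx.
have y0 : y < 0 by rewrite gt_max x0 oppr_lt0.
have ly := lt_le_trans lx xy.
apply: le_trans (_ : A y + mu y <= _).
  apply: lerD; last exact: mu_nondecreasing.
  by apply: A_mono (expR_ge0 x) _ (expR_lt1 y0); rewrite ler_expR.
apply: le_trans (A_mu_le ly y0) _.
by rewrite lerNl le_max lexx orbT.
Qed.

(** The positive part of ln |F| is nonnegative and continuous with mean at most 0 on each circle,
    hence zero. *)
Lemma v_outer z : 2^-1 < normc z < 1 -> v z = - ln (normc (F z)).
Proof.
move=> /andP[z2 z1].
have z0 : 0 < normc z by apply: lt_trans z2; rewrite invr_gt0.
have x0 : ln (normc z) < 0 by rewrite -ln1 ltr_ln ?posrE.
have lx : ln 2^-1 < ln (normc z) by rewrite ltr_ln ?posrE ?invr_gt0.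
have E : expR (ln (normc z)) = normc z by rewrite lnK ?posrE.
have cv := v_circle (ltW z0) z1; have cl := lnF_continuous z2 z1.
have [t tt zE] := circle_polar 0 z; rewrite subr0 in zE.
have : v (circle 0 (normc z) t) + ln (normc (F (circle 0 (normc z) t))) = 0.
  apply: (@mean_ge0_eq0 R (fun t => v (circle 0 (normc z) t) +
    ln (normc (F (circle 0 (normc z) t))))) => //.
  - by move=> u; exact: (@continuousD R R R _ _ u (cv u) (cl u)).
  - move=> u; have nc := normc_circle0 u (ltW z0).
    by have := @v_lnF (circle 0 (normc z) u); rewrite nc z2 z1 => /(_ isT) /andP[].
  - have := A_mu_le0 lx x0; rewrite /A /mu E meanD//.
by rewrite -zE => /eqP; rewrite addr_eq0 => /eqP.
Qed.

Lemma quotient_outer_le1 z : 2^-1 < normc z < 1 -> normc (F z) <= 1.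
Proof.
move=> zb; have := v_ge0 z; rewrite v_outer// oppr_ge0 => l0.
have F0 : 0 < normc (F z) by rewrite normc_gt0 quotient_neq0//; exact: Obig.
by rewrite -ler_ln ?posrE// ln1.
Qed.

Let A_mu x : ln 2^-1 < x -> x < 0 -> A x = - mu x.
Proof.
move=> lx x0; have e2 := expR_half lx; have e1 := expR_lt1 x0.
have cv := v_circle (expR_ge0 x) e1; have cl := lnF_continuous e2 e1.
apply/eqP; rewrite -addr_eq0 /A /mu /cmean -meanD// -[X in _ == X]mean_cst.
apply/eqP; apply: eq_mean => t; rewrite v_outer; first by rewrite addrC subrr.
by rewrite normc_circle0 ?expR_ge0// e2 e1.
Qed.

(** Here A = - mu, and neither A nor mu decreases. *)
Let A_const r1 r2 : 2^-1 < r1 -> r1 <= r2 -> r2 < 1 -> cmean v 0 r1 = cmean v 0 r2.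
Proof.
move=> r1h r12 r21.
have r10 : 0 < r1 by apply: lt_trans r1h; rewrite invr_gt0.
have r20 := lt_le_trans r10 r12.
have l1 : ln 2^-1 < ln r1 by rewrite ltr_ln ?posrE ?invr_gt0.
have l12 : ln r1 <= ln r2 by rewrite ler_ln ?posrE.
have l2 : ln r2 < 0 by rewrite -ln1 ltr_ln ?posrE.
have E1 : cmean v 0 r1 = A (ln r1) by rewrite /A lnK ?posrE.
have E2 : cmean v 0 r2 = A (ln r2) by rewrite /A lnK ?posrE.
have h1 := A_mono (ltW r10) r12 r21.
have h2 := mu_nondecreasing l1 l12 l2.
have h3 : A (ln r2) <= A (ln r1).
  rewrite (A_mu l1 (le_lt_trans l12 l2)) (A_mu (lt_le_trans l1 l12) l2).
  by rewrite lerN2.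
rewrite E1 E2 in h1 *; apply/eqP; rewrite eq_le; apply/andP; split; [exact: h1|exact: h3].
Qed.

Let numeric : [/\ 0 < 2^-1 :> R, 2^-1 < 3 / 4 :> R, 3 / 4 < 1 :> R, 0 <= 4^-1 :> R &
  2^-1 + 4^-1 = 3 / 4 :> R].
Proof. by split; lra. Qed.

(** The circle carrying the slits is beyond [A_const]; it is reached by continuity of the mean in
    the radius. *)
Let A_half : cmean v 0 2^-1 = cmean v 0 (3 / 4).
Proof.
have [n1 n2 n3 _ _] := numeric.
have [|B cB BE] := @continuous_cmean R v (3 / 4) (ltW (lt_trans n1 n2)).
  by move=> z z3; exact: (v_continuous (le_lt_trans z3 n3)).
apply/eqP; rewrite -subr_eq0; apply/negPn/negP => ne.
have e0 : 0 < `|cmean v 0 2^-1 - cmean v 0 (3 / 4)| by rewrite normr_gt0.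
have /cvgrPdist_lt /(_ _ e0) /nbhs_ballP[d /= d0 dP'] := cB 2^-1.
pose r := Num.min (2^-1 + d / 2) (3 / 4).
have d2 : 0 < d / 2 by rewrite divr_gt0.
have r2 : 2^-1 < r by rewrite lt_min n2 ltrDl d2.
have r3 : r <= 3 / 4 by rewrite ge_min lexx orbT.
have := dP' r; rewrite /ball /= distrC gtr0_norm ?subr_gt0// !BE.
- rewrite (A_const r2 r3 n3) ltxx => H; have : false; last by [].
  apply: H; rewrite ltrBlDl; apply: le_lt_trans (_ : 2^-1 + d / 2 < _).
    by rewrite /r ge_min lexx.
  by rewrite ltrD2l ltr_pdivrMr// ltr_pMr// ltr1n.
- by rewrite (ltW (lt_trans n1 r2)).
- by rewrite (ltW n1) (ltW n2).
Qed.

Lemma unimodular_point : exists2 z, 2^-1 < normc z < 1 & normc (F z) = 1.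
Proof.
have [n1 n2 n3 n4 n5] := numeric.
have [s s2 pE] := circle_polar 0 p; rewrite subr0 pn in pE.
have vp : v p = 0 by have := @ext_ln_eq R Omega (fun w => (F w)^-1) 1 p (fun Op => False_ind _ (np Op)); rewrite ln1.
have : cmean v (circle 0 2^-1 s) 4^-1 = v (circle 0 2^-1 s).
  have n6 : 2^-1 + 4^-1 < 1 :> R by rewrite n5.
  refine (@submean_rigid R v 2^-1 4^-1 1 (ltW n1) n4 n6 v_continuous v_submean _ s s2).
  move=> x /andP[x0]; rewrite n5 A_half => x3; exact: A_mono.
(* The radius 1/4 keeps the circle about p inside |z| <= 3/4; its outermost point has modulus 3/4
   and lies where v = - ln |F|. *)
rewrite -pE vp => mp; have [t tt tE] := circle_extend 0 p n4.
have c1 u : normc (circle p 4^-1 u) < 1.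
  rewrite -[circle _ _ _](subrK p); apply: le_lt_trans (normcD _ _) _.
  by rewrite normc_circle (ger0_norm n4) pn [4^-1 + _]addrC n5.
have vt : v (circle p 4^-1 t) = 0.
  apply: (@mean_ge0_eq0 R (fun u => v (circle p 4^-1 u))) => //.
  - exact: (@continuous_on_circle R v p 4^-1 (fun u => v_continuous (c1 u))).
  - by move=> u; exact: v_ge0.
  - by rewrite -[leRHS]mp.
rewrite !subr0 pn n5 in tE.
exists (circle p 4^-1 t); first by rewrite tE n2 n3.
have := v_outer (z := circle p 4^-1 t); rewrite tE n2 n3 => /(_ isT).
rewrite vt => /eqP; rewrite eq_sym oppr_eq0 => /eqP l0.
rewrite -[LHS]lnK ?posrE ?normc_gt0 ?quotient_neq0// ?l0 ?expR0//.
by apply: Obig; rewrite tE n2 n3.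
Qed.

(** Two passes with opposite bounds. On the annulus |F| <= 1 makes F constant. Then v = 0 there, so
    by monotone means v = 0 on the whole disk, and the resulting |1 / F| <= 1 makes 1 / F constant
    on the connected set Omega. *)
Lemma quotient_const : exists2 c, normc c = 1 & forall z, Omega z -> F z = c.
Proof.
have [z1 z1b Fz1] := unimodular_point; exists (F z1) => //.
have F0 : F z1 != 0 by rewrite -normc_gt0 Fz1.
have rim z : 2^-1 < normc z < 1 -> F z = F z1.
  move=> zb; apply: (mulfI (invr_neq0 F0)); rewrite mulVf//.
  refine (@strong_max R (fun w => (F z1)^-1 * F w) [set w | 2^-1 < normc w < 1] z1
    (annulus_connected _) z1b _ _ _ (mulVf F0) z zb).
  - by rewrite invr_ge0.
  - move=> w wb; have [w2 w1] := andP wb.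
    exists (Num.min (normc w - 2^-1) (1 - normc w)).
      by rewrite lt_min !subr_gt0 w2 w1.
    move=> u; rewrite lt_min => /andP[u1 u2]; apply/andP; split.
      have := normcB_ge w u; rewrite normcBC => h.
      by move: (le_lt_trans h u1); rewrite ltrD2l ltrN2.
    have := le_lt_trans (normcB_ge u w) u2; by rewrite ltrD2r.
  - by move=> w /Obig Ow; apply: holo_nearZ; exact: quotient_holo_near.
  - by move=> w wb; rewrite normcM normcV Fz1 invr1 mul1r; exact: quotient_outer_le1.
have v0 z : normc z < 1 -> v z = 0.
  move=> z1'; pose r := (Num.max (normc z) 2^-1 + 1) / 2.
  have [zr r2 r1] : [/\ normc z < r, 2^-1 < r & r < 1].
    have M1 : Num.max (normc z) 2^-1 < 1 by rewrite gt_max z1' invf_lt1// ltr1n.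
    have Mr : Num.max (normc z) 2^-1 < r by rewrite /r midf_lt.
    by split; [apply: le_lt_trans Mr; rewrite le_max lexx|
      apply: le_lt_trans Mr; rewrite le_max lexx orbT|rewrite /r midf_lt].
  have r0 : 0 <= r by apply: le_trans (ltW zr); exact: normc_ge0.
  have cr : cmean v 0 r = 0.
    rewrite -[RHS]mean_cst; apply: eq_mean => t.
    have tb : 2^-1 < normc (circle 0 r t : C) < 1 by rewrite normc_circle0 ?r2.
    by rewrite v_outer// rim// Fz1 ln1 oppr0.
  have [t tt zE] := circle_polar 0 z; rewrite subr0 in zE; rewrite zE.
  refine (@mean_ge0_eq0 R (fun t => v (circle 0 (normc z) t))
    (v_circle (normc_ge0 z) z1') (fun t => v_ge0 _) _ t tt).
  by rewrite -[leRHS]cr; exact: (A_mono (normc_ge0 z) (ltW zr) r1).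
move=> z Oz; have Fz0 := quotient_neq0 Oz.
suff : F z1 * (F z)^-1 = 1 by move=> h; rewrite -[LHS]mul1r -h divfK.
refine (@strong_max R (fun w => F z1 * (F w)^-1) Omega z1 Oc (Obig z1b) _ _ _ (divff F0) z Oz).
- by move=> w Ow; have [d d0 dO] := open_disk oO Ow; exists d => // u /ltW; exact: dO.
- by move=> w Ow; apply: holo_nearZ; exact: inv_holo_near.
- move=> w Ow; have Fw0 : 0 < normc (F w)^-1 by rewrite normc_gt0 invr_eq0 quotient_neq0.
  rewrite normcM Fz1 mul1r -ler_ln ?posrE// ln1 -(v0 w (O1 Ow)).
  refine (@ext_ln_ge_ln R Omega (fun u => (F u)^-1) 1 w ltr01 Ow _).
  by rewrite invr_eq0 quotient_neq0.
Qed.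

End Rigidity.

(** * The disk with equally spaced short slits on |z| = 1/2 *)

Section SlitDomain.
Context {R : realType}.
Local Notation C := R[i].
Implicit Types (m : nat) (al s t : R) (z w : C).

Definition slit_angle m (j : nat) : R := 2 * pi / m%:R * j%:R.

Definition slit m al (j : nat) : set C :=
  circular_arc 2^-1 (slit_angle m j) (slit_angle m j + al).

Definition slit_domain m al : set C :=
  unit_disk `\` \bigcup_(j : 'I_m) slit m al j.

Lemma sector_gt0 m : (0 < m)%N -> 0 < 2 * pi / m%:R :> R.
Proof. by move=> m0; rewrite divr_gt0 ?twopi_gt0// ltr0n. Qed.

(* Two angles agreeing modulo 2 pi differ by a multiple of the sector 2 pi / m
   once their sector indices are removed. *)
Lemma sector_index m i j s t : (0 < m)%N -> `|s - t| < 2 * pi / m%:R ->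
  expi (slit_angle m i + s) = expi (slit_angle m j + t) ->
  i = j %[mod m] /\ s = t.
Proof.
move=> m0 st e; have w0 := sector_gt0 m0.
have [|N] := @expi_eq1 R (slit_angle m i + s - (slit_angle m j + t)).
  by rewrite expiD expiN e divff// expi_neq0.
have -> : 2 * pi = 2 * pi / m%:R * m%:R :> R by rewrite divfK// pnatr_eq0 -lt0n.
rewrite /slit_angle; set w := 2 * pi / m%:R in w0 st * => eN.
pose M : int := j%:Z - i%:Z + m%:Z * N.
have stM : s - t = w * M%:~R.
  rewrite /M !rmorphD rmorphN rmorphM /= -!pmulrn.
  transitivity ((w * i%:R + s - (w * j%:R + t)) + w * (j%:R - i%:R)); first by ring.
  by rewrite eN; ring.
have : `|M| < 1.
  by rewrite -(ltr_int R) intr_norm -(ltr_pM2l w0) mulr1 -[X in X * _]gtr0_norm//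
    -normrM -stM.
rewrite ltNge -gtz0_ge1 normr_gt0 negbK => /eqP M0.
have ij : i%:Z = j%:Z + N * m%:Z by move: M0; rewrite /M; lia.
split; last by apply/eqP; rewrite -subr_eq0 stM M0 mulr0.
apply/eqP; rewrite -eqz_nat -!modz_nat ij addrC modzMDl//.
Qed.

Lemma normc_slit m al j z : slit m al j z -> normc z = 2^-1.
Proof.
by move=> [t _ <-]; rewrite normcM normc_expi mulr1 normc_real gtr0_norm// invr_gt0.
Qed.

Lemma slit_eq m al j z : slit m al j z -> exists2 s, 0 <= s <= al &
  z = (2^-1 : R)%:C%C * expi (slit_angle m j + s).
Proof.
move=> [t /=]; rewrite in_itv /= => /andP[t1 t2] <-; exists (t - slit_angle m j).
  by rewrite subr_ge0 t1 lerBlDl.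
by rewrite addrC subrK.
Qed.

Lemma half_C_neq0 : (2^-1 : R)%:C%C != 0 :> C.
Proof. by rewrite -normc_gt0 normc_real normr_gt0 invr_eq0 pnatr_eq0. Qed.

Lemma slit_disjoint m al (i j : 'I_m) : al < 2 * pi / m%:R -> i != j ->
  slit m al i `&` slit m al j = set0.
Proof.
move=> alm ij; apply/seteqP; split=> // z [/slit_eq[s s0 ->] /slit_eq[t t0]].
move=> /(mulfI half_C_neq0) e; case/negP: ij; apply/eqP/val_inj => /=.
have m0 := leq_ltn_trans (leq0n i) (ltn_ord i).
have [|+ _] := @sector_index m i j s t m0 _ e; last by rewrite !modn_small.
by apply: le_lt_trans alm; rewrite ler_norml; lra.
Qed.

(** The angle is the middle of the gap that follows slit 0; the radius in this direction joins the
    two sides of the circle |z| = 1/2. *)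
Lemma slit_gap m al (i : 'I_m) : 0 < al < 2 * pi / m%:R ->
  ~ slit m al i (circle 0 2^-1 ((al + 2 * pi / m%:R) / 2)).
Proof.
move=> ww /slit_eq[t tt]; rewrite /circle add0r => /(mulfI half_C_neq0).
set s := (_ / 2); have sal : al < s < 2 * pi / m%:R.
  by case/andP: ww => h1 h2; rewrite /s !midf_lt.
have -> : s = slit_angle m 0 + s by rewrite /slit_angle mulr0 add0r.
move=> e; have m0 := leq_ltn_trans (leq0n i) (ltn_ord i).
have [|_ st] := @sector_index m 0 i s t m0 _ e.
  clear e; move: sal tt ww; clearbody s; move: (2 * pi / m%:R) => w.
  by case/andP=> s1 s2 /andP[t1 t2] /andP[w1 w2]; rewrite ltr_norml; lra.
by case/andP: sal; rewrite st ltNge; case/andP: tt => _ ->.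
Qed.

Lemma slit_domainE m al z : normc z < 1 -> normc z != 2^-1 -> slit_domain m al z.
Proof. by move=> z1 zh; split=> // -[j _ /normc_slit zE]; rewrite zE eqxx in zh. Qed.

Lemma slit_domain_outside m al z : normc z < 1 -> ~ slit_domain m al z ->
  exists j : 'I_m, slit m al j z.
Proof.
by move=> z1 nz; apply: contrapT => no; apply: nz; split=> // -[j _ zj]; apply: no; exists j.
Qed.

Lemma slit_domain0 m al : slit_domain m al 0.
Proof. by apply: slit_domainE; rewrite normc0 ?ltr01// lt_eqF// invr_gt0. Qed.

Lemma closed_slit m al j : closed (slit m al j).
Proof.
apply: compact_closed; first exact: norm_hausdorff.
apply: continuous_compact; last exact: segment_compact.
apply: continuous_subspaceT => t.
exact: (@continuousM C R (fun=> (2^-1 : R)%:C%C) expi t (cvg_cst _)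
  (@continuous_expi R t)).
Qed.

Lemma open_unit_disk : open (unit_disk : set C).
Proof.
rewrite openE => z z1; apply/nbhs_normcP; exists (1 - normc z); first by rewrite subr_gt0.
by move=> w /(le_lt_trans (normcB_ge w z)); rewrite ltrD2r.
Qed.

Lemma open_slit_domain m al : open (slit_domain m al).
Proof.
rewrite /slit_domain setDE; apply: openI; first exact: open_unit_disk.
apply: closed_openC.
by apply: closed_bigcup => [|j _]; [exact: finite_finset|exact: closed_slit].
Qed.

(** A point with |z| <= 1/2 is joined to 0 by its own radius, which meets the circle of the slits at
    most at z. Any other point is joined within the outer annulus to the radius that passes through
    the gap. *)
Lemma slit_domain_connected m al : 0 < al < 2 * pi / m%:R ->
  connected (slit_domain m al).
Proof.
move=> ww; apply: (@star_connected R _ 0) => z Oz; have [z1 _] := Oz.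
have [t0 _ zE] := polar0 z.
have [zh|zh] := leP (normc z) 2^-1.
  exists ((fun x => circle 0 x t0) @` `[0, normc z]); split.
  - by apply: interval_image_connected; exact: continuous_ray.
  - move=> w [x /=]; rewrite in_itv /= => /andP[x0 xz] <-.
    have [->|nxz] := eqVneq x (normc z); first by rewrite -zE.
    have xh : x < 2^-1 by apply: lt_le_trans zh; rewrite lt_neqAle nxz.
    by apply: slit_domainE; rewrite normc_circle0// ?lt_eqF// (le_lt_trans xz).
  - exists 0; first by rewrite /= in_itv /= lexx normc_ge0.
    by rewrite /circle mul0r addr0.
  - by exists (normc z) => //; rewrite /= in_itv /= lexx normc_ge0.
set th : R := (al + 2 * pi / m%:R) / 2.
have h34 : 2^-1 < (3 / 4 : R) < 1 by apply/andP; split; lra.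
have h0 : 0 <= 2^-1 :> R by rewrite invr_ge0.
have [|B [cB Bb Bx Bz]] := @annulus_joint R 2^-1 1 (3 / 4) th z h0 h34.
  by rewrite zh.
exists (((fun x => circle 0 x th) @` `[0, (3 / 4)%R]) `|` B); split.
- apply: connectedU => //.
    exists (circle 0 (3 / 4) th); split=> //; exists (3 / 4) => //.
    by rewrite /= in_itv /= lexx andbT; lra.
  by apply: interval_image_connected; exact: continuous_ray.
- move=> w [[x /=]|/Bb /andP[w1 w2]]; last by apply: slit_domainE; rewrite // gt_eqF.
  rewrite in_itv /= => /andP[x0 x34] <-.
  have x1 : x < 1 by lra.
  have [->|xh] := eqVneq x 2^-1; last by apply: slit_domainE; rewrite normc_circle0.
  split; first by rewrite /unit_disk /mkset normc_circle0//; lra.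
  by case=> j _; exact: slit_gap.
- left; exists 0; first by rewrite /= in_itv /= lexx; lra.
  by rewrite /circle mul0r addr0.
- by right.
Qed.

End SlitDomain.

(** * The barrier polynomial and the length of the slits *)

Section SlitPolynomial.
Context {R : realType}.
Local Notation C := R[i].
Implicit Types (m : nat) (al r s t e : R) (z w : C).

(** The zeros are the starting points of the slits, which do not depend on the length al; so al can
    be chosen after the winding number of this polynomial is known. *)
Definition slit_poly m z : C := \prod_(j < m) (z - circle 0 2^-1 (slit_angle m j)).

Lemma normc_slit_poly m z :
  normc (slit_poly m z) = \prod_(j < m) normc (z - circle 0 2^-1 (slit_angle m j)).
Proof. by apply: big_morph; [exact: normcM|exact: normc1]. Qed.

Lemma slit_poly_cdiff m z : cdiff (slit_poly m) z.
Proof.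
refine (@cdiff_prod R m (fun j w => w - circle 0 2^-1 (slit_angle m j)) z _) => j _.
exact: (cdiffB (@cdiff_id R z) (@cdiff_cst R _ z)).
Qed.

Lemma slit_poly_neq0 m z :
  (forall j : 'I_m, z != circle 0 2^-1 (slit_angle m j)) -> slit_poly m z != 0.
Proof. by move=> nz; apply/prodf_neq0 => j _; rewrite subr_eq0. Qed.

Lemma circle_slit m al s (j : nat) : 0 <= s <= al ->
  slit m al j (circle 0 2^-1 (slit_angle m j + s)).
Proof.
move=> /andP[s0 sal]; exists (slit_angle m j + s); last by rewrite /circle add0r.
by rewrite /= in_itv /= lerDl s0 lerD2l.
Qed.

Lemma slit_poly_domain_neq0 m al z : 0 <= al -> slit_domain m al z ->
  slit_poly m z != 0.
Proof.
move=> al0 [_ nz]; apply: slit_poly_neq0 => j; apply/eqP => zE; apply: nz; exists j => //.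
by rewrite zE -[slit_angle m j]addr0; apply: circle_slit; rewrite lexx.
Qed.

(** Each factor is at least 3/4 - 1/2. *)
Lemma slit_poly_lower m z : 3 / 4 <= normc z -> 4^-1 ^+ m <= normc (slit_poly m z).
Proof.
move=> z34; have -> : 4^-1 ^+ m = \prod_(j < m) (4^-1 : R).
  by rewrite prodr_const card_ord.
rewrite normc_slit_poly; apply: ler_prod => j _; apply/andP; split; first by lra.
apply: le_trans (normcB_ge z _); rewrite normc_circle0; last by lra.
by move: z34; move: (normc z) => u; lra.
Qed.

(** Continuity at the zero that starts each slit gives a length for that slit, and [common_radius]
    one for all of them. *)
Lemma slit_poly_small m e : 0 < e -> exists2 r0, 0 < r0 &
  forall j, (j < m)%N -> forall r, 0 < r < r0 -> forall s, 0 <= s <= r ->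
    normc (slit_poly m (circle 0 2^-1 (slit_angle m j + s))) < e.
Proof.
move=> e0; apply: (@common_radius R m (fun j r => forall s, 0 <= s <= r ->
  normc (slit_poly m (circle 0 2^-1 (slit_angle m j + s))) < e)) => j jm.
have cP : {for circle 0 2^-1 (slit_angle m j), continuous (fun w => normc (slit_poly m w))}.
  by apply/continuous_normcE; exact: (cdiff_continuous (slit_poly_cdiff m _)).
have P0 : slit_poly m (circle 0 2^-1 (slit_angle m j)) = 0.
  by rewrite /slit_poly (bigD1 (Ordinal jm)) //= subrr mul0r.
have [d d0 Pd] := (continuous_CRP _ _).1 cP _ e0.
have : nbhs (slit_angle m j) (circle 0 2^-1 @^-1` [set w : C |
    normc (w - circle 0 2^-1 (slit_angle m j)) < d]).
  apply: (@continuous_circle R 0 2^-1 (slit_angle m j)).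
  by apply/nbhs_normcP; exists d.
case/nbhs_ballP => r0 /= r00 rd; exists r0 => // r /andP[_ rr] s /andP[s0 sr].
have /Pd : normc (circle 0 2^-1 (slit_angle m j + s) -
    circle 0 2^-1 (slit_angle m j) : C) < d.
  apply: rd; rewrite /ball /= opprD addNKr normrN ger0_norm//.
  exact: le_lt_trans rr.
by rewrite P0 normc0 subr0 ger0_norm// normc_ge0.
Qed.

(* The winding number q of P along |z| = 3/4 does not involve the slits, which
   are then taken so short that P is tiny on them compared with its size on the
   annulus, by the factor that q demands. *)
Lemma slit_barrier m : (0 < m)%N ->
  exists (al : R) (K : nat) (k : R) (q : int),
  [/\ 0 < al < 2 * pi / m%:R, 0 < k /\ (`|q| < K)%N,
    cmean (fun z => ln (normc (slit_poly m z))) 0 (7 / 8) -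
    cmean (fun z => ln (normc (slit_poly m z))) 0 (3 / 4) =
      q%:~R * (ln (7 / 8) - ln (3 / 4)),
    forall z, 3 / 4 <= normc z <= 7 / 8 -> 2 ^+ K * k <= normc (slit_poly m z) &
    forall z, normc z < 1 -> ~ slit_domain m al z ->
      4 ^+ K * normc (slit_poly m z) < k].
Proof.
move=> m0; have h3 : 0 < 3 / 4 :> R by lra.
have h7 : 0 < 7 / 8 :> R by lra.
have h37 : 3 / 4 <= 7 / 8 :> R by lra.
have h43 : 2^-1 < 3 / 4 :> R by lra.
have l37 : ln (3 / 4) <= ln (7 / 8) :> R by rewrite ler_ln ?posrE.
have [|q Hq] := @log_mean_winding R (slit_poly m) 0 _ _ l37.
  move=> z; rewrite !lnK ?posrE// subr0 => /andP[z3 _].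
  split; first exact: slit_poly_cdiff.
  apply: slit_poly_neq0 => j; apply/eqP => zE; move: z3.
  by rewrite zE normc_circle0 ?invr_ge0// leNgt h43.
(* K is the least exponent above |q|, and 2 ^ K k is exactly the lower bound of
   [slit_poly_lower]. *)
pose K := `|q|.+1; pose k : R := 4^-1 ^+ m / 2 ^+ K.
have k0 : 0 < k by rewrite divr_gt0// exprn_gt0// invr_gt0.
have K0 : 0 < 4 ^+ K :> R by rewrite exprn_gt0.
have [r0 r00 Hr] := @slit_poly_small m (k / 4 ^+ K) (divr_gt0 k0 K0).
have w0 := @sector_gt0 R m m0.
(* Below r0 the polynomial is small on the slits; below the sector width the slits are disjoint with
   gaps between them. *)
pose al := Num.min r0 (2 * pi / m%:R) / 2.
have M0 : 0 < Num.min r0 (2 * pi / m%:R) by rewrite lt_min r00.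
have al0 : 0 < al by rewrite divr_gt0.
have aM : al < Num.min r0 (2 * pi / m%:R).
  by rewrite /al ltr_pdivrMr// ltr_pMr// ltr1n.
have [ar aw] : al < r0 /\ al < 2 * pi / m%:R by move: aM; rewrite lt_min => /andP.
exists al, K, k, q; split=> //.
- by rewrite al0.
- by have := Hq (ln (7 / 8)); rewrite !lnK ?posrE//; apply; rewrite l37 lexx.
- move=> z /andP[z3 _]; rewrite mulrC divfK; first exact: slit_poly_lower.
  by rewrite expf_neq0.
- move=> z z1 /(slit_domain_outside z1)[j /slit_eq[s sal ->]].
  rewrite mulrC -ltr_pdivlMr//.
  have := Hr j (ltn_ord j) al _ s sal; rewrite /circle add0r; apply.
  by rewrite al0.
Qed.

End SlitPolynomial.

(** * Distance to the boundary and inscribed disks *)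

Section SqueezingSlit.
Context {R : realType}.
Local Notation C := R[i].
Implicit Types (s : R) (z w b : C) (U : set C) (f : C -> C).

Lemma boundary_dist_le U b : boundary U b -> dist 0 (boundary U) <= normc b.
Proof.
move=> Ub; apply: ge_inf; last by exists b => //; rewrite sub0r normcN.
by exists 0 => _ [w _ <-]; exact: normc_ge0.
Qed.

(** The segment from 0 to w is connected and meets no boundary point of U, so its part in U, open
    and closed in it, is all of it. *)
Lemma disk_subset U s w : open U -> U 0 -> s <= dist 0 (boundary U) ->
  normc w < s -> U w.
Proof.
move=> oU U0 sd ws; pose S := (fun t : R => t%:C%C * w) @` `[0, 1].
have cS : connected S.
  apply: interval_image_connected => t.
  exact: (@continuousM C R (fun x => x%:C%C) (fun=> w) t
    (@continuous_real_complex R t) (cvg_cst _)).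
have Ss b : S b -> normc b < s.
  move=> [t /=]; rewrite in_itv /= => /andP[t0 t1] <-; apply: le_lt_trans ws.
  by rewrite normcM normc_real ger0_norm// ler_piMl// normc_ge0.
have S0 : S 0 by exists 0; rewrite ?mul0r//= in_itv /= lexx ler01.
suff : S `&` U = S.
  move=> SU; have : S w by exists 1; rewrite ?mul1r//= in_itv /= lexx ler01.
  by rewrite -SU => -[].
apply: cS; first by exists 0.
  by exists U.
exists (closure U); first exact: closed_closure.
apply/seteqP; split=> b [Sb Ub]; split=> //; first exact: subset_closure.
apply: contrapT => nUb; have bb : boundary U b.
  by split=> // /interior_subset.
by have := lt_le_trans (Ss b Sb) (le_trans sd (boundary_dist_le bb)); rewrite ltxx.
Qed.

Lemma open_image Omega f : open Omega -> (forall z, Omega z -> cdiff f z) ->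
  injective_on Omega f -> open (f @` Omega).
Proof.
move=> oO df inj; rewrite openE => _ [z Oz <-].
have [r r0 rO] := open_disk oO Oz.
have [|u v|e e0 He] := @open_map R f z r r0; first by move=> u /rO/df.
  by move=> /rO Ou /rO Ov; exact: inj.
by apply/nbhs_normcP; exists e => // w /He[u /rO Ou <-]; exists u.
Qed.

End SqueezingSlit.

(** * Extremality of the identity and uniqueness up to rotation *)

Section SlitRigidity.
Context {R : realType} (m : nat) (al k : R) (K : nat) (q : int).
Context (m0 : (0 < m)%N) (ww : 0 < al < 2 * pi / m%:R) (k0 : 0 < k).
Context (qK : (`|q| < K)%N)
  (qP : cmean (fun z : R[i] => ln (normc (slit_poly m z))) 0 (7 / 8) -
    cmean (fun z : R[i] => ln (normc (slit_poly m z))) 0 (3 / 4) =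
      q%:~R * (ln (7 / 8) - ln (3 / 4)))
  (Plow : forall z : R[i], 3 / 4 <= normc z <= 7 / 8 ->
    2 ^+ K * k <= normc (slit_poly m z))
  (Pup : forall z : R[i], normc z < 1 -> ~ slit_domain m al z ->
      4 ^+ K * normc (slit_poly m z) < k).
Local Notation C := R[i].
Implicit Types (s : R) (z w b : C) (f : C -> C).

Let Omega : set C := slit_domain m al.
Let p : C := circle 0 2^-1 0.

Lemma slit_endpoint : ~ slit_domain m al p.
Proof.
move=> [_]; apply; exists (Ordinal m0) => //.
have -> : p = circle 0 2^-1 (slit_angle m 0 + 0) by rewrite /slit_angle mulr0 addr0.
by apply: circle_slit; rewrite lexx ltW//; case/andP: ww.
Qed.

Lemma normc_slit_endpoint : normc p = 2^-1.
Proof. by rewrite normc_circle0// invr_ge0. Qed.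

(** The inequality, rather than an equality of distances, lets this serve both the bound on the
    squeezing function and the uniqueness of extremal maps. *)
Lemma slit_rigidity f : univalent_to_disk (slit_domain m al) f -> f 0 = 0 ->
  2^-1 <= dist 0 (boundary (f @` slit_domain m al)) ->
  exists2 c, normc c = 1 & forall z, slit_domain m al z -> f z = c * z.
Proof.
move=> [hf inj fD] f0 fb.
have df z : Omega z -> cdiff f z by move=> Oz; apply: derivable_cdiff; exact: hf.
have O0 : Omega 0 by exact: slit_domain0.
(* Caratheodory's form at 0, where f vanishes, provides the quotient f z / z together with its
   continuity at 0. *)
have [F cF fF] := df 0 O0.
have oO : open Omega by exact: open_slit_domain.
have sur w : normc w < 2^-1 -> (f @` Omega) w.
  move=> wh; refine (disk_subset (open_image oO df inj) _ fb wh); by exists 0.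
have [c c1 Fc] := @quotient_const R Omega f F p oO (fun z Oz => Oz.1)
  (slit_domain_connected ww) (@slit_domainE R m al) normc_slit_endpoint
  slit_endpoint df inj (fun z Oz => fD _ (imageP f Oz)) f0 sur cF
  (fun z => etrans (fF z) (etrans (congr2 +%R f0 (congr2 *%R (erefl (F z)) (subr0 z)))
     (add0r _)))
  (slit_poly m) K k q (@slit_poly_cdiff R m)
  (fun z => slit_poly_domain_neq0 (ltW (andP ww).1)) k0 qK qP Plow Pup.
by exists c => // z Oz; rewrite fF f0 add0r subr0 Fc.
Qed.

Lemma dist_slit_boundary : dist 0 (boundary Omega) = 2^-1.
Proof.
have bp : boundary Omega p.
  split; last by move=> /interior_subset; exact: slit_endpoint.
  (* The point of Omega near p lies on the radius of p, at distance e / 2 from it, or is 0 if that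
     would pass the origin. *)
  move=> A /nbhs_normcP[e e0 eA]; pose r : R := Num.max 0 (2^-1 - e / 2).
  have r0 : 0 <= r by rewrite le_max lexx.
  have h0 : 0 <= 2^-1 :> R by rewrite invr_ge0.
  have [r1 r2] : r < 2^-1 /\ 2^-1 - r < e.
    have : r = 0 /\ 2^-1 <= e / 2 \/ r = 2^-1 - e / 2.
      by rewrite /r maxEle; case: ifP; [right|left; split=> //; lra].
    by case=> [[-> ?]|->]; split; lra.
  exists (circle 0 r 0); split.
    apply: slit_domainE; rewrite normc_circle0// ?lt_eqF//.
    by apply: lt_trans r1 _; lra.
  apply: eA; rewrite /p /circle !add0r -mulrBl -rmorphB normcM normc_expi mulr1.
  by rewrite normc_real distrC gtr0_norm ?subr_gt0.
apply/eqP; rewrite eq_le -{1}normc_slit_endpoint (boundary_dist_le bp) /=.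
apply: lb_le_inf => [|_ [b [_ nb] <-]]; first by exists (normc (0 - p)), p.
rewrite sub0r normcN leNgt; apply/negP => bh; apply: nb.
apply/nbhs_normcP; exists (2^-1 - normc b); first by rewrite subr_gt0.
move=> w /(le_lt_trans (normcB_ge w b)); rewrite ltrD2r => wh.
by apply: slit_domainE; [apply: lt_trans wh _; lra|rewrite lt_eqF].
Qed.

Lemma id_univalent : univalent_to_disk Omega id.
Proof.
by split=> [z _|//|_ [z [z1 _] <-]]; first exact: derivable_id.
Qed.

(** If the distance exceeded 1/2, f would be z to c z with |c| = 1, and its image would contain c p,
    of modulus 1/2; then p would lie in Omega. *)
Lemma slit_dist_le f : univalent_to_disk Omega f -> f 0 = 0 ->
  dist 0 (boundary (f @` Omega)) <= 2^-1.
Proof.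
move=> uf f0; rewrite leNgt; apply/negP => fb; have [hf inj _] := uf.
have [c c1 fc] := slit_rigidity uf f0 (ltW fb).
have oO : open (f @` Omega).
  apply: open_image => //; first exact: open_slit_domain.
  by move=> z Oz; apply: derivable_cdiff; exact: hf.
have [||z Oz zE] := disk_subset (w := c * p) oO _ (lexx _).
- by exists 0 => //; exact: slit_domain0.
- by rewrite normcM c1 mul1r normc_slit_endpoint.
have c0 : c != 0 by rewrite -normc_gt0 c1.
by move: zE; rewrite (fc z Oz) => /(mulfI c0) zp; apply: slit_endpoint; rewrite -zp.
Qed.

Lemma squeezing_slit : squeezing Omega 0 = 2^-1.
Proof.
have mem : [set dist 0 (boundary (f @` Omega))
    | f in [set f | univalent_to_disk Omega f /\ f 0 = 0]] (2^-1 : R).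
  by exists id; [split=> //; exact: id_univalent|rewrite image_id dist_slit_boundary].
have ub : ubound [set dist 0 (boundary (f @` Omega))
    | f in [set f | univalent_to_disk Omega f /\ f 0 = 0]] (2^-1 : R).
  by move=> _ [f [uf f0] <-]; exact: slit_dist_le.
apply/eqP; rewrite eq_le ge_sup//=; last by exists 2^-1.
by apply: ub_le_sup => //; exists 2^-1.
Qed.

End SlitRigidity.

Theorem theorem3 (R : realType) (n : nat) (hn : (3 <= n)%N) :
  exists Omega : set R[i],
    [/\ circularly_slit_disk n Omega,
        Omega 0,
        extremal_domain Omega 0 Omega,
        squeezing Omega 0 = dist 0 (boundary Omega)
      & forall f : R[i] -> R[i], extremal Omega 0 f ->
          exists theta : R, f @` Omega = rotate theta Omega].
Proof.
have m0 : (0 < n.-1)%N by case: n hn => [|[]].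
have [al [K [k [q [ww [k0 qK] qP Plow Pup]]]]] := @slit_barrier R n.-1 m0.
have sq := squeezing_slit m0 ww k0 qK qP Plow Pup.
have db := dist_slit_boundary m0 ww.
exists (slit_domain n.-1 al); split.
- split.
    split; [exact: open_slit_domain|exact: slit_domain_connected|].
    by exists 0; exact: slit_domain0.
  exists (fun j : 'I_n.-1 => slit n.-1 al j); split=> //.
    move=> j; exists 2^-1, (slit_angle n.-1 j), (slit_angle n.-1 j + al).
    case/andP: ww => al0 alw; split=> //; first by rewrite invr_gt0 ltr0n invf_lt1 ?ltr1n.
    rewrite ltrDl al0 ltrD2l (lt_le_trans alw)// ler_pdivrMr ?ltr0n//.
    by rewrite ler_peMr ?ler1n// ltW// twopi_gt0.
  by move=> i j; apply: slit_disjoint; case/andP: ww.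
- exact: slit_domain0.
- exists id; last by rewrite image_id.
  by split=> //; [exact: id_univalent|rewrite image_id db].
- by rewrite sq db.
- move=> f [uf f0 fd].
  have [|c c1 fc] := slit_rigidity m0 ww k0 qK qP Plow Pup uf f0.
    by rewrite fd sq.
  have [t _ cE] := polar c; exists t; rewrite c1 mul1r in cE.
  by apply/seteqP; split=> _ [z Oz <-]; exists z => //; rewrite fc// cE.
Qed.
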